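(* Consider the contaminated AR($p$) model, the residuals $\hat\varepsilon_t$, and the empirical distribution functions $\hat G_n$ (of the residuals) and $G_n$ (of the innovations) described in the context. Suppose that the distribution function $G$ of the innovations is differentiable with derivative (density) $g$, and that $\sup_x|g'(x)|<\infty$. Let $\Gamma\ge 0$ be any real number and let $x\in\mathbb{R}$. Then for every $\delta>0$, $$\sup_{\gamma\le\Gamma}\mathsf{P}\Big(\big|\,n^{1/2}[\hat G_n(x)-G_n(x)]-g(x)(1-\beta_1-\dots-\beta_p)\,n^{1/2}(\hat\mu_n-\mu)-\gamma\Delta(x,\Pi)\big|>\delta\Big)\to 0,\qquad n\to\infty,$$ where $$\Delta(x,\Pi)=\sum_{j=0}^p\big[\mathsf{E}\,G(x+\beta_j\xi_j)-G(x)\big],\qquad \beta_0=-1,$$ and each $\xi_j$ has distribution $\Pi$.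
   Context: Model. Let $\{v_t\}_{t\in\mathbb{Z}}$ be the stationary solution of $v_t=\beta_1v_{t-1}+\dots+\beta_pv_{t-p}+\nu+\varepsilon_t$, $t\in\mathbb{Z}$, where $\{\varepsilon_t\}$ are i.i.d. with unknown distribution function $G$, $\mathsf{E}\varepsilon_1=0$, $0<\mathsf{E}\varepsilon_1^2<\infty$; $\boldsymbol\beta=(\beta_1,\dots,\beta_p)^T$ is a vector of unknown parameters such that all roots of the corresponding characteristic equation $x^p-\beta_1x^{p-1}-\dots-\beta_p=0$ have modulus less than $1$; and $\nu\in\mathbb{R}$ is an unknown constant. Define $\mu$ by $\nu=(1-\beta_1-\dots-\beta_p)\mu$. Observations with outliers. One observes $y_t=v_t+z_t^{\gamma_n}\xi_t$, $t=1-p,\dots,n$, where $\{z_t^{\gamma_n}\}$ are i.i.d. with values in $\{0,1\}$ and $\mathsf{P}(z_t^{\gamma_n}=1)=\gamma_n=\min(1,\gamma/\sqrt n)$, $\gamma\ge0$ unknown; $\{\xi_t\}$ are i.i.d. random variables with arbitrary unknown distribution $\Pi$. Estimators. $\hat\mu_n$ and $\hat{\boldsymbol\beta}_n=(\hat\beta_{1n},\dots,\hat\beta_{pn})^T$ are any sequences for which $n^{1/2}(\hat\mu_n-\mu)=O_P(1)$ and $n^{1/2}(\hat{\boldsymbol\beta}_n-\boldsymbol\beta)=O_P(1)$ as $n\to\infty$, uniformly in $\gamma\le\Gamma<\infty$. Residuals. $\hat u_t=y_t-\hat\mu_n$ for $t=1-p,\dots,n$, and $\hat\varepsilon_t=\hat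 u_t-\hat\beta_{1n}\hat u_{t-1}-\dots-\hat\beta_{pn}\hat u_{t-p}$ for $t=1,\dots,n$. Empirical distribution functions. $\hat G_n(x)=n^{-1}\sum_{t=1}^nI(\hat\varepsilon_t\le x)$ and $G_n(x)=n^{-1}\sum_{t=1}^nI(\varepsilon_t\le x)$, $x\in\mathbb{R}$, with $I(\cdot)$ the indicator.
   Formalization: The innovations ε_t, the contamination indicators z_t and the outlier sizes ξ_t are additionally assumed to be mutually independent sequences; without this the claim fails (e.g. β=0, ξ_t=−2ε_t with ε_t standard normal and z independent of ε). *)

(* Defs.v *)
From HB Require Import structures.
From mathcomp Require Import all_boot all_order all_algebra complex.
From mathcomp Require Import all_classical all_reals all_analysis.

Set Implicit Arguments.
Unset Strict Implicit.
Unset Printing Implicit Defensive.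

Import Order.TTheory GRing.Theory Num.Theory.
Import numFieldNormedType.Exports.

Local Open Scope classical_set_scope.
Local Open Scope ring_scope.

(* The coefficients beta_1, ..., beta_p are stored with a shift:               *)
(* beta_(j+1) is [beta j 0] for j : 'I_p.                                      *)

Section ar_model.
Context {R : realType} {p : nat}.
Implicit Type beta : 'cV[R]_p.

Definition ar_charpoly beta : {poly R} :=
  'X^p - \sum_(j < p) beta j 0 *: 'X^(p - j.+1).

(* In R[i] the norm is a (real) complex number, and `|w| < 1 is the usual      *)
(* comparison of moduli.                                                       *)
Definition ar_stable beta : Prop :=
  forall w : R[i], root (map_poly (real_complex R) (ar_charpoly beta)) w ->
    `|w| < 1.

(* 1 - beta_1 - ... - beta_p *)
Definition ar_at1 beta : R := 1 - \sum_(j < p) beta j 0.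

(* The vector (beta_0, beta_1, ..., beta_p) with beta_0 = -1. *)
Definition ar_coef0 beta (j : 'I_p.+1) : R :=
  if unlift ord0 j is Some i then beta i 0 else -1.

Definition ar_residual (b : 'cV[R]_p) (m : R) (y : int -> R) (t : int) : R :=
  (y t - m) - \sum_(j < p) b j 0 * (y (t - (j.+1)%:Z) - m).

Definition Delta beta (G : R -> R) (Pi : probability R R) (x : R) : R :=
  \sum_(j < p.+1)
    (fine ('E_Pi [fun u : R => G (x + ar_coef0 beta j * u)%R])%E - G x).

End ar_model.

Definition contamination_rate {R : realType} (gamma : R) (n : nat) : R :=
  Num.min 1 (gamma / Num.sqrt n%:R).

(* Empirical distribution function of e_1, ..., e_n. *)
Definition edf {R : realType} (n : nat) (e : int -> R) (x : R) : R :=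
  n%:R^-1 * \sum_(1 <= t < n.+1) (e t%:Z <= x)%R%:R.

Section stochastic.
Context {d : measure_display} {T : measurableType d} {R : realType}.
Variable P : probability T R.

Definition mutually_independent (I : eqType) (X : I -> {RV P >-> R}) : Prop :=
  forall (s : seq I) (B : I -> set R), uniq s ->
    (forall i, measurable (B i)) ->
    P (\bigcap_(i in [set` s]) (X i @^-1` B i)) =
    (\prod_(i <- s) P (X i @^-1` B i))%E.

(* Three sequences merged into one family: its mutual independence says that   *)
(* each sequence is independent and that the three sequences are independent   *)
(* of each other.                                                              *)
Definition noise_family (eps z xi : int -> {RV P >-> R})
    (i : int + int + int) : {RV P >-> R} :=
  match i with
  | inl (inl t) => eps t
  | inl (inr t) => z t
  | inr t => xi t
  end.

(* Strict stationarity; the finite-dimensional laws are compared on            *)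
(* rectangles, which determine them.                                           *)
Definition strictly_stationary (v : int -> {RV P >-> R}) : Prop :=
  forall (h : int) (s : seq int) (B : int -> set R),
    (forall t, measurable (B t)) ->
    P (\bigcap_(t in [set` s]) (v (t + h) @^-1` B t)) =
    P (\bigcap_(t in [set` s]) (v t @^-1` B t)).

Definition stationary_ar_solution (p : nat) (beta : 'cV[R]_p) (nu : R)
    (eps v : int -> {RV P >-> R}) : Prop :=
  strictly_stationary v /\
  forall t : int, {ae P, forall w,
    v t w = \sum_(j < p) beta j 0 * v (t - (j.+1)%:Z) w + nu + eps t w}.

Definition contaminated (v z xi : int -> {RV P >-> R}) (w : T) (t : int) : R :=
  v t w + z t w * xi t w.

(* X gamma n = O_P(1) as n -> oo, uniformly in 0 <= gamma <= Gamma, for every  *)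
(* finite Gamma.                                                               *)
Definition uniform_OP1 (V : normedModType R) (X : R -> nat -> T -> V) : Prop :=
  forall Gamma : R, forall eta : R, 0 < eta -> exists M : R,
    \forall n \near \oo, forall gamma : R, 0 <= gamma <= Gamma ->
      (P [set w | (M < `|X gamma n w|)%R] <= eta%:E)%E.

End stochastic.

(* Main.v *)
(** Write u = v - mu, a = sqrt n (muhat - mu), b = sqrt n (betahat - beta),
q = 1 / sqrt n, zeta = z xi and kappa = 1 - sum beta_j. The residual is
eps_t minus sum_(j <= p) beta_j zeta_(t-j) minus q (sum b_j (u + zeta)_(t-j) + c)
with c = kappa a - q a sum b_j, so up to a negligible error its indicator splits
into an outlier-free part and the sum over j <= p of
z_(t-j) [I(eps_t <= x + beta_j xi_(t-j)) - I(eps_t <= x)].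

The outlier-free part is sandwiched, on the event |a|, |b_j| <= M, between sums
with (b, c) replaced by points of a finite grid and a slack proportional to
V_t = 2 + sum |u_(t-j)|. For a fixed grid point, centering the indicators
conditionally on all the other noise variables leaves orthogonal terms, whose
sum is negligible by Chebyshev; the compensator is g(x) times the average of the
perturbations by Taylor's formula, and the averages of u_(t-j) tend to 0, which
leaves g(x) kappa a. Adaptedness of u is obtained by replacing it by
a finite moving average of eps: iterating the recursion K times leaves
a remainder linear in u_(t-K), ..., u_(t-K-p+1) with geometrically small
coefficients, and u is tight by stationarity.

The outlier part has mean q n gamma_n Delta = gamma Delta, and its three
successive centerings (in eps, xi and z) are again sums of orthogonal terms. All
estimates involve gamma only through gamma_n <= Gamma q, hence are uniform. *)

Require Import Defs.
From HB Require Import structures.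
From mathcomp Require Import all_boot all_order all_algebra complex.
From mathcomp Require Import all_classical all_reals all_analysis.
From mathcomp Require Import measurable_realfun ring lra.

Set Implicit Arguments.
Unset Strict Implicit.
Unset Printing Implicit Defensive.

Import Order.TTheory GRing.Theory Num.Theory.
Import numFieldNormedType.Exports.

Local Open Scope classical_set_scope.
Local Open Scope ring_scope.

(** Three difficulties shape the proof. The estimators are arbitrary functions of the whole sample,
    so nothing can be centered with them inside the thresholds; only their size is known, which
    forces a statement uniform over a box of values of a and b. The solution [v] is only assumed
    stationary, with neither causality nor moments given, so adaptedness and second moments are
    available for finite moving averages alone, and [v] itself enters through tightness. All moment
    bounds on these averages are free of K, so K may be chosen after n. Finally, conditional
    expectations are never formed: T is given the coarser sigma-algebra generated by all noise
    variables but one, X i; independence says that the pair (point, X i) has a product law, and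
    conditioning becomes Fubini's theorem. Limits are expressed through q with q^2 n = 1 rather than
    through n: the normalized centered sums have second moments O(q), and the other constants (grid
    step, truncation levels, tail bounds) are fixed before q is made small. *)

Lemma measurable_pred {d : measure_display} {T : measurableType d}
  (b : T -> bool) : measurable_fun setT b -> measurable [set w | b w].
Proof.
move=> mb; rewrite (_ : [set w | b w] = b @^-1` [set true]) //.
by rewrite -[X in measurable X]setTI; exact: mb.
Qed.

Lemma natb_indicE {T : Type} {R : pzRingType} (b : T -> bool) :
  (fun w => (b w)%:R : R) = \1_[set w | b w].
Proof.
apply/funext => w; rewrite indicE; congr (_%:R).
by case: (boolP (b w)) => bw; [rewrite mem_set|rewrite memNset//; apply/negP].
Qed.

Lemma measurable_natb {d : measure_display} {T : measurableType d}
  {R : realType} (b : T -> bool) :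
  measurable_fun setT b -> measurable_fun setT (fun w => (b w)%:R : R).
Proof.
by move=> mb; rewrite natb_indicE; apply/measurable_indic/measurable_pred.
Qed.

(** * First moments of nonnegative variables and Markov's inequality *)

Section mean_bounds.
Context {d : measure_display} {T : measurableType d} {R : realType}.
Variable P : probability T R.
Implicit Types (X Y : T -> R) (p q : R).

(* X >= 0 and E X <= q; the nonnegative integral needs no integrability. *)
Definition meanle (X : T -> R) (q : R) : Prop :=
  [/\ measurable_fun setT X, forall w, 0 <= X w &
      (\int[P]_w (X w)%:E <= q%:E)%E].

Lemma meanle_ge0 X q : meanle X q -> 0 <= q.
Proof.
case=> mX X0 Xq; rewrite -lee_fin; apply: le_trans Xq.
by apply: integral_ge0 => w _; rewrite lee_fin.
Qed.

Lemma meanle_le X Y q q' : meanle Y q -> measurable_fun setT X ->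
  (forall w, 0 <= X w <= Y w) -> q <= q' -> meanle X q'.
Proof.
case=> mY Y0 Yq mX XY qq'; split=> // [w|]; first by have /andP[] := XY w.
rewrite (@le_trans _ _ q%:E) ?lee_fin// (le_trans _ Yq)//.
apply: ge0_le_integral => //.
- by move=> w _; rewrite lee_fin; have /andP[] := XY w.
- exact/measurable_EFinP.
- exact/measurable_EFinP.
- by move=> w _; rewrite lee_fin; have /andP[] := XY w.
Qed.

Lemma meanle_cst (k : R) : 0 <= k -> meanle (cst k) k.
Proof.
move=> k0; split=> //.
have -> : (\int[P]_w (cst k w)%:E = k%:E * P setT)%E.
  by rewrite -integral_cst.
by rewrite probability_setT mule1.
Qed.

Lemma meanleD X Y p q : meanle X p -> meanle Y q ->
  meanle (fun w => X w + Y w) (p + q).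
Proof.
case=> mX X0 Xp [mY Y0 Yq]; split=> [|w|].
- exact: measurable_funD.
- by rewrite addr_ge0.
- under eq_integral do rewrite EFinD.
  rewrite ge0_integralD//; first by rewrite EFinD leeD.
  + by move=> w _; rewrite lee_fin.
  + exact/measurable_EFinP.
  + by move=> w _; rewrite lee_fin.
  + exact/measurable_EFinP.
Qed.

Lemma meanleZ X (k q : R) : 0 <= k -> meanle X q ->
  meanle (fun w => k * X w) (k * q).
Proof.
move=> k0 [mX X0 Xq]; split=> [|w|].
- exact: measurable_funM.
- by rewrite mulr_ge0.
- under eq_integral do rewrite EFinM.
  rewrite ge0_integralZl//; first by rewrite EFinM lee_wpmul2l.
  + exact/measurable_EFinP.
  + by move=> w _; rewrite lee_fin.
Qed.

Lemma meanle_sum (I : Type) (r : seq I) (Q : pred I) (X : I -> T -> R)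
    (q : I -> R) :
  (forall i, Q i -> meanle (X i) (q i)) ->
  meanle (fun w => \sum_(i <- r | Q i) X i w) (\sum_(i <- r | Q i) q i).
Proof.
move=> XQ; elim: r => [|i r IH].
  rewrite big_nil (_ : (fun w => _) = cst 0).
    exact: meanle_cst.
  by apply/funext => w; rewrite big_nil.
rewrite big_cons (_ : (fun w => _) = (fun w => (if Q i then X i w else 0) +
    \sum_(i <- r | Q i) X i w)); last first.
  by apply/funext => w; rewrite big_cons; case: ifP => // _; rewrite add0r.
case: ifP => Qi; first exact: meanleD (XQ _ Qi) IH.
by apply: (meanle_le IH) => // [|w]; rewrite ?add0r ?lexx ?andbT;
  case: IH => mS S0 _ //; under eq_fun do rewrite add0r.
Qed.

Lemma meanle_indic (b : T -> bool) (q : R) :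
  measurable [set w | b w] -> (P [set w | b w] <= q%:E)%E ->
  meanle (fun w => (b w)%:R) q.
Proof.
move=> mb Pb.
split=> [|w|].
- by rewrite natb_indicE; exact: measurable_indic.
- by rewrite ler0n.
- have -> : (\int[P]_w (b w)%:R%:E = \int[P]_w (\1_[set w | b w] w)%:E)%E.
    by rewrite -natb_indicE.
  by rewrite integral_indic// setIT.
Qed.

Lemma meanle_markov X (q del eta : R) : meanle X q -> 0 < del ->
  q <= del * eta ->
  exists E, [/\ measurable E, (P E <= eta%:E)%E & forall w, ~ E w -> X w <= del].
Proof.
case=> mX X0 Xq del0 qde.
pose E := [set w | del < X w].
have mE : measurable E.
  by apply: measurable_pred; apply: measurable_fun_ltr.
exists E; split=> // [|w /negP]; last by rewrite -leNgt.
rewrite -(@lee_pmul2l _ del%:E)//.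
rewrite -EFinM; apply: (@le_trans _ _ q%:E); last by rewrite lee_fin.
apply: le_trans Xq.
have -> : (del%:E * P E =
    \int[P]_w (del * \1_E w)%:E)%E.
  under eq_integral do rewrite EFinM.
  rewrite ge0_integralZl// ?integral_indic ?setIT//.
  + exact/measurable_EFinP/measurable_indic.
  + exact: ltW.
apply: ge0_le_integral => //.
- by move=> w _; rewrite lee_fin mulr_ge0// ltW.
- by apply/measurable_EFinP/measurable_funM => //; exact: measurable_indic.
- exact/measurable_EFinP.
- move=> w _; rewrite lee_fin indicE; case: (boolP (_ \in _)) => [|_].
    by rewrite inE /= mulr1 => /ltW.
  by rewrite mulr0.
Qed.

End mean_bounds.

(** Serves for the integrability of products and, with a = 1, for bounding a first absolute moment
    by a second moment. *)
Lemma normM_le_sqrD (R : realDomainType) (a b : R) :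
  `|a * b| <= a ^+ 2 + b ^+ 2.
Proof.
have := sqr_ge0 (a + b); have := sqr_ge0 (a - b).
have := sqr_ge0 a; have := sqr_ge0 b.
by rewrite ler_norml => *; apply/andP; split; lra.
Qed.

(** * Integration against one variable of an independent family *)

Section independence.
Context {d : measure_display} {T : measurableType d} {R : realType}.
Variable P : probability T R.
Variables (I : eqType) (X : I -> {RV P >-> R}).
Hypothesis indX : mutually_independent X.

Definition cylinders (i : I) : set (set T) :=
  [set C | exists (s : seq I) (B : I -> set R), [/\ uniq s, i \notin s,
    forall k, measurable (B k) &
    C = \bigcap_(k in [set` s]) (X k @^-1` B k)]].

(* T with the sigma-algebra generated by all the X k with k <> i. *)
Definition others (i : I) : Type := g_sigma_algebraType (cylinders i).

HB.instance Definition _ i := Measurable.on (others i).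

Let cylinder_measurable i C : cylinders i C -> measurable C.
Proof.
case=> s [B [us _ mB ->]]; apply: fin_bigcap_measurable.
  exact: finite_seq.
by move=> k _; rewrite -[X in measurable X]setTI; exact: (measurable_funP (X k)).
Qed.

Let cylindersI i : setI_closed (cylinders i).
Proof.
move=> _ _ [s [B [us si mB ->]]] [s' [B' [us' si' mB' ->]]].
(* Each family is padded by [setT] outside its own list, so that both constraints can be imposed on
   the merged list. *)
exists (undup (s ++ s')), (fun k => (if k \in s then B k else setT) `&`
                                (if k \in s' then B' k else setT)); split.
- exact: undup_uniq.
- by rewrite mem_undup mem_cat negb_or si.
- by move=> k; apply: measurableI; case: ifP.
- apply/seteqP; split=> [w [ws ws'] k /= | w ws].
    rewrite mem_undup mem_cat => _; split; case: ifPn => // ks;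
      [exact: ws|exact: ws'].
  split=> k /= ks.
    by have [] := ws k; rewrite /= ?mem_undup ?mem_cat ?ks.
  by have [] := ws k; rewrite /= ?mem_undup ?mem_cat ?ks ?orbT.
Qed.

Lemma measurable_others_id i : measurable_fun setT (idfun : T -> others i).
Proof.
move=> _ A mA; rewrite setTI preimage_id.
have : <<s cylinders i >> `<=` (measurable : set (set T)).
  apply: smallest_sub; first exact: sigma_algebra_measurable.
  exact: cylinder_measurable.
exact.
Qed.

(** The identity, seen as a random element of the coarser space; its law is the restriction of [P]
    to that sigma-algebra. *)
Definition idO i : T -> others i := id.

HB.instance Definition _ i := @isMeasurableFun.Build _ _ _ _ (idO i)
  (@measurable_others_id i).

Lemma measurable_other i k : k != i ->
  measurable_fun setT (X k : others i -> R).
Proof.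
move=> ki _ B mB; rewrite setTI; apply: sub_sigma_algebra.
exists [:: k], (fun=> B); split=> //.
  by rewrite inE eq_sym.
apply/seteqP; split=> [w wB j /=|w /(_ k)].
  by rewrite inE => /eqP ->.
by apply; rewrite /= inE.
Qed.

Lemma others_measurable i (h : T -> R) :
  measurable_fun setT (h : others i -> R) -> measurable_fun setT h.
Proof.
by move=> mh; exact: (measurableT_comp mh (measurable_funP (idO i))).
Qed.

Let cylinder_indep i C (B : set R) : cylinders i C -> measurable B ->
  (P (C `&` X i @^-1` B) = P C * P (X i @^-1` B))%E.
Proof.
case=> s [D [us si mD ->]] mB.
(* [D'] carries [B] at [i] and [D] elsewhere, so that one family serves in [indX] both on [s] and on
   [i :: s]. *)
pose D' k := if k == i then B else D k.
have mD' k : measurable (D' k) by rewrite /D'; case: ifP.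
have E : \bigcap_(k in [set` s]) (X k @^-1` D k) =
         \bigcap_(k in [set` s]) (X k @^-1` D' k).
  apply: eq_bigcapr => k /= ks; rewrite /D' ifN//.
  by apply: contraNneq si => <-.
rewrite E (indX us mD').
have Ei : \bigcap_(k in [set` i :: s]) (X k @^-1` D' k) =
    X i @^-1` B `&` \bigcap_(k in [set` s]) (X k @^-1` D' k).
  apply/seteqP; split=> [w ws|w [wB ws] k /=].
    split; first by have := ws i; rewrite /= inE eqxx /D' eqxx; apply.
    by move=> k ks; apply: ws; rewrite /= inE ks orbT.
  by rewrite inE => /predU1P[->|]; [rewrite /D' eqxx|exact: ws].
have usi : uniq (i :: s) by rewrite /= si.
rewrite setIC -Ei (indX usi mD') big_cons {1}/D' eqxx muleC.
by rewrite -(indX us mD').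
Qed.

(** The cylinders form a generating pi-system, and for fixed [B] the sets satisfying the product
    formula form a Dynkin class. *)
Lemma others_indep i A (B : set R) : measurable (A : set (others i)) ->
  measurable B -> (P (A `&` X i @^-1` B) = P A * P (X i @^-1` B))%E.
Proof.
move=> mA mB.
have mXB : measurable (X i @^-1` B).
  by rewrite -[X in measurable X]setTI; exact: (measurable_funP (X i)).
have mO C : measurable (C : set (others i)) -> measurable (C : set T).
  by move=> mC; have := measurable_others_id measurableT mC; rewrite setTI.
pose Q (C : set (others i)) :=
  (P ((C : set T) `&` X i @^-1` B) = P C * P (X i @^-1` B))%E.
apply: (@dynkin_induction _ (others i) (cylinders i) Q erefl) => //.
- by rewrite /Q setTI probability_setT mul1e.
- by move=> C CC; exact: cylinder_indep.
- move=> C /mO mC QC; rewrite /Q setIC -setDE measureD//; last first.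
    by rewrite -ge0_fin_numE// fin_num_measure.
  rewrite (setIC _ C) [X in (_ - X)%E]QC probability_setC// muleBl ?mul1e//.
    exact: fin_num_measure.
- move=> F mF tF QF; have mF' k := mO _ (mF k).
  rewrite /Q setI_bigcupl measure_bigcup//; last 2 first.
  + by move=> k _; apply: measurableI.
  + by apply: trivIset_setIr.
  rewrite (measure_bigcup P setT F)//.
  have cfin : P (X i @^-1` B) = (fine (P (X i @^-1` B)))%:E.
    by rewrite fineK// fin_num_measure.
  rewrite cfin muleC -nneseriesZl//.
  apply: eq_eseriesr => k _; rewrite [RHS]muleC -cfin; exact: QF.
Qed.

Let pairO i (w : T) : others i * R := (idO i w, X i w).

Let measurable_pairO i : measurable_fun setT (pairO i).
Proof.
by apply/measurable_fun_pairP; split; exact: measurable_funP.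
Qed.

HB.instance Definition _ i := @isMeasurableFun.Build _ _ _ _ (pairO i)
  (@measurable_pairO i).

(** With the joint law a product, conditioning on all variables but [X i] amounts to freezing the
    first coordinate. *)
Let law_pairO i A : measurable A ->
  distribution P (pairO i) A =
  (distribution P (idO i) \x distribution P (X i))%E A.
Proof.
move=> mA; apply/esym/product_measure_unique => // B C mB mC.
rewrite /distribution /pushforward /= -(others_indep mB mC).
by [].
Qed.

Lemma ge0_integral_others i (f : others i * R -> \bar R) :
  measurable_fun setT f -> (forall z, 0 <= f z)%E ->
  (\int[P]_w f (w, X i w) =
   \int[P]_w \int[distribution P (X i)]_x f (w, x))%E.
Proof.
move=> mf f0.
transitivity (\int[distribution P (pairO i)]_z f z)%E.
  by rewrite ge0_integral_pushforward.
transitivity (\int[(distribution P (idO i) \x distribution P (X i))%E]_z f z)%E.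
  by apply: eq_measure_integral => A mA _; exact: law_pairO.
rewrite fubini_tonelli1// ge0_integral_pushforward//.
  exact: measurable_fun_fubini_tonelli_F.
by move=> w _; exact: integral_ge0.
Qed.

(** For a signed [f] the iterated integral equals the integral only under integrability on the
    product, which is transported from [P] by the joint law. *)
Lemma integral_others_eq0 i (f : others i * R -> R) :
  measurable_fun setT f ->
  P.-integrable setT (fun w => (f (w, X i w))%:E) ->
  (forall w, \int[distribution P (X i)]_x (f (w, x))%:E = 0)%E ->
  (\int[P]_w (f (w, X i w))%:E = 0)%E.
Proof.
move=> mf intf f0.
have mEf : measurable_fun setT (EFin \o f) by exact/measurable_EFinP.
have iprod : (distribution P (idO i) \x distribution P (X i))%E.-integrable setT
    (EFin \o f).
  apply/integrableP; split=> //.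
  have /integrableP[_] := integrable_pushforward
    (measurable_funP (pairO i)) mEf intf measurableT.
  apply: le_lt_trans; rewrite le_eqVlt; apply/orP; left; apply/eqP.
  by apply: eq_measure_integral => A mA _; exact/esym/law_pairO.
transitivity (\int[distribution P (pairO i)]_z (f z)%:E)%E.
  by rewrite integral_pushforward.
transitivity (\int[(distribution P (idO i) \x distribution P (X i))%E]_z
    (f z)%:E)%E.
  by apply: eq_measure_integral => A mA _; exact: law_pairO.
rewrite -integral12_prod_meas1//.
by rewrite integral0_eq// => w _; exact: f0.
Qed.

(** Pythagoras: [S] does not involve [X i] and [f] is centered in it, so the cross term has mean
    zero. *)
Lemma meanle_orthogonal i (S : T -> R) (f : others i * R -> R) p q :
  measurable_fun setT (S : others i -> R) -> measurable_fun setT f ->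
  (forall w, \int[distribution P (X i)]_x (f (w, x))%:E = 0)%E ->
  meanle P (fun w => S w ^+ 2) p ->
  meanle P (fun w => f (w, X i w) ^+ 2) q ->
  meanle P (fun w => (S w + f (w, X i w)) ^+ 2) (p + q).
Proof.
move=> mS mf f0 Sp fq.
pose Y w := f (w, X i w).
have mY : measurable_fun setT Y.
  exact: (measurableT_comp mf (measurable_funP (pairO i))).
have mS' := others_measurable mS.
have [mSY2 SY0 SY2] := meanleD Sp fq.
have mSY : measurable_fun setT (fun w => S w * Y w) by exact: measurable_funM.
have iSY2 : P.-integrable setT (fun w => (S w ^+ 2 + Y w ^+ 2)%:E).
  apply/integrableP; split; first exact/measurable_EFinP.
  under eq_integral do rewrite gee0_abs ?lee_fin ?SY0//.
  by rewrite (le_lt_trans SY2)// ltry.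
have iSY : P.-integrable setT (fun w => (S w * Y w)%:E).
  apply: (le_integrable measurableT _ _ iSY2); first exact/measurable_EFinP.
  move=> w _ /=; rewrite lee_fin (ger0_norm (SY0 w)).
  exact: normM_le_sqrD.
have SY_eq0 : (\int[P]_w (S w * Y w)%:E = 0)%E.
  apply: (@integral_others_eq0 i (fun z => S z.1 * f z)) => //.
    by apply: measurable_funM => //; exact: (measurableT_comp mS measurable_fst).
  move=> w /=.
  have mfw : measurable_fun setT (fun x => f (w, x)).
    by apply: measurableT_comp => //; exact: measurable_pair1.
  under eq_integral do rewrite EFinM.
  rewrite integralZl// ?f0 ?mule0//.
  (* A finite value of the integral already forces integrability: a difference of two infinite parts
     is infinite by convention. *)
  apply/integrableP; split; first exact/measurable_EFinP.
  by rewrite integral_fin_num_abs// f0.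
split=> [|w|].
- by apply: measurable_funX; exact: measurable_funD.
- exact: sqr_ge0.
- have -> : (\int[P]_w ((S w + Y w) ^+ 2)%:E =
      \int[P]_w (((S w ^+ 2 + Y w ^+ 2)%R)%:E + 2%:E * (S w * Y w)%R%:E))%E.
    by apply: eq_integral => w _; rewrite -EFinM -EFinD; congr EFin; ring.
  rewrite integralD//; last exact: integrableZl.
  by rewrite integralZl// SY_eq0 mule0 adde0.
Qed.

Lemma meanle_others i (f : others i * R -> R) (phi : T -> R) q :
  measurable_fun setT f -> (forall z, 0 <= f z) -> meanle P phi q ->
  (forall w, \int[distribution P (X i)]_x (f (w, x))%:E <= (phi w)%:E)%E ->
  meanle P (fun w => f (w, X i w)) q.
Proof.
move=> mf f0 [mphi phi0 phiq] fphi.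
have mF : measurable_fun setT ((fun w =>
    \int[distribution P (X i)]_x (f (w, x))%:E)%E : others i -> \bar R).
  apply: (@measurable_fun_fubini_tonelli_F _ _ _ _ _ _ (EFin \o f)) => //.
    exact/measurable_EFinP.
split=> [|//|].
  exact: (measurableT_comp mf (measurable_funP (pairO i))).
rewrite (@ge0_integral_others i (EFin \o f))//; last exact/measurable_EFinP.
apply: le_trans phiq; apply: ge0_le_integral => //.
- by move=> w _; apply: integral_ge0 => x _; rewrite lee_fin.
- exact: (measurableT_comp mF (measurable_funP (idO i))).
- exact/measurable_EFinP.
- by move=> w _; exact: fphi.
Qed.

(** Works as for martingale differences, the filtration being replaced by the requirement that
    earlier terms do not involve [X (i k)]. Noise variables outside the list [i] may enter every
    term. *)
Lemma meanle_sum_orthogonal (n : nat) (i : nat -> I) (f : nat -> T -> R -> R)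
    (q : R) :
  (forall k, measurable_fun setT
     ((fun z => f k z.1 z.2) : others (i k) * R -> R)) ->
  (forall k w, \int[distribution P (X (i k))]_x (f k w x)%:E = 0)%E ->
  (forall k, meanle P (fun w => f k w (X (i k) w) ^+ 2) q) ->
  (forall k l, (l < k)%N -> measurable_fun setT
     ((fun w => f l w (X (i l) w)) : others (i k) -> R)) ->
  meanle P (fun w => (\sum_(1 <= k < n.+1) f k w (X (i k) w)) ^+ 2) (n%:R * q).
Proof.
move=> mf f0 fq mlk; elim: n => [|n IH].
  rewrite mul0r (_ : (fun w => _) = cst 0); first exact: meanle_cst.
  by apply/funext => w; rewrite big_geq// expr0n.
rewrite (_ : (fun w => _) = fun w => (\sum_(1 <= k < n.+1) f k w (X (i k) w) +
    f n.+1 w (X (i n.+1) w)) ^+ 2); last first.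
  by apply/funext => w; rewrite big_nat_recr.
rewrite -natr1 mulrDl mul1r.
apply: (@meanle_orthogonal (i n.+1) _ (fun z => f n.+1 z.1 z.2)) => //.
(* The range condition moves into the summands because [mlk] covers only the indices below
   [n.+1]. *)
suff : measurable_fun setT ((fun w => \sum_(k <- index_iota 1 n.+1)
    (if (k < n.+1)%N then f k w (X (i k) w) else 0)) : others (i n.+1) -> R).
  congr (measurable_fun _ _); apply/funext => w.
  by rewrite big_nat [RHS]big_nat; apply: eq_bigr => k /andP[_ ->].
apply: measurable_sum => k; have [kn|_] := boolP (k < n.+1)%N; last exact: measurable_cst.
  exact: mlk.
by move=> w /=; exact: f0.
Qed.

End independence.

(** * Autoregressive weights *)

Section linear_recurrence.

(* (q(S) w)_t, where S is the forward shift of sequences. *)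
Definition shift_act {C : nzRingType} (w : nat -> C) (t : nat) (q : {poly C}) : C :=
  \sum_(i < size q) q`_i * w (t + i)%N.

Lemma shift_act_widen {C : nzRingType} (w : nat -> C) t (q : {poly C}) n :
  (size q <= n)%N -> shift_act w t q = \sum_(i < n) q`_i * w (t + i)%N.
Proof.
move=> qn; rewrite /shift_act (big_ord_widen n (fun i => q`_i * w (t + i)%N) qn).
rewrite big_mkcond; apply: eq_bigr => i _; case: ltnP => // qi.
by rewrite nth_default ?mul0r.
Qed.

(** A linear factor of the polynomial acts as S - l, which peels one root off. *)
Lemma shift_act_XsubC_mul {C : comNzRingType} (w : nat -> C) t (q : {poly C}) l :
  shift_act w t (('X - l%:P) * q) = shift_act w t.+1 q - l * shift_act w t q.
Proof.
have s1 : (size (('X - l%:P) * q)%R <= (size q).+1)%N.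
  by rewrite (leq_trans (size_polyMleq _ _))// size_XsubC.
rewrite (shift_act_widen _ _ s1) (shift_act_widen w t (leqnSn (size q))).
rewrite (shift_act_widen w t.+1 (leqnn (size q))) mulr_sumr.
under eq_bigr do rewrite mulrBl coefB coefXM coefCM mulrBl.
rewrite sumrB; congr (_ - _); last by apply: eq_bigr => i _; rewrite mulrA.
rewrite big_ord_recl /= mul0r add0r; apply: eq_bigr => i _.
by rewrite /bump /= add1n addnS addSn.
Qed.

(** The strict gap between |l| and r allows a constant K' with K + |l| K' <= r K', a bound that the
    recursion preserves. *)
Lemma first_order_decay {C : numFieldType} (l r K : C) (y : nat -> C) :
  `|l| < r -> 0 < r -> (forall t, `|y t.+1 - l * y t| <= K * r ^+ t) ->
  exists K', forall t, `|y t| <= K' * r ^+ t.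
Proof.
move=> lr r0 yK; have rl0 : 0 < r - `|l| by rewrite subr_gt0.
have K0 : 0 <= K by have := yK 0; rewrite expr0 mulr1; apply: le_trans.
exists (`|y 0| + K / (r - `|l|)); set K' := _ + _.
have K'0 : 0 <= K' by rewrite addr_ge0// divr_ge0// ltW.
have KK' : K <= K' * (r - `|l|).
  by rewrite mulrDl divfK ?gt_eqF// lerDr mulr_ge0// ltW.
elim=> [|t IH]; first by rewrite expr0 mulr1 lerDl divr_ge0// ltW.
have -> : y t.+1 = (y t.+1 - l * y t) + l * y t by rewrite subrK.
apply: le_trans (ler_normD _ _) _; rewrite normrM.
apply: (@le_trans _ _ (K * r ^+ t + `|l| * (K' * r ^+ t))).
  by apply: lerD => //; exact: ler_wpM2l.
rewrite mulrA -mulrDl exprS mulrA; apply: ler_wpM2r; first by rewrite exprn_ge0// ltW.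
by rewrite -lerBrDr [`|l| * _]mulrC -mulrBr.
Qed.

(** Roots are removed one at a time through a first-order inequality, so multiple roots need no
    separate treatment. *)
Lemma shift_act_decay {C : numFieldType} (r : C) (rs : seq C) (w : nat -> C) :
  0 < r -> all (fun l => `|l| < r) rs ->
  (exists K, forall t,
    `|shift_act w t (\prod_(l <- rs) ('X - l%:P))| <= K * r ^+ t) ->
  exists K, forall t, `|w t| <= K * r ^+ t.
Proof.
move=> r0; elim: rs => [_ [K wK]|l rs IH /= /andP[lr rsr] [K]].
  exists K => t; have := wK t.
  by rewrite big_nil /shift_act size_poly1 big_ord1 coef1 eqxx mul1r addn0.
rewrite big_cons => wK; apply: IH => //.
apply: (first_order_decay lr r0 (y := fun t => shift_act w t _)).
by move=> t; rewrite -shift_act_XsubC_mul; exact: wK.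
Qed.

Lemma radius_lt1 {C : numFieldType} (rs : seq C) :
  all (fun l => `|l| < 1) rs ->
  exists2 r : C, 0 < r < 1 & all (fun l => `|l| < r) rs.
Proof.
elim: rs => [_|l rs IH /= /andP[l1 /IH[r /andP[r0 r1] rsr]]].
  by exists 2^-1 => //; rewrite invr_gt0 ltr0n/= invf_lt1 ?ltr1n ?ltr0n.
(* The order of [C] is partial; being real makes the two radii comparable. *)
have lr : `|l| \is Num.real by rewrite normr_real.
have rr : r \is Num.real by rewrite gtr0_real.
have [rl|lr'] := real_leP rr lr; last first.
  by exists r; rewrite ?r0 ?r1 ?lr'.
exists ((`|l| + 1) / 2).
  by rewrite (lt_le_trans _ (midf_le (ltW l1)).1) ?(lt_le_trans r0 rl)//= midf_lt.
rewrite midf_lt//=; apply: sub_all rsr => x xr.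
by rewrite (lt_le_trans xr)// (le_trans rl)// midf_le// ltW.
Qed.

End linear_recurrence.

Section ar_weights.
Context {R : realType} {p : nat}.
Variable beta : 'cV[R]_p.

(** Extended by 0 beyond [p], so that [ar_row] needs no range conditions. *)
Definition ar_coef (j : nat) : R :=
  if insub j is Some i then beta i 0 else 0.

(* Coefficients of u_(t-K-j) once the recursion has been substituted K times
   into u_t, see ar_expansion; the first row of the K-th power of the companion
   matrix. *)
Fixpoint ar_row (K : nat) : nat -> R :=
  if K is K'.+1 then fun j => ar_row K' 0 * ar_coef j + ar_row K' j.+1
  else fun j => (j == 0)%N%:R.

(** The impulse response, that is, the coefficients of the moving-average representation of the
    solution. *)
Definition ar_psi (k : nat) : R := ar_row k 0.

Lemma ar_coefE (j : 'I_p) : ar_coef j = beta j 0.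
Proof. by rewrite /ar_coef valK. Qed.

Lemma ar_coef_default j : (p <= j)%N -> ar_coef j = 0.
Proof. by move=> pj; rewrite /ar_coef insubN// -leqNgt. Qed.

Lemma ar_row_default K j : (0 < p)%N -> (p <= j)%N -> ar_row K j = 0.
Proof.
move=> p0; elim: K j => [|K IH] j pj /=.
  by rewrite gtn_eqF// (leq_trans p0).
by rewrite ar_coef_default// mulr0 add0r IH// leqW.
Qed.

(** For [j = 0] this is the convolution recursion of the impulse response, the last term being the
    unit impulse at time 0. *)
Lemma ar_rowE K j :
  ar_row K j = \sum_(i < K) ar_coef (j + i)%N * ar_psi (K - i.+1)%N + (j + K == 0)%N%:R.
Proof.
elim: K j => [|K IH] j.
  by rewrite big_ord0 add0r addn0.
rewrite /= (IH j.+1) big_ord_recl /= addn0 subn1 /= [ar_row K 0 * _]mulrC -addrA.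
rewrite addnS; congr (_ + (_ + _)); apply: eq_bigr => i _.
by rewrite /bump /= add1n addSn addnS subSS.
Qed.

Lemma ar_psi_rec t : (0 < p)%N ->
  shift_act ar_psi t (ar_charpoly beta) = 0.
Proof.
move=> p0; have sz : (size (ar_charpoly beta) <= p.+1)%N.
  rewrite /ar_charpoly (leq_trans (size_polyD _ _))// geq_max size_polyXn leqnn /=.
  rewrite size_polyN; apply: (leq_trans (size_sum _ _ _)).
  apply/bigmax_leqP => j _; apply: (leq_trans (size_scale_leq _ _)).
  by rewrite size_polyXn ltnS leq_subr.
rewrite (shift_act_widen _ _ sz).
under eq_bigr => i _.
  rewrite coefB coefXn coef_sum mulrBl mulr_suml.
  under eq_bigr do rewrite coefZ coefXn.
  over.
rewrite sumrB (bigD1 ord_max)//= eqxx mul1r big1 ?addr0; last first.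
  by move=> i /negPf ip; rewrite -val_eqE/= in ip; rewrite ip mul0r.
rewrite exchange_big /= [X in X - _](_ : _ =
    \sum_(j < p) beta j 0 * ar_psi (t + (p - j.+1))%N).
  apply/eqP; rewrite subr_eq0; apply/eqP; apply: eq_bigr => j _.
  have jp : (p - j.+1 < p.+1)%N by rewrite ltnS leq_subr.
  rewrite (bigD1 (Ordinal jp))//= eqxx mulr1 big1 ?addr0// => i.
  by rewrite -val_eqE /= => /negPf ->; rewrite mulr0 mul0r.
(* Since [p] is positive, the unit impulse does not reach time t + p; the remaining sum stops at
   [p], where [ar_coef] vanishes. *)
rewrite /ar_psi ar_rowE add0n addn_eq0 [p == 0]gtn_eqF// andbF addr0.
rewrite -(big_mkord xpredT (fun i => ar_coef (0 + i)%N * ar_psi (t + p - i.+1)%N)).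
rewrite (big_cat_nat (leq0n p) (leq_addl t p)) /=.
rewrite (big1_seq (index_iota p _)) ?addr0; last first.
  move=> i; rewrite mem_index_iota => /andP[_ /andP[pi _]].
  by rewrite ar_coef_default ?mul0r.
rewrite big_mkord; apply: eq_bigr => j _.
by rewrite add0n ar_coefE addnBA.
Qed.

Lemma ar_expansion (u e : int -> R) t K : (0 < p)%N ->
  (forall s, u s = \sum_(j < p) beta j 0 * u (s - (j.+1)%:Z) + e s) ->
  u t = \sum_(k < K) ar_psi k * e (t - k%:Z)
        + \sum_(j < p) ar_row K j * u (t - K%:Z - j%:Z).
Proof.
move=> p0 uE; elim: K => [|K ->].
  rewrite big_ord0 add0r (bigD1 (Ordinal p0))//= mul1r !subr0 big1 ?addr0// => j.
  by rewrite -val_eqE /= => /negPf ->; rewrite mul0r.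
rewrite big_ord_recr /= -addrA; congr (_ + _).
set x := t - K%:Z.
(* The row is lengthened by its zero entry at [p], so that splitting off [j = 0] leaves a shifted
   sum of the same length. *)
have -> : \sum_(j < p) ar_row K j * u (x - j%:Z) =
    ar_psi K * u x + \sum_(j < p) ar_row K j.+1 * u (x - (j.+1)%:Z).
  rewrite -(big_mkord xpredT (fun j => ar_row K j * u (x - j%:Z))).
  rewrite -(big_mkord xpredT (fun j => ar_row K j.+1 * u (x - (j.+1)%:Z))).
  have /= <- := big_add1 _ _ 0 p.+1 xpredT (fun j => ar_row K j * u (x - j%:Z)).
  rewrite big_nat_recr//= ar_row_default// mul0r addr0.
  by rewrite big_ltn// subr0.
rewrite (uE x) mulrDr [X in X + _]addrC -addrA; congr (_ + _).
rewrite mulr_sumr -big_split /=; apply: eq_bigr => j _.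
have -> : t - K.+1%:Z - j%:Z = x - (j.+1)%:Z.
  by rewrite /x -!addrA -!opprD -!PoszD addSnnS.
by rewrite mulrDl ar_coefE mulrA.
Qed.

(** The characteristic roots govern entry 0 of the rows directly; the recursion of [ar_row], solved
    for the next entry, carries the decay to every [j] at the same rate. *)
Lemma ar_row_decay : (0 < p)%N -> ar_stable beta ->
  exists2 r : R, 0 < r < 1 &
    forall j, exists2 C, 0 <= C & forall K, `|ar_row K j| <= C * r ^+ K.
Proof.
move=> p0 stab.
pose f := map_poly (real_complex R) (ar_charpoly beta).
have [rs fE] := closed_field_poly_normal f.
have fmonic : lead_coef f = 1.
  rewrite lead_coef_map /ar_charpoly lead_coefDl ?lead_coefXn ?rmorph1//.
  rewrite size_polyN size_polyXn ltnS; apply: (leq_trans (size_sum _ _ _)).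
  apply/bigmax_leqP => j _; apply: (leq_trans (size_scale_leq _ _)).
  by rewrite size_polyXn -subSn// subSS leq_subr.
rewrite fmonic scale1r in fE.
have rsr : all (fun l => `|l| < 1) rs.
  apply/allP => l lrs; apply: stab; rewrite -/f fE root_prod_XsubC.
  exact: lrs.
have [rc /andP[rc0 rc1] rsrc] := radius_lt1 rsr.
have [Kc psiK] : exists K, forall t, `|real_complex R (ar_psi t)| <= K * rc ^+ t.
  apply: (shift_act_decay rc0 rsrc).
  exists 0 => t; rewrite mul0r -fE /shift_act size_map_poly.
  under eq_bigr do rewrite coef_map -rmorphM.
  by rewrite -rmorph_sum; have := ar_psi_rec t p0; rewrite /shift_act => ->;
    rewrite rmorph0 normr0.
have Kc0 : 0 <= Kc by have := psiK 0; rewrite expr0 mulr1; apply: le_trans.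
(* The constant and the rate were found in [R[i]]; being nonnegative there, they are images of
   reals. *)
have [K KE] := complex_realP _ (ger0_real Kc0).
have [r rE] := complex_realP _ (gtr0_real rc0).
rewrite {}KE {}rE in Kc0 rc0 rc1 psiK.
rewrite -(rmorph0 (real_complex R)) ltcR in rc0.
rewrite -(rmorph1 (real_complex R)) ltcR in rc1.
rewrite -(rmorph0 (real_complex R)) lecR in Kc0.
have psir t : `|ar_psi t| <= K * r ^+ t.
  rewrite -lecR rmorphM rmorphXn; apply: le_trans (psiK t).
  by rewrite normc_def /= expr0n addr0 sqrtr_sqr.
exists r; first by rewrite rc0.
elim=> [|j [C C0 jC]]; first by exists K.
exists (C * r + K * `|ar_coef j|).
  by rewrite addr_ge0// mulr_ge0// ltW.
move=> k; have -> : ar_row k j.+1 = ar_row k.+1 j - ar_psi k * ar_coef j.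
  by rewrite /= addrC addKr.
apply: le_trans (ler_normB _ _) _.
rewrite mulrDl -mulrA -exprS lerD// normrM mulrAC.
exact: ler_wpM2r.
Qed.

End ar_weights.

(** * Distribution functions *)

Section distribution_functions.
Context {R : realType}.

Lemma eq_probability_cdf (m1 m2 : probability R R) :
  (forall y, m1 `]-oo, y]%classic = m2 `]-oo, y]%classic) ->
  forall A : set R, measurable A -> m1 A = m2 A.
Proof.
move=> m12 A mA.
apply: (measure_unique (@RGenOInfty.G R) (fun k => `]-(k%:R), +oo[%classic)) => //.
- exact: RGenOInfty.measurableE.
- move=> _ _ [y ->] [z ->]; exists (Num.max y z).
  apply/seteqP; split=> t /=; rewrite !in_itv/= !andbT gt_max.
    by case=> -> ->.
  by move/andP.
- by move=> k; exists (-(k%:R)).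
- rewrite -subTset => y _; have [k yk] : exists k : nat, - k%:R < y.
    exists (Num.bound `|y|); rewrite ltrNl.
    by rewrite (le_lt_trans _ (archi_boundP _))// -normrN ler_norm.
  by exists k => //=; rewrite in_itv /= yk.
- move=> _ [y ->]; rewrite -setCitvl.
  transitivity (1 - m1 `]-oo, y]%classic)%E; first exact: probability_setC.
  by rewrite m12; exact/esym/probability_setC.
- by move=> k; rewrite (le_lt_trans (probability_le1 _ _))// ltry.
Qed.

Section fixed_cdf.
Variables (m : probability R R) (G : R -> R).
Hypothesis mG : forall y, m `]-oo, y]%classic = (G y)%:E.

Lemma cdf_bounds y : 0 <= G y <= 1.
Proof. by rewrite -!lee_fin -mG measure_ge0 probability_le1. Qed.

Let measurable_indic_le (a : R) : measurable_fun setT (fun y : R => (y <= a)%R%:R : R).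
Proof.
by apply: measurable_natb; apply: measurable_fun_ler.
Qed.

Lemma integral_cdf (a : R) : (\int[m]_y (y <= a)%R%:R%:E = (G a)%:E)%E.
Proof.
have -> : (\int[m]_y (y <= a)%R%:R%:E = \int[m]_y (\1_(`]-oo, a]%classic) y)%:E)%E.
  apply: eq_integral => y _; rewrite indicE; congr (_%:R%:E).
  by rewrite mem_setE in_itv.
rewrite integral_indic// setIT.
exact: mG.
Qed.

Let integrable_indic_le c : m.-integrable setT (fun y => ((y <= c)%R%:R : R)%:E).
Proof.
apply: measurable_bounded_integrable => //.
  by rewrite (le_lt_trans (probability_le1 _ _))// ltry.
exists 1; split=> // M M1 y _ /=; case: (y <= c); rewrite ?normr1 ?normr0 ltW//.
exact: lt_trans M1.
Qed.

Lemma integral_cdf_diff (a b : R) :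
  (\int[m]_y ((y <= a)%R%:R - (y <= b)%R%:R)%:E = (G a - G b)%:E)%E.
Proof.
under eq_integral do rewrite EFinB.
by rewrite integralB// !integral_cdf.
Qed.

Lemma integral_cdf_centered (a b : R) :
  (\int[m]_y ((y <= a)%R%:R - (y <= b)%R%:R - (G a - G b))%:E = 0)%E.
Proof.
under eq_integral do rewrite EFinB.
rewrite integralB//; last exact: finite_measure_integrable_cst.
  rewrite integral_cdf_diff integral_cst//.
  rewrite [X in (_ * X)%E](_ : _ = 1%E); last exact: probability_setT.
  by rewrite mule1 -!EFinB subrr.
by under eq_fun do rewrite EFinB; exact: integrableB.
Qed.

Variable L : R.
Hypothesis lipG : forall a b, `|G a - G b| <= L * `|a - b|.

Lemma integral_near (a s : R) : 0 < s ->
  (\int[m]_y (`|y - a| <= s)%R%:R%:E <= (3 * L * s)%:E)%E.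
Proof.
move=> s0.
(* The half-open interval from a - 2s to a + s covers the closed window with both end points; its
   length 3s is the source of the constant 3. *)
apply: (@le_trans _ _ (\int[m]_y ((y <= a + s)%R%:R - (y <= a - 2 * s)%R%:R)%:E)%E).
  apply: ge0_le_integral => //.
  - by apply/measurable_EFinP/measurable_natb; apply: measurable_fun_ler => //;
      apply: measurableT_comp => //; exact: measurable_funB.
  - by apply/measurable_EFinP; exact: measurable_funB.
  - move=> y _; rewrite lee_fin; case: (boolP (_ <= s)) => [|_].
      rewrite ler_norml => /andP[h1 h2].
      have -> : y <= a + s by lra.
      have /negPf -> : ~~ (y <= a - 2 * s) by rewrite -ltNge; lra.
      by rewrite subr0.
    rewrite subr_ge0 ler_nat.
    by case: (leP y (a - 2 * s)) => // h; rewrite (_ : y <= a + s)//; lra.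
rewrite integral_cdf_diff.
rewrite lee_fin (le_trans (ler_norm _))// (le_trans (lipG _ _))//.
have -> : a + s - (a - 2 * s) = 3 * s by ring.
by rewrite ger0_norm; [rewrite mulrCA mulrA|lra].
Qed.

End fixed_cdf.
End distribution_functions.

Section smooth_cdf.
Context {R : realType}.
Variables (G g : R -> R) (B : R).
Hypothesis G_bounds : forall y, 0 <= G y <= 1.
Hypothesis G_diff : forall y : R, is_derive y 1 G (g y).
Hypothesis g_lip : forall a b, `|g a - g b| <= B * `|a - b|.

Let G_continuous (a b : R) : {within `[a, b], continuous G}.
Proof.
by apply: derivable_within_continuous => y _; case: (G_diff y).
Qed.

Lemma mean_value a b : a < b -> exists2 c, a < c < b & G b - G a = g c * (b - a).
Proof.
move=> ab; have [c] := MVT ab (fun y _ => G_diff y) (@G_continuous a b).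
by rewrite in_itv /= => cab Gab; exists c.
Qed.

(** By the mean value theorem the remainder is (g c - g x) h with |c - x| <= |h|; the Lipschitz
    bound on g then gives [B] in place of the sharp B / 2. *)
Lemma taylor2_bound x h : `|G (x + h) - G x - g x * h| <= B * h ^+ 2.
Proof.
have B0 : 0 <= B by have := g_lip 1 0; rewrite subr0 normr1 mulr1; exact: le_trans.
have [h0|h0|->] := ltgtP h 0; last first.
- by rewrite addr0 subrr sub0r mulr0 oppr0 normr0 expr0n mulr0.
- have [|c /andP[xc ch]] := @mean_value x (x + h); first by rewrite ltrDl.
  rewrite addrAC subrr add0r => ->; rewrite -mulrBl normrM.
  apply: le_trans (ler_wpM2r _ (g_lip _ _)) _ => //.
  rewrite -mulrA ler_wpM2l// expr2 (gtr0_norm h0) ler_wpM2r ?(ltW h0)//.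
  by rewrite ler_norml; apply/andP; split; lra.
- have [|c /andP[xc ch]] := @mean_value (x + h) x; first by rewrite gtrDl.
  move=> E; have {E} -> : G (x + h) - G x = g c * h.
    by rewrite -[LHS]opprB E; ring.
  rewrite -mulrBl normrM.
  apply: le_trans (ler_wpM2r _ (g_lip _ _)) _ => //.
  rewrite -mulrA ler_wpM2l// -[h ^+ 2]sqrrN expr2 (ltr0_norm h0).
  rewrite ler_wpM2r ?oppr_ge0 ?(ltW h0)//.
  by rewrite ler_norml; apply/andP; split; lra.
Qed.

(** Over a unit step G changes by at most 1, so Taylor's formula bounds the slope. This makes G
    Lipschitz although only g' is assumed bounded. *)
Lemma density_bound y : `|g y| <= 1 + B.
Proof.
have := taylor2_bound y 1; rewrite mulr1 expr1n mulr1.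
have /andP[? ?] := G_bounds y; have /andP[? ?] := G_bounds (y + 1).
rewrite ler_norml => /andP[? ?]; rewrite ler_norml.
by apply/andP; split; lra.
Qed.

Lemma cdf_lipschitz a b : `|G a - G b| <= (1 + B) * `|a - b|.
Proof.
wlog ab : a b / a < b => [H|].
  have [ab|ba|->] := ltgtP a b; first exact: H.
  - by rewrite distrC (distrC a); exact: H.
  - by rewrite !subrr normr0 mulr0.
have [c _ E] := mean_value ab.
rewrite distrC (distrC a) E normrM.
by apply: ler_wpM2r => //; exact: density_bound.
Qed.

End smooth_cdf.

Lemma derivable_bounded_lipschitz {R : realType} (g : R -> R) :
  (forall y : R, derivable g y 1) ->
  (ereal_sup [set (`|derive1 g y|%R)%:E | y in [set: R]] < +oo)%E ->
  exists2 B, 0 <= B & forall a b, `|g a - g b| <= B * `|a - b|.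
Proof.
move=> dg sup_lt.
pose S := ereal_sup [set (`|derive1 g y|%R)%:E | y in [set: R]].
have gS y : ((`|derive1 g y|%R)%:E <= S)%E.
  by apply: ereal_sup_ubound; exists y.
have S0 : (0 <= S)%E by apply: le_trans (gS 0); rewrite lee_fin.
have SE : S = (fine S)%:E by rewrite fineK// ge0_fin_numE.
rewrite SE in gS S0; exists (fine S) => // a b.
wlog ab : a b / a < b => [H|].
  have [ab|ba|->] := ltgtP a b; first exact: H.
  - by rewrite distrC (distrC a); exact: H.
  - by rewrite !subrr normr0 mulr0.
have [||c _ E] := @MVT _ g (derive1 g) a b ab.
- by move=> y _; rewrite derive1E; exact: DeriveDef.
- by apply: derivable_within_continuous => y _; exact: dg.
rewrite distrC (distrC a) E normrM.
by apply: ler_wpM2r => //; have := gS c; rewrite lee_fin.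
Qed.

Lemma geometric_sum_bound {R : realFieldType} (r : R) n : 0 < r < 1 ->
  \sum_(i < n) r ^+ i <= (1 - r)^-1.
Proof.
move=> /andP[r0 r1]; have r1' : 0 < 1 - r by rewrite subr_gt0.
rewrite -[leRHS]mul1r ler_pdivlMr// mulrC -opprB mulNr -subrX1 opprB.
by rewrite gerBl exprn_ge0// ltW.
Qed.

Lemma sqr_normE {R : realDomainType} (x : R) : `|x| ^+ 2 = x ^+ 2.
Proof. by rewrite real_normK// num_real. Qed.

(** * Exceptional events, tails and weighted sums *)

Section high_probability.
Context {d : measure_display} {T : measurableType d} {R : realType}.
Variable P : probability T R.
Implicit Types (Q : T -> Prop) (eta : R).

(* Q need not be measurable. *)
Definition whp eta Q : Prop :=
  exists E, [/\ measurable E, (P E <= eta%:E)%E & forall w, ~ E w -> Q w].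

Lemma whp_imp eta eta' Q Q' : whp eta Q -> eta <= eta' ->
  (forall w, Q w -> Q' w) -> whp eta' Q'.
Proof.
move=> [E [mE PE QE]] ee QQ'; exists E; split=> // [|w /QE/QQ'//].
by rewrite (le_trans PE)// lee_fin.
Qed.

Lemma whp_and eta1 eta2 Q1 Q2 : whp eta1 Q1 -> whp eta2 Q2 ->
  whp (eta1 + eta2) (fun w => Q1 w /\ Q2 w).
Proof.
move=> [E [mE PE QE]] [F [mF PF QF]]; exists (E `|` F); split.
- exact: measurableU.
- by rewrite (le_trans (measureU2 _ _ _))// EFinD leeD.
- by move=> w /not_orP[/QE ? /QF ?].
Qed.

Lemma whp_true eta Q : 0 <= eta -> (forall w, Q w) -> whp eta Q.
Proof. by move=> e0 QT; exists set0; split=> //; rewrite measure0. Qed.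

Lemma whp_seq (I : eqType) (s : seq I) (eta : R) (Q : I -> T -> Prop) :
  (forall i, i \in s -> whp eta (Q i)) ->
  whp ((size s)%:R * eta) (fun w => forall i, i \in s -> Q i w).
Proof.
elim: s => [_|i s IH Qs]; first by apply: whp_true; rewrite ?mul0r.
have := whp_and (Qs i (mem_head _ _)) (IH _).
rewrite /= -natr1 mulrDl mul1r addrC => H; apply: whp_imp (H _) _ _ => //.
  by move=> j js; apply: Qs; rewrite inE js orbT.
by move=> w [Qi Qs'] j; rewrite inE => /predU1P[->//|/Qs'].
Qed.

Lemma whp_ae Q : {ae P, forall w, Q w} -> whp 0 Q.
Proof.
move=> [E [mE PE QE]]; exists E; split=> //; first by rewrite PE.
by move=> w nEw; apply: contrapT => nQ; exact/nEw/QE.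
Qed.

Lemma whp_markov X (q del eta : R) : meanle P X q -> 0 < del ->
  q <= del * eta -> whp eta (fun w => X w <= del).
Proof. exact: meanle_markov. Qed.

Lemma whp_chebyshev (X : T -> R) (q del eta : R) :
  meanle P (fun w => X w ^+ 2) q -> 0 < del ->
  q <= del ^+ 2 * eta -> whp eta (fun w => `|X w| <= del).
Proof.
move=> Xq d0 qd; apply: whp_imp (whp_markov Xq _ qd) (lexx _) _ => [|w].
  by rewrite exprn_gt0.
by rewrite -[in X in X -> _]sqr_normE ler_pXn2r ?nnegrE// ltW.
Qed.

Lemma whp_prob (b : T -> bool) eta : measurable_fun setT b ->
  (P [set w | ~~ b w] <= eta%:E)%E -> whp eta b.
Proof.
move=> mb Pb; exists [set w | ~~ b w]; split=> //.
  by apply: measurable_pred; exact: measurable_neg.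
by move=> w /negP; rewrite negbK.
Qed.

End high_probability.

(** Continuity from above along the decreasing sets |u| > k, whose intersection is empty. *)
Lemma probability_tail {R : realType} (m : probability R R) (eta : R) :
  0 < eta -> exists2 A : R, 0 < A & (m [set u | (A < `|u|)%R] <= eta%:E)%E.
Proof.
move=> eta0.
pose F (k : nat) := [set u : R | k%:R < `|u|].
have mF k : measurable (F k).
  by apply: measurable_pred; apply: measurable_fun_ltr => //; exact: measurableT_comp.
have cF : m (F k) @[k --> \oo] --> m (\bigcap_k F k).
  apply: nonincreasing_cvg_mu => //.
  - by rewrite (le_lt_trans (probability_le1 _ _))// ltry.
  - exact: bigcapT_measurable.
  - move=> k l kl; apply/subsetPset => u /=; apply: le_lt_trans.
    by rewrite ler_nat.
have F0 : \bigcap_k F k = set0.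
  apply/seteqP; split=> // u /(_ (Num.bound `|u|) I) uN.
  by have := lt_trans uN (archi_boundP (normr_ge0 u)); rewrite ltxx.
rewrite F0 measure0 in cF.
have [N _ NF] : \forall k \near \oo, (m (F k) < eta%:E)%E.
  apply: filterS (cvgr_lt _ (fine_cvg cF) _ eta0) => k.
  by rewrite -lte_fin fineK// fin_num_measure.
exists N.+1%:R => //; apply: ltW; apply: NF => /=.
exact: leqnSn.
Qed.

Section weighted_sums.
Context {d : measure_display} {T : measurableType d} {R : realType}.
Variable P : probability T R.

(** Cauchy-Schwarz with respect to the weights |a k|. *)
Lemma weighted_sum_sqr (n : nat) (a x : nat -> R) :
  (\sum_(k < n) a k * x k) ^+ 2 <=
  (\sum_(k < n) `|a k|) * \sum_(k < n) `|a k| * x k ^+ 2.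
Proof.
elim: n => [|n IH]; first by rewrite !big_ord0 mul0r expr0n.
rewrite !big_ord_recr /=.
have := IH; set S := \sum_(i < n) _; set A := \sum_(i < n) _; set Q := \sum_(i < n) _.
move=> SAQ.
have A0 : 0 <= A by exact: sumr_ge0.
have Q0 : 0 <= Q by apply: sumr_ge0 => k _; rewrite mulr_ge0// sqr_ge0.
have x0 := sqr_ge0 (x n).
(* Arithmetic-geometric mean: (2 S x)^2 <= 4 A Q x^2 <= (A x^2 + Q)^2, the first inequality by
   induction. *)
have H : `|2 * S * x n| <= A * x n ^+ 2 + Q.
  rewrite -(@ler_pXn2r _ 2) ?nnegrE//; last by rewrite addr_ge0// mulr_ge0.
  rewrite sqr_normE.
  have : 0 <= (A * x n ^+ 2 - Q) ^+ 2 by exact: sqr_ge0.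
  have : 0 <= (A * Q - S ^+ 2) * x n ^+ 2 by rewrite mulr_ge0// subr_ge0.
  by move=> *; nra.
have : a n * (2 * S * x n) <= `|a n| * (A * x n ^+ 2 + Q).
  by rewrite (le_trans (ler_norm _))// normrM ler_wpM2l.
have -> : (S + a n * x n) ^+ 2 = S ^+ 2 + a n * (2 * S * x n) + `|a n| ^+ 2 * x n ^+ 2.
  by rewrite sqr_normE; ring.
by move=> *; lra.
Qed.

(** The weights enter only through their absolute sum, which makes the bound uniform in the number
    of terms. *)
Lemma meanle_weighted_sum (n : nat) (a : nat -> R) (X : nat -> T -> R) (q A : R) :
  0 <= q -> \sum_(k < n) `|a k| <= A ->
  (forall k, meanle P (fun w => X k w ^+ 2) q) ->
  (forall k, measurable_fun setT (X k)) ->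
  meanle P (fun w => (\sum_(k < n) a k * X k w) ^+ 2) (A ^+ 2 * q).
Proof.
move=> q0 aA Xq mX.
have A0 : 0 <= A by apply: le_trans aA; exact: sumr_ge0.
have s0 : 0 <= \sum_(k < n) `|a k| by exact: sumr_ge0.
apply: (@meanle_le _ _ _ _ _ (fun w => (\sum_(k < n) `|a k|) *
    \sum_(k < n) `|a k| * X k w ^+ 2)
  ((\sum_(k < n) `|a k|) * \sum_(k < n) `|a k| * q)).
- apply: meanleZ => //; apply: meanle_sum => k _; exact: meanleZ.
- apply: measurable_funX; apply: measurable_sum => k.
  by apply: measurable_funM.
- by move=> w; rewrite sqr_ge0 /=; exact: (weighted_sum_sqr n a (X ^~ w)).
- rewrite -mulr_suml mulrA ler_wpM2r// expr2.
  by apply: ler_pM.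
Qed.

End weighted_sums.

(** * Sums of innovations *)

Section innovations.
Context {d : measure_display} {T : measurableType d} {R : realType}.
Variable P : probability T R.
Variables (eps z xi : int -> {RV P >-> R}) (G : R -> R).
Hypothesis indep : mutually_independent (noise_family eps z xi).
Hypothesis eps_cdf : forall t y, cdf (eps t) y = (G y)%:E.
Hypothesis eps_mean : ('E_P [eps 1%R] = 0)%E.
Hypothesis eps_var : ('E_P [fun w => (eps 1 w ^+ 2)%R] < +oo)%E.

Definition other_noise (i : int + int + int) := others (noise_family eps z xi) i.
HB.instance Definition _ i := Measurable.on (other_noise i).

Local Notation Ieps t := (inl (inl t) : int + int + int).
Local Notation Iz t := (inl (inr t) : int + int + int).
Local Notation Ixi t := (inr t : int + int + int).

Lemma other_noiseP i k : k != i ->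
  measurable_fun setT (noise_family eps z xi k : other_noise i -> R).
Proof. exact: measurable_other. Qed.

Let eps_law t A : measurable A ->
  distribution P (eps 1) A = distribution P (eps t) A.
Proof.
by apply: eq_probability_cdf => y; have := eps_cdf t y; rewrite -(eps_cdf 1 y).
Qed.

Definition eps_variance : R := fine 'E_P [fun w => (eps 1 w ^+ 2)%R].

Lemma meanle_eps_sqr t : meanle P (fun w => eps t w ^+ 2) eps_variance.
Proof.
split=> [|w|]; [exact: measurable_funX|exact: sqr_ge0|].
have -> : (\int[P]_w (eps t w ^+ 2)%:E = \int[P]_w (eps 1 w ^+ 2)%:E)%E.
  transitivity (\int[distribution P (eps t)]_y (y ^+ 2)%:E)%E.
    rewrite ge0_integral_pushforward// => [|y _]; last by rewrite lee_fin sqr_ge0.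
    by apply/measurable_EFinP; exact: measurable_funX.
  transitivity (\int[distribution P (eps 1)]_y (y ^+ 2)%:E)%E.
    by apply: eq_measure_integral => A mA _; exact/esym/eps_law.
  rewrite ge0_integral_pushforward// => [|y _]; last by rewrite lee_fin sqr_ge0.
  by apply/measurable_EFinP; exact: measurable_funX.
rewrite /eps_variance unlock fineK// ge0_fin_numE.
  by move: eps_var; rewrite unlock.
by apply: integral_ge0 => w _; rewrite lee_fin sqr_ge0.
Qed.

Lemma eps_law_mean t : (\int[distribution P (eps t)]_y y%:E = 0)%E.
Proof.
transitivity (\int[distribution P (eps 1)]_y y%:E)%E.
  by apply: eq_measure_integral => A mA _; exact/esym/eps_law.
have ieps : P.-integrable setT (fun w => (eps 1 w)%:E).
  have i2 : P.-integrable setT (fun w => (1 + eps 1 w ^+ 2)%:E).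
    have [m1 n1 b1] := meanleD (meanle_cst P ler01) (meanle_eps_sqr 1).
    apply/integrableP; split; first exact/measurable_EFinP.
    under eq_integral do rewrite gee0_abs ?lee_fin ?n1//.
    by rewrite (le_lt_trans b1)// ltry.
  apply: (le_integrable measurableT _ _ i2); first exact/measurable_EFinP.
  move=> w _ /=; rewrite lee_fin.
  have := normM_le_sqrD 1 (eps 1 w); rewrite mul1r expr1n => h.
  exact: le_trans h (ler_norm _).
have mE : measurable_fun setT (EFin : R -> \bar R) by exact/measurable_EFinP.
rewrite (integral_pushforward (measurable_funP (eps 1)) mE ieps measurableT).
by move: eps_mean; rewrite unlock.
Qed.

Lemma meanle_sum_eps (m : int) n :
  meanle P (fun w => (\sum_(1 <= t < n.+1) eps (t%:Z - m) w) ^+ 2)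
    (n%:R * eps_variance).
Proof.
apply: (meanle_sum_orthogonal indep n
  (i := fun t : nat => Ieps (t%:Z - m)) (f := fun _ _ y => y)) => //.
- by move=> k; exact: measurable_snd.
- by move=> k w; exact: eps_law_mean.
- by move=> k; exact: meanle_eps_sqr.
- move=> k l lk; apply: (other_noiseP (k := Ieps (l%:Z - m))).
  apply/eqP => -[] /addIr [] lk'; by rewrite lk' ltnn in lk.
Qed.

Variables (psi : nat -> R) (Psi : R).
Hypothesis psi_sum : forall K, \sum_(k < K) `|psi k| <= Psi.

Definition moving_average (K : nat) (t : int) (w : T) : R :=
  \sum_(k < K) psi k * eps (t - k%:Z) w.

Lemma moving_average_measurable K t : measurable_fun setT (moving_average K t).
Proof. by apply: measurable_sum => k; exact: measurable_funM. Qed.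

(** This is adaptedness, phrased through the noise indices that the average avoids. *)
Lemma moving_average_other K t i : (forall s, s <= t -> i != Ieps s) ->
  measurable_fun setT (moving_average K t : other_noise i -> R).
Proof.
move=> it; apply: measurable_sum => k; apply: measurable_funM => //.
apply: (other_noiseP (k := Ieps (t - k%:Z))).
by rewrite eq_sym it// gerBl.
Qed.

Definition ma_moment : R := Psi ^+ 2 * eps_variance.

Lemma eps_variance_ge0 : 0 <= eps_variance.
Proof. exact: meanle_ge0 (meanle_eps_sqr 1). Qed.

Lemma ma_moment_ge0 : 0 <= ma_moment.
Proof. by rewrite mulr_ge0 ?sqr_ge0 ?eps_variance_ge0. Qed.

Lemma meanle_moving_average_sqr K t :
  meanle P (fun w => moving_average K t w ^+ 2) ma_moment.
Proof.
apply: (meanle_weighted_sum (X := fun k w => eps (t - k%:Z) w)) => //.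
- exact: eps_variance_ge0.
- by move=> k; exact: meanle_eps_sqr.
Qed.

Lemma meanle_norm_moving_average K t :
  meanle P (fun w => `|moving_average K t w|) (1 + ma_moment).
Proof.
apply: (meanle_le (meanleD (meanle_cst P ler01) (meanle_moving_average_sqr K t))).
- by apply: measurableT_comp => //; exact: moving_average_measurable.
- move=> w; rewrite normr_ge0 /=.
  by have := normM_le_sqrD 1 (moving_average K t w); rewrite mul1r expr1n.
- exact: lexx.
Qed.

(** Exchanging the sums puts shifted sums of independent innovations inside, so the bound grows like
    n and not n^2. Divided by n^2 it is the law of large numbers for the averages of u. *)
Lemma meanle_sum_moving_average K (m : int) n :
  meanle P (fun w => (\sum_(1 <= t < n.+1) moving_average K (t%:Z - m) w) ^+ 2)
    (n%:R * ma_moment).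
Proof.
rewrite (_ : (fun w => _) = fun w => (\sum_(k < K) psi k *
  \sum_(1 <= t < n.+1) eps (t%:Z - (m + k%:Z)) w) ^+ 2); last first.
  apply/funext => w; congr (_ ^+ 2); rewrite exchange_big /=.
  apply: eq_bigr => k _; rewrite mulr_sumr; apply: eq_bigr => t _.
  by rewrite opprD addrA.
rewrite mulrCA.
apply: (meanle_weighted_sum
  (X := fun k w => \sum_(1 <= t < n.+1) eps (t%:Z - (m + k%:Z)) w)) => //.
- by rewrite mulr_ge0// eps_variance_ge0.
- by move=> k; exact: meanle_sum_eps.
- by move=> k; exact: measurable_sum.
Qed.

End innovations.

Lemma integral_scale_eq0 {d : measure_display} {T : measurableType d}
  {R : realType} (m : {measure set T -> \bar R}) (c : R) (f : T -> R) :
  measurable_fun setT f -> (\int[m]_y (f y)%:E = 0)%E ->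
  (\int[m]_y (c * f y)%:E = 0)%E.
Proof.
move=> mf f0; under eq_integral do rewrite EFinM.
rewrite integralZl// ?f0 ?mule0//.
apply/integrableP; split; first exact/measurable_EFinP.
by rewrite integral_fin_num_abs// f0.
Qed.

Lemma measurable_natb_le {d : measure_display} {T : measurableType d}
  {R : realType} (f h : T -> R) :
  measurable_fun setT f -> measurable_fun setT h ->
  measurable_fun setT (fun w => (f w <= h w)%R%:R : R).
Proof. by move=> mf mh; apply: measurable_natb; exact: measurable_fun_ler. Qed.

(** * Indicators at predictable random thresholds *)

Section thresholds.
Context {d : measure_display} {T : measurableType d} {R : realType}.
Variable P : probability T R.
Variables (eps z xi : int -> {RV P >-> R}) (G : R -> R).
Hypothesis indep : mutually_independent (noise_family eps z xi).
Hypothesis eps_cdf : forall t y, cdf (eps t) y = (G y)%:E.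
Variable L : R.
Hypothesis lipG : forall a b, `|G a - G b| <= L * `|a - b|.
Variable x : R.

Local Notation Ieps t := (inl (inl t) : int + int + int).
Local Notation Iz t := (inl (inr t) : int + int + int).
Local Notation Ixi t := (inr t : int + int + int).
Local Notation other i := (other_noise eps z xi i).

Let G_measurable : measurable_fun setT G.
Proof.
apply: measurable_realfun.nondecreasing_measurable => // a b ab.
rewrite -lee_fin -!(eps_cdf 0); exact: cdf_nondecreasing.
Qed.

Lemma eps_other (s t : int) : s != t ->
  measurable_fun setT (eps s : other (Ieps t) -> R).
Proof.
by move=> st; apply: (other_noiseP (k := Ieps s)); apply: contra_neq st => -[].
Qed.

(** The last bracket is the conditional mean of the indicator increment as soon as [tau] does not
    involve [eps t]. *)
Definition threshold_dev (tau : T -> R) (t : int) (w : T) : R :=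
  (eps t w <= tau w)%R%:R - (eps t w <= x)%R%:R - (G (tau w) - G x).

(** The two measurability conditions express predictability: thresholds and weights up to time k do
    not involve [eps k]. *)
Lemma meanle_sum_threshold (c tau : nat -> T -> R) n s :
  (forall k l : nat, (l <= k)%N ->
     measurable_fun setT (tau l : other (Ieps k%:Z) -> R)) ->
  (forall k l : nat, (l <= k)%N ->
     measurable_fun setT (c l : other (Ieps k%:Z) -> R)) ->
  (forall k : nat,
     meanle P (fun w => (c k w * threshold_dev (tau k) k%:Z w) ^+ 2) s) ->
  meanle P (fun w => (\sum_(1 <= k < n.+1)
     c k w * threshold_dev (tau k) k%:Z w) ^+ 2) (n%:R * s).
Proof.
move=> mtau mc Ys.
apply: (meanle_sum_orthogonal indep n (i := fun k : nat => Ieps k%:Z)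
  (f := fun k w y => c k w * ((y <= tau k w)%R%:R - (y <= x)%R%:R
                               - (G (tau k w) - G x)))) => //.
- move=> k.
  have mtau1 : measurable_fun setT
      ((fun v => tau k v.1) : other (Ieps k%:Z) * R -> R).
    exact: (measurableT_comp (mtau k k (leqnn k)) measurable_fst).
  apply: measurable_funM.
    exact: (measurableT_comp (mc k k (leqnn k)) measurable_fst).
  apply: measurable_funB; first apply: measurable_funB.
  + by apply: measurable_natb_le.
  + by apply: measurable_natb_le.
  + apply: measurable_funB => //; exact: measurableT_comp.
- move=> k w; apply: integral_scale_eq0.
    by apply: measurable_funB => //; apply: measurable_funB;
      apply: measurable_natb_le.
  by apply: integral_cdf_centered => y; exact: eps_cdf.
- move=> k l lk; have mtaul := mtau k l (ltnW lk); have mcl := mc k l (ltnW lk).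
  have ml : measurable_fun setT (eps l%:Z : other (Ieps k%:Z) -> R).
    by apply: eps_other; apply/eqP => -[] lk'; rewrite lk' ltnn in lk.
  apply: measurable_funM => //; apply: measurable_funB.
    by apply: measurable_funB; apply: measurable_natb_le.
  by apply: measurable_funB => //; exact: measurableT_comp.
Qed.

Lemma meanle_eps_near (t : int) (c tau s : T -> R) q :
  measurable_fun setT (tau : other (Ieps t) -> R) ->
  measurable_fun setT (s : other (Ieps t) -> R) ->
  measurable_fun setT (c : other (Ieps t) -> R) ->
  (forall w, 0 <= c w) -> (forall w, 0 < s w) ->
  meanle P (fun w => c w * s w) q ->
  meanle P (fun w => c w * (`|eps t w - tau w| <= s w)%R%:R) (3 * L * q).
Proof.
move=> mtau ms mc c0 s0 csq.
have L0 : 0 <= L.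
  by have := lipG 1 0; rewrite subr0 normr1 mulr1; exact: le_trans.
have csq3 : meanle P (fun w => c w * (3 * L * s w)) (3 * L * q).
  have := meanleZ (k := 3 * L) _ csq; rewrite mulr_ge0// => /(_ isT).
  by congr (meanle _ _); apply/funext => w; rewrite mulrCA.
apply: (meanle_others indep (i := Ieps t)
  (f := fun v => c v.1 * (`|v.2 - tau v.1| <= s v.1)%R%:R) _ _ csq3).
- apply: measurable_funM; first exact: (measurableT_comp mc measurable_fst).
  apply: measurable_natb_le; last exact: (measurableT_comp ms measurable_fst).
  apply: measurableT_comp => //; apply: measurable_funB => //.
  exact: (measurableT_comp mtau measurable_fst).
- by move=> v; rewrite mulr_ge0.
- move=> w /=; under eq_integral do rewrite EFinM.
  have mE : measurable_fun setT (fun y : R => (`|y - tau w| <= s w)%R%:R : R).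
    apply: measurable_natb_le => //; apply: measurableT_comp => //.
    exact: measurable_funB.
  rewrite ge0_integralZl_EFin//; last exact/measurable_EFinP.
  rewrite EFinM; apply: lee_wpmul2l; first by rewrite lee_fin.
  by apply: (@integral_near _ _ G) => // y; exact: eps_cdf.
Qed.

(** By (a - b)^2 <= 2 a^2 + 2 b^2, the constant 8 is 2 * 3 + 2. The indicators differ only if
    [eps t] is within [s] of [x], which costs 3 L s; the squared G-increment is at most its absolute
    value, since G lies between 0 and 1. *)
Lemma meanle_threshold_dev_sqr (t : int) (tau s : T -> R) q :
  measurable_fun setT (tau : other (Ieps t) -> R) ->
  measurable_fun setT (s : other (Ieps t) -> R) ->
  (forall w, 0 < s w) -> (forall w, `|tau w - x| <= s w) -> meanle P s q ->
  meanle P (fun w => (threshold_dev tau t w) ^+ 2) (8 * L * q).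
Proof.
move=> mtau ms s0 taus sq.
have L0 : 0 <= L.
  by have := lipG 1 0; rewrite subr0 normr1 mulr1; exact: le_trans.
have near : meanle P (fun w => (`|eps t w - x| <= s w)%R%:R) (3 * L * q).
  rewrite (_ : (fun w => _) = fun w => cst 1 w * (`|eps t w - cst x w| <= s w)%R%:R).
    apply: meanle_eps_near => //.
    by rewrite (_ : (fun w => _) = s)//; apply/funext => w; rewrite mul1r.
  by apply/funext => w; rewrite mul1r.
have -> : 8 * L * q = 2 * (3 * L * q) + 2 * L * q by ring.
apply: (meanle_le (meanleD (meanleZ (k := 2) _ near) (meanleZ (k := 2 * L) _ sq))).
- by [].
- by rewrite mulr_ge0.
- have mtau' := others_measurable mtau.
  apply: measurable_funX; apply: measurable_funB.
    by apply: measurable_funB; exact: measurable_natb_le.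
  by apply: measurable_funB => //; exact: measurableT_comp.
- move=> w; rewrite sqr_ge0 /=.
  have Gd : `|G (tau w) - G x| <= L * s w.
    by rewrite (le_trans (lipG _ _))// ler_wpM2l.
  have [G1 G2] : 0 <= G (tau w) <= 1 /\ 0 <= G x <= 1.
    by split; apply: (@cdf_bounds _ (distribution P (eps t))) => y; exact: eps_cdf.
  have sq2 : threshold_dev tau t w ^+ 2 <=
      2 * ((eps t w <= tau w)%R%:R - (eps t w <= x)%R%:R) ^+ 2
      + 2 * (G (tau w) - G x) ^+ 2.
    have sqB (a b : R) : (a - b) ^+ 2 <= 2 * a ^+ 2 + 2 * b ^+ 2.
      by have := sqr_ge0 (a + b); lra.
    exact: sqB.
  apply: le_trans sq2 _; apply: lerD.
    rewrite ler_wpM2l//.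
    case: (leP (eps t w) (tau w)) => et; case: (leP (eps t w) x) => ex;
      rewrite ?subrr ?expr0n //.
    + rewrite subr0 expr1n (_ : `|_| <= _) //.
      have := taus w; rewrite !ler_norml => /andP[? ?]; apply/andP; split; lra.
    + rewrite sub0r sqrrN expr1n (_ : `|_| <= _) //.
      have := taus w; rewrite !ler_norml => /andP[? ?]; apply/andP; split; lra.
  rewrite -mulrA ler_wpM2l// (le_trans _ Gd)//.
  rewrite -sqr_normE expr2 -[leRHS]mul1r ler_wpM2r//.
  by rewrite ler_norml; apply/andP; split; lra.
- exact: lexx.
Qed.

End thresholds.

(** * The residuals without outliers *)

Lemma grid_point {R : realType} (r : R) (N : nat) (y : R) : 0 < r ->
  `|y| <= N%:R * r ->
  exists k : 'I_(2 * N).+1, `|y - (k%:R - N%:R) * r| <= r.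
Proof.
(* Shifting by N r makes the quotient nonnegative, so that truncation rounds down. *)
move=> r0 yN; pose v := (y + N%:R * r) / r.
have [yl yu] : - (N%:R * r) <= y /\ y <= N%:R * r by apply/andP; rewrite -ler_norml.
have v0 : 0 <= v by rewrite divr_ge0 ?(ltW r0)//; lra.
have /andP[kv vk] := truncn_itv v0.
have kN : (Num.truncn v < (2 * N).+1)%N.
  rewrite ltnS -(ler_nat R) (le_trans kv)// ler_pdivrMr// natrM.
  by lra.
exists (Ordinal kN) => /=.
have yE : y = v * r - N%:R * r by rewrite divfK ?gt_eqF// addrK.
have -> : y - ((Num.truncn v)%:R - N%:R) * r = (v - (Num.truncn v)%:R) * r.
  by rewrite [in LHS]yE; ring.
rewrite normrM (gtr0_norm r0) -[leRHS]mul1r ler_wpM2r ?(ltW r0)//.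
rewrite ger0_norm ?subr_ge0//; move: vk; rewrite -natr1 => vk; lra.
Qed.

Section expansion.
Context {R : realType} {p : nat}.
Variables (G g : R -> R) (B x : R).
Hypothesis B0 : 0 <= B.
Hypothesis taylor : forall h, `|G (x + h) - G x - g x * h| <= B * h ^+ 2.
Variables (e u : int -> R).

(** The constant 2 pays for two errors of size r in [residual_sum_bound], rounding c and replacing u
    by its approximation; the sum pays for rounding the b_j. *)
Definition envelope (t : int) : R := 2 + \sum_(j < p) `|u (t - (j.+1)%:Z)|.

Lemma envelope_ge2 t : 2 <= envelope t.
Proof. by rewrite lerDl sumr_ge0. Qed.

(** Meant for a grid point [theta], [c]; the signed slack [rho] covers the distance to the true
    values. *)
Definition perturbation (theta : 'I_p -> R) (c rho : R) (t : int) : R :=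
  \sum_(j < p) theta j * u (t - (j.+1)%:Z) + c + rho * envelope t.

Lemma perturbation_bound theta c rho (M r : R) t :
  (forall j, `|theta j| <= M) -> `|c| <= M -> `|rho| <= r ->
  `|perturbation theta c rho t| <= (M + r) * envelope t.
Proof.
move=> thM cM rr; have V2 := envelope_ge2 t.
apply: le_trans (ler_normD _ _) _; rewrite mulrDl; apply: lerD; last first.
  by rewrite normrM (ger0_norm (x := envelope t)) ?ler_wpM2r//; lra.
apply: le_trans (ler_normD _ _) _.
have M0 : 0 <= M by apply: le_trans cM.
have : \sum_(j < p) `|theta j * u (t - (j.+1)%:Z)| <=
    M * \sum_(j < p) `|u (t - (j.+1)%:Z)|.
  by rewrite mulr_sumr; apply: ler_sum => j _; rewrite normrM ler_wpM2r.
have := ler_norm_sum (index_enum 'I_p)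
  (fun j : 'I_p => theta j * u (t - (j.+1)%:Z)) xpredT.
rewrite /envelope mulrDr => *; lra.
Qed.

Definition le_increment (tau : R) (t : int) : R :=
  (e t <= tau)%R%:R - (e t <= x)%R%:R.

Lemma le_increment_mono tau tau' t :
  tau <= tau' -> le_increment tau t <= le_increment tau' t.
Proof.
move=> tt; rewrite lerD2r ler_nat.
by case: (leP (e t) tau) => // et; rewrite (le_trans et).
Qed.

(** As q^2 n = 1, each q^2 times a sum over t is an average. The error terms come from centering,
    from the linear part carried by averages of u, from the slack and from the Taylor remainder. *)
Lemma perturbed_sum_bound (n : nat) (q : R) theta c rho (M r : R) :
  (forall j, `|theta j| <= M) -> `|c| <= M -> `|rho| <= r ->
  0 < q -> q ^+ 2 * n%:R = 1 ->
  `| q * \sum_(1 <= t < n.+1)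
       le_increment (x + q * perturbation theta c rho t%:Z) t%:Z - g x * c | <=
  `| q * \sum_(1 <= t < n.+1)
       (le_increment (x + q * perturbation theta c rho t%:Z) t%:Z
        - (G (x + q * perturbation theta c rho t%:Z) - G x)) |
  + `|g x| * M * \sum_(j < p)
      `| q ^+ 2 * \sum_(1 <= t < n.+1) u (t%:Z - (j.+1)%:Z)|
  + `|g x| * r * (q ^+ 2 * \sum_(1 <= t < n.+1) envelope t%:Z)
  + B * (M + r) ^+ 2 * q * (q ^+ 2 * \sum_(1 <= t < n.+1) envelope t%:Z ^+ 2).
Proof.
move=> thM cM rr q0 qn.
set D := \sum_(1 <= t < n.+1) (le_increment _ _ - _).
set I := \sum_(1 <= t < n.+1) le_increment _ _.
pose h t := perturbation theta c rho t.
pose rem t := G (x + q * h t) - G x - g x * (q * h t).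
have IE : I = D + \sum_(1 <= t < n.+1) (g x * (q * h t%:Z) + rem t%:Z).
  rewrite /D -big_split /=; apply: eq_bigr => t _.
  by rewrite /rem /h; ring.
have hE : q ^+ 2 * \sum_(1 <= t < n.+1) h t%:Z = c +
    (\sum_(j < p) theta j * (q ^+ 2 * \sum_(1 <= t < n.+1) u (t%:Z - (j.+1)%:Z))
    + rho * (q ^+ 2 * \sum_(1 <= t < n.+1) envelope t%:Z)).
  have -> : \sum_(1 <= t < n.+1) h t%:Z =
      \sum_(j < p) theta j * \sum_(1 <= t < n.+1) u (t%:Z - (j.+1)%:Z)
      + n%:R * c + rho * \sum_(1 <= t < n.+1) envelope t%:Z.
    rewrite /h /perturbation big_split big_split /= sumr_const_nat subn1 /= mulr_natl.
    rewrite exchange_big /= mulr_sumr; congr (_ + _ + _).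
    by apply: eq_bigr => j _; rewrite mulr_sumr.
  under [in RHS]eq_bigr do rewrite mulrCA.
  rewrite -mulr_sumr.
  set S := \sum_(j < p) _; set V := \sum_(1 <= t < n.+1) _.
  transitivity (q ^+ 2 * n%:R * c + (q ^+ 2 * S + rho * (q ^+ 2 * V))).
    by ring.
  by rewrite qn mul1r.
have -> : q * I - g x * c = q * D + g x * (q ^+ 2 * \sum_(1 <= t < n.+1) h t%:Z - c)
    + q * \sum_(1 <= t < n.+1) rem t%:Z.
  rewrite IE big_split /= -mulr_sumr -mulr_sumr; ring.
rewrite hE [c + _]addrC addrK -!addrA.
apply: le_trans (ler_normD _ _) _; apply: lerD => //; rewrite !addrA.
apply: le_trans (ler_normD _ _) _; apply: lerD.
  rewrite normrM -(mulrA _ M) -(mulrA _ r) -mulrDr ler_wpM2l//.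
  apply: le_trans (ler_normD _ _) _; apply: lerD.
    apply: le_trans (ler_norm_sum _ _ _) _; rewrite mulr_sumr.
    by apply: ler_sum => j _; rewrite normrM ler_wpM2r.
  have EV : 0 <= q ^+ 2 * \sum_(1 <= t < n.+1) envelope t%:Z.
    rewrite mulr_ge0 ?sqr_ge0// sumr_ge0// => t _.
    by have := envelope_ge2 t%:Z; lra.
  by rewrite normrM (ger0_norm EV) ler_wpM2r.
rewrite normrM (gtr0_norm q0).
apply: (@le_trans _ _ (q * \sum_(1 <= t < n.+1)
    (B * (q ^+ 2 * ((M + r) ^+ 2 * envelope t%:Z ^+ 2))))).
  rewrite ler_wpM2l ?(ltW q0)//; apply: le_trans (ler_norm_sum _ _ _) _.
  apply: ler_sum => t _; apply: le_trans (taylor _) _; rewrite ler_wpM2l//.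
  rewrite exprMn ler_wpM2l ?sqr_ge0// -exprMn -sqr_normE.
  have hb := perturbation_bound t%:Z thM cM rr.
  by rewrite ler_pXn2r ?nnegrE// (le_trans _ hb).
rewrite -!mulr_sumr le_eqVlt; apply/orP; left; apply/eqP; ring.
Qed.

End expansion.

Section small_scale.
Context {R : realType}.

(** Here q stands for 1 / sqrt n, which keeps all smallness conditions linear;
    [eventually_small_inv_sqrt] converts back to n. *)
Definition eventually_small (A : R -> Prop) : Prop :=
  exists2 q0 : R, 0 < q0 & forall q, 0 < q -> q <= q0 -> A q.

Lemma eventually_small_and (A1 A2 : R -> Prop) :
  eventually_small A1 -> eventually_small A2 ->
  eventually_small (fun q => A1 q /\ A2 q).
Proof.
move=> [q1 q10 A1q] [q2 q20 A2q]; exists (Num.min q1 q2).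
  by rewrite lt_min q10.
by move=> q q0; rewrite le_min => /andP[? ?]; split; [exact: A1q|exact: A2q].
Qed.

Lemma eventually_small_imp (A1 A2 : R -> Prop) :
  eventually_small A1 -> (forall q, 0 < q -> A1 q -> A2 q) ->
  eventually_small A2.
Proof. by move=> [q0 q00 A1q] A12; exists q0 => // q ? ?; exact/A12/A1q. Qed.

Lemma eventually_small_linear (C e : R) : 0 < e ->
  eventually_small (fun q => C * q <= e).
Proof.
move=> e0; exists (e / (`|C| + 1)); first by rewrite divr_gt0// ltr_wpDl.
have C1 : 0 < `|C| + 1 by rewrite ltr_wpDl.
move=> q q0; rewrite ler_pdivlMr// => qe; apply: le_trans qe.
by rewrite mulrC ler_wpM2l ?(ltW q0)// (le_trans (ler_norm _))// lerDl.
Qed.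

End small_scale.

Section pointwise.
Context {R : realType} {p : nat}.
Variables (G g : R -> R) (B x : R).
Hypothesis B0 : 0 <= B.
Hypothesis taylor : forall h, `|G (x + h) - G x - g x * h| <= B * h ^+ 2.
Variables (e u ut : int -> R).

(** Coordinate 0 approximates c and coordinate j + 1 the shifted b_j; a finite function type allows
    a union bound over all grid points. *)
Definition grid (N : nat) (r : R) (k : {ffun 'I_p.+1 -> 'I_(2 * N).+1})
  (j : 'I_p.+1) : R := ((k j)%:R - N%:R) * r.

Lemma grid_le N r k j : 0 < r -> `|@grid N r k j| <= N%:R * r.
Proof.
move=> r0; rewrite normrM (gtr0_norm r0) ler_wpM2r ?(ltW r0)//.
have : (k j)%:R <= (2 * N)%:R :> R by rewrite ler_nat -ltnS.
have : 0 <= (k j)%:R :> R by [].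
by rewrite natrM ler_norml => ? ?; apply/andP; split; lra.
Qed.

Lemma grid_approx N r (v : 'I_p.+1 -> R) : 0 < r ->
  (forall j, `|v j| <= N%:R * r) ->
  exists k, forall j, `|v j - @grid N r k j| <= r.
Proof.
move=> r0 vN; have /choice[k kv] : forall j, exists k : 'I_(2 * N).+1,
    `|v j - (k%:R - N%:R) * r| <= r by move=> j; exact: grid_point.
by exists [ffun j => k j] => j; rewrite /grid ffunE.
Qed.

Definition centered_sum (n : nat) (q : R) theta c rho : R :=
  q * \sum_(1 <= t < n.+1)
    (le_increment x e (x + q * perturbation (p := p) ut theta c rho t%:Z) t%:Z
     - (G (x + q * perturbation ut theta c rho t%:Z) - G x)).

Definition residual_sum (n : nat) (q : R) (b : 'I_p -> R) (c : R) : R :=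
  q * \sum_(1 <= t < n.+1)
    le_increment x e (x + q * (\sum_(j < p) b j * u (t%:Z - (j.+1)%:Z) + c)) t%:Z.

(* Deterministic core: with ut close to u, the sum for arbitrary (a, b) in the box
   lies between the sums for a neighbouring grid point with slack -r and r. *)
Lemma residual_sum_bound (n N : nat) (q kap M M2 r d1 M3 eta0 e2 : R)
    (a : R) (b : 'I_p -> R) :
  0 < q -> q <= 1 -> q ^+ 2 * n%:R = 1 -> 0 < r -> 0 <= M -> 0 <= eta0 ->
  M2 = M + `|kap| * M + p%:R * M ^+ 2 -> M2 <= N%:R * r ->
  M * p%:R * eta0 <= r ->
  `|g x| * (N%:R * r) * (p%:R * e2) <= d1 -> `|g x| * r * M3 <= d1 ->
  `|g x| * r <= d1 -> `|g x| * (q * (p%:R * M ^+ 2)) <= d1 ->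
  (forall k (s : bool), `|centered_sum n q (fun j => @grid N r k (lift ord0 j))
     (@grid N r k ord0) (if s then r else - r)| <= d1) ->
  (forall j : 'I_p,
     `|q ^+ 2 * \sum_(1 <= t < n.+1) ut (t%:Z - (j.+1)%:Z)| <= e2) ->
  q ^+ 2 * \sum_(1 <= t < n.+1) envelope (p := p) ut t%:Z <= M3 ->
  B * (N%:R * r + r) ^+ 2 * q
    * (q ^+ 2 * \sum_(1 <= t < n.+1) envelope (p := p) ut t%:Z ^+ 2) <= d1 ->
  (forall t : nat, (1 <= t < n.+1)%N -> forall j : 'I_p,
     `|u (t%:Z - (j.+1)%:Z) - ut (t%:Z - (j.+1)%:Z)| <= eta0) ->
  `|a| <= M -> (forall j, `|b j| <= M) ->
  `|residual_sum n q b (kap * a - q * a * \sum_(j < p) b j) - g x * kap * a|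
     <= 6 * d1.
Proof.
move=> q0 q1 qn r0 M0 eta00 M2E M2N Meta gM4 grM3 gr gq Hc Hu HV HW Hut aM bM.
set c := kap * a - _.
have sb : `|\sum_(j < p) b j| <= p%:R * M.
  rewrite (le_trans (ler_norm_sum _ _ _))//.
  rewrite (le_trans (ler_sum _ (fun j _ => bM j)))//.
  by rewrite sumr_const card_ord mulr_natl.
have qab : `|q * a * \sum_(j < p) b j| <= q * (p%:R * M ^+ 2).
  rewrite !normrM (gtr0_norm q0) -mulrA ler_wpM2l ?(ltW q0)//.
  by rewrite expr2 mulrCA; apply: ler_pM.
have pM2 : 0 <= p%:R * M ^+ 2 by rewrite mulr_ge0// sqr_ge0.
have cM : `|c| <= M2.
  apply: le_trans (ler_normB _ _) _; rewrite normrM M2E.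
  have : `|kap| * `|a| <= `|kap| * M by rewrite ler_wpM2l.
  have : q * (p%:R * M ^+ 2) <= p%:R * M ^+ 2 by rewrite ler_piMl.
  lra.
have kM : 0 <= `|kap| * M by rewrite mulr_ge0.
pose v (j : 'I_p.+1) := if unlift ord0 j is Some i then b i else c.
have [k kv] : exists k, forall j, `|v j - @grid N r k j| <= r.
  apply: grid_approx => // j; rewrite (le_trans _ M2N)//.
  by rewrite /v; case: unliftP => [i _|_] //; have := bM i; lra.
pose th j := @grid N r k (lift ord0 j); pose ct := @grid N r k ord0.
have bth j : `|b j - th j| <= r by have := kv (lift ord0 j); rewrite /v liftK.
have cct : `|c - ct| <= r by have := kv ord0; rewrite /v unlift_none.
(* Replacing b, c and u at once costs at most r times the envelope, exactly the slack built into
   [perturbation]. *)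
have diff (t : nat) : (1 <= t < n.+1)%N ->
  `|\sum_(j < p) b j * u (t%:Z - (j.+1)%:Z) + c
     - (\sum_(j < p) th j * ut (t%:Z - (j.+1)%:Z) + ct)| <=
    r * envelope (p := p) ut t%:Z.
  move=> tn; rewrite opprD addrACA -sumrB.
  apply: le_trans (ler_normD _ _) _.
  have : `|\sum_(j < p) (b j * u (t%:Z - (j.+1)%:Z) - th j * ut (t%:Z - (j.+1)%:Z))|
      <= M * p%:R * eta0 + r * \sum_(j < p) `|ut (t%:Z - (j.+1)%:Z)|.
    have -> : M * p%:R * eta0 = \sum_(j < p) M * eta0.
      by rewrite sumr_const card_ord mulrAC mulr_natr.
    rewrite mulr_sumr -big_split /=.
    apply: le_trans (ler_norm_sum _ _ _) _; apply: ler_sum => j _.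
    set ui := u _; set uti := ut _.
    have -> : b j * ui - th j * uti = b j * (ui - uti) + (b j - th j) * uti by ring.
    apply: le_trans (ler_normD _ _) _; rewrite !normrM; apply: lerD.
      by apply: ler_pM => //; exact: Hut.
    exact: ler_wpM2r.
  rewrite /envelope.
  by rewrite mulrDr => h; clear -B0 taylor e u ut h cct Meta; lra.
have thN j : `|th j| <= N%:R * r by exact: grid_le.
have ctN : `|ct| <= N%:R * r by exact: grid_le.
have rn s : `|(if s then r else - r)| <= r.
  by case: s; rewrite ?normrN gtr0_norm.
have A s := perturbed_sum_bound B0 taylor e ut thN ctN (rn s) q0 qn.
have Su : \sum_(j < p) `|q ^+ 2 * \sum_(1 <= t < n.+1) ut (t%:Z - (j.+1)%:Z)|
    <= p%:R * e2.
  rewrite (le_trans (ler_sum _ (fun j _ => Hu j)))//.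
  by rewrite sumr_const card_ord mulr_natl.
have Nr0 : 0 <= N%:R * r by apply: le_trans (normr_ge0 _) ctN.
have gu := le_trans (ler_wpM2l (mulr_ge0 (normr_ge0 (g x)) Nr0) Su) gM4.
have gV := le_trans (ler_wpM2l (mulr_ge0 (normr_ge0 (g x)) (ltW r0)) HV) grM3.
(* One [d1] for each of the four terms of [perturbed_sum_bound]. *)
have Ab s : `| q * \sum_(1 <= t < n.+1) le_increment x e
    (x + q * perturbation ut th ct (if s then r else - r) t%:Z) t%:Z
    - g x * ct | <= 4 * d1.
  apply: le_trans (A s) _; have := Hc k s; rewrite /centered_sum => hk.
  by clear -B0 taylor e u ut hk gu gV HW; lra.
have low : q * \sum_(1 <= t < n.+1) le_increment x e
    (x + q * perturbation ut th ct (- r) t%:Z) t%:Z <= residual_sum n q b c.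
  rewrite ler_wpM2l ?(ltW q0)// !big_nat; apply: ler_sum => t tn.
  apply: le_increment_mono; rewrite lerD2l ler_wpM2l ?(ltW q0)//.
  have := diff t tn; rewrite ler_norml => /andP[h1 h2].
  by rewrite /perturbation; clear -B0 taylor e u ut h1 h2; lra.
have upp : residual_sum n q b c <= q * \sum_(1 <= t < n.+1) le_increment x e
    (x + q * perturbation ut th ct r t%:Z) t%:Z.
  rewrite ler_wpM2l ?(ltW q0)// !big_nat; apply: ler_sum => t tn.
  apply: le_increment_mono; rewrite lerD2l ler_wpM2l ?(ltW q0)//.
  have := diff t tn; rewrite ler_norml => /andP[h1 h2].
  by rewrite /perturbation; clear -B0 taylor e u ut h1 h2; lra.
(* Two more [d1]: the rounding of c, and the correction q a sum b_j by which c differs from kap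
   a. *)
have gc : `|g x * ct - g x * kap * a| <= 2 * d1.
  have -> : g x * ct - g x * kap * a = - (g x * (c - ct)) - g x * (q * a * \sum_(j < p) b j).
    by rewrite /c; ring.
  apply: le_trans (ler_normB _ _) _; rewrite normrN !(normrM (g x)).
  have := ler_wpM2l (normr_ge0 (g x)) cct; have := ler_wpM2l (normr_ge0 (g x)) qab.
  by move=> h1 h2; clear -B0 taylor e u ut h1 h2 gr gq; lra.
have := Ab true; have := Ab false; move: gc.
rewrite !ler_norml => /andP[h1 h2] /andP[h3 h4] /andP[h5 h6].
by clear -B0 taylor e u ut h1 h2 h3 h4 h5 h6 low upp; apply/andP; split; lra.
Qed.

End pointwise.

(** * Second moments at a fixed grid point *)

Section part_one.
Context {d : measure_display} {T : measurableType d} {R : realType} {p : nat}.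
Variable P : probability T R.
Variables (eps z xi : int -> {RV P >-> R}) (G g : R -> R) (B x : R).
Hypothesis indep : mutually_independent (noise_family eps z xi).
Hypothesis eps_cdf : forall t y, cdf (eps t) y = (G y)%:E.
Hypothesis eps_var : ('E_P [fun w => (eps 1 w ^+ 2)%R] < +oo)%E.
Hypothesis G_diff : forall y : R, is_derive y 1 G (g y).
Hypothesis g_lip : forall a b, `|g a - g b| <= B * `|a - b|.
Variables (psi : nat -> R) (Psi : R).
Hypothesis psi_sum : forall K, \sum_(k < K) `|psi k| <= Psi.

Local Notation Ieps t := (inl (inl t) : int + int + int).
Local Notation other i := (other_noise eps z xi i).
Local Notation ma := (moving_average eps psi).
Local Notation C2 := (ma_moment eps Psi).

Lemma lip_ge0 : 0 <= B.
Proof. by have := g_lip 1 0; rewrite subr0 normr1 mulr1; exact: le_trans. Qed.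

Lemma G_bounds y : 0 <= G y <= 1.
Proof.
by apply: (@cdf_bounds _ (distribution P (eps 0))) => a; exact: eps_cdf.
Qed.

Lemma G_lipschitz a b : `|G a - G b| <= (1 + B) * `|a - b|.
Proof. exact: (cdf_lipschitz G_bounds G_diff g_lip). Qed.

Lemma G_taylor h : `|G (x + h) - G x - g x * h| <= B * h ^+ 2.
Proof. exact: (taylor2_bound G_diff g_lip). Qed.

Definition env K (t : int) (w : T) : R := envelope (p := p) (fun s => ma K s w) t.

Definition env_mean : R := 2 + p%:R * (1 + C2).
Definition env_sqr_mean : R := 2 * (2 ^+ 2) + 2 * (p%:R ^+ 2 * C2).

Let C2_ge0 : 0 <= C2.
Proof. exact: (ma_moment_ge0 eps_cdf eps_var Psi). Qed.

Lemma env_measurable K t : measurable_fun setT (env K t).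
Proof.
apply: measurable_funD => //; apply: measurable_sum => j.
by apply: measurableT_comp => //; exact: moving_average_measurable.
Qed.

Lemma meanle_env K t : meanle P (env K t) env_mean.
Proof.
apply: meanleD; first exact: meanle_cst.
have -> : p%:R * (1 + C2) = \sum_(j < p) (1 + C2).
  by rewrite sumr_const card_ord mulr_natl.
by apply: meanle_sum => j _; exact: (meanle_norm_moving_average eps_cdf eps_var psi_sum).
Qed.

Lemma meanle_env_sqr K t : meanle P (fun w => env K t w ^+ 2) env_sqr_mean.
Proof.
have Sq : meanle P
    (fun w => (\sum_(j < p) 1 * `|ma K (t - (j.+1)%:Z) w|) ^+ 2) (p%:R ^+ 2 * C2).
  apply: (meanle_weighted_sum (a := fun=> 1) (X := fun j w => `|ma K (t - (j.+1)%:Z) w|)) => //.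
  - by rewrite normr1 sumr_const card_ord.
  - move=> k; under eq_fun do rewrite sqr_normE.
    exact: (meanle_moving_average_sqr eps_cdf eps_var psi_sum).
  - move=> k; apply: measurableT_comp => //; exact: moving_average_measurable.
apply: (meanle_le (meanleD (meanle_cst P (k := 2 * 2 ^+ 2) _)
  (meanleZ (k := 2) _ Sq))) => //.
  by apply: measurable_funX; exact: env_measurable.
move=> w; rewrite sqr_ge0 /= /env /envelope.
under [in leRHS]eq_bigr do rewrite mul1r.
have sqD (a b : R) : (a + b) ^+ 2 <= 2 * a ^+ 2 + 2 * b ^+ 2.
  by have := sqr_ge0 (a - b); lra.
exact: sqD.
Qed.

(** The lag j + 1 is at least 1, so only innovations strictly before time k enter. *)
Lemma ma_other K (k l j : nat) : (l <= k)%N ->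
  measurable_fun setT (ma K (l%:Z - (j.+1)%:Z) : other (Ieps k%:Z) -> R).
Proof.
move=> lk; apply: moving_average_other => s sl; apply/eqP => -[] ks.
move: sl; rewrite -ks leNgt => /negP; apply.
by rewrite ltrBlDr -PoszD ltz_nat addnS ltnS (leq_trans lk)// leq_addr.
Qed.

Lemma env_other K (k l : nat) : (l <= k)%N ->
  measurable_fun setT (env K l%:Z : other (Ieps k%:Z) -> R).
Proof.
move=> lk; apply: measurable_funD => //; apply: measurable_sum => j.
by apply: measurableT_comp => //; exact: ma_other.
Qed.

Lemma perturbation_other K theta c rho (k l : nat) : (l <= k)%N ->
  measurable_fun setT ((fun w =>
    perturbation (p := p) (fun s => ma K s w) theta c rho l%:Z) :
      other (Ieps k%:Z) -> R).
Proof.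
move=> lk; apply: measurable_funD.
  apply: measurable_funD => //; apply: measurable_sum => j.
  by apply: measurable_funM => //; exact: ma_other.
by apply: measurable_funM => //; exact: env_other.
Qed.

(** There are n orthogonal terms of second moment O(q), scaled by q^2 = 1 / n: the total is O(q). *)
Lemma meanle_centered_sum_sqr K n (q : R) theta c rho (M r : R) :
  0 < q -> q ^+ 2 * n%:R = 1 -> 0 < M + r ->
  (forall j, `|theta j| <= M) -> `|c| <= M -> `|rho| <= r ->
  meanle P (fun w => centered_sum (p := p) G x (fun t => eps t w)
    (fun s => ma K s w) n q theta c rho ^+ 2)
    (8 * (1 + B) * ((M + r) * env_mean) * q).
Proof.
move=> q0 qn Mr thM cM rr.
pose tau (t : nat) w :=
  x + q * perturbation (p := p) (fun s => ma K s w) theta c rho t%:Z.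
have mtau (k l : nat) : (l <= k)%N ->
    measurable_fun setT (tau l : other (Ieps k%:Z) -> R).
  move=> lk; apply: measurable_funD => //; apply: measurable_funM => //.
  exact: perturbation_other.
pose s (t : nat) w := q * ((M + r) * env K t%:Z w).
have : meanle P (fun w => (\sum_(1 <= k < n.+1)
    1 * threshold_dev eps G x (tau k) k%:Z w) ^+ 2)
    (n%:R * (8 * (1 + B) * (q * ((M + r) * env_mean)))).
  apply: (meanle_sum_threshold indep eps_cdf (c := fun _ _ => 1) n mtau) => [//|k].
  under eq_fun do rewrite mul1r.
  apply: (meanle_threshold_dev_sqr indep eps_cdf G_lipschitz (s := s k)).
  - exact: mtau.
  - apply: measurable_funM => //; apply: measurable_funM => //; exact: env_other.
  - move=> w; rewrite mulr_gt0// mulr_gt0// (lt_le_trans _ (envelope_ge2 _ _))//.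
  - move=> w; rewrite /tau addrC addKr normrM (gtr0_norm q0).
    rewrite ler_wpM2l ?(ltW q0)//; exact: perturbation_bound.
  - apply: meanleZ; first exact: ltW.
    by apply: meanleZ; [exact: ltW|exact: meanle_env].
move/(meanleZ (sqr_ge0 q)).
rewrite mulrA qn mul1r => H.
have -> : 8 * (1 + B) * ((M + r) * env_mean) * q =
  8 * (1 + B) * (q * ((M + r) * env_mean)) by ring.
congr (meanle P _ _): H; apply/funext => w; rewrite /centered_sum exprMn.
by congr (_ * _ ^+ 2); apply: eq_bigr => t _; rewrite mul1r.
Qed.

End part_one.

Section part_one_conclusion.
Context {d : measure_display} {T : measurableType d} {R : realType} {p : nat}.
Variable P : probability T R.
Variables (eps z xi : int -> {RV P >-> R}) (G g : R -> R) (B x : R).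
Hypothesis indep : mutually_independent (noise_family eps z xi).
Hypothesis eps_cdf : forall t y, cdf (eps t) y = (G y)%:E.
Hypothesis eps_mean : ('E_P [eps 1%R] = 0)%E.
Hypothesis eps_var : ('E_P [fun w => (eps 1 w ^+ 2)%R] < +oo)%E.
Hypothesis G_diff : forall y : R, is_derive y 1 G (g y).
Hypothesis g_lip : forall a b, `|g a - g b| <= B * `|a - b|.
Variables (psi : nat -> R) (Psi : R).
Hypothesis psi_sum : forall K, \sum_(k < K) `|psi k| <= Psi.
Variable u : int -> T -> R.

Local Notation ma := (moving_average eps psi).
Local Notation C2 := (ma_moment eps Psi).
Local Notation Cv := (env_mean (p := p) eps Psi).
Local Notation Cv2 := (env_sqr_mean (p := p) eps Psi).

Hypothesis ma_approx : forall n (eta0 eta : R), 0 < eta0 -> 0 < eta ->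
  exists K, whp P eta (fun w => forall t : nat, (1 <= t < n.+1)%N ->
    forall j : 'I_p,
      `|u (t%:Z - (j.+1)%:Z) w - ma K (t%:Z - (j.+1)%:Z) w| <= eta0).

(* The exceptional event does not depend on (a, b), so that the estimators may be
   substituted for a and b. *)
Lemma residual_sum_whp (kap M del eta : R) : 0 < M -> 0 < del -> 0 < eta ->
  eventually_small (fun q => forall n, q ^+ 2 * n%:R = 1 ->
    whp P eta (fun w => forall a (b : 'I_p -> R),
      `|a| <= M -> (forall j, `|b j| <= M) ->
      `|residual_sum x (fun t => eps t w) (fun t => u t w) n q b
         (kap * a - q * a * \sum_(j < p) b j) - g x * kap * a| <= del)).
Proof.
move=> M0 del0 eta0.
have B0 := lip_ge0 g_lip.
have C20 : 0 <= C2 by exact: (ma_moment_ge0 eps_cdf eps_var Psi).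
have Cv0 : 0 < Cv by rewrite ltr_wpDr// mulr_ge0// addr_ge0.
(* Five exceptional events: the grid sums, the averages of the moving average, the means of the
   envelope and of its square, and the approximation of u. *)
pose eta1 := eta / 5; have eta10 : 0 < eta1 by rewrite divr_gt0.
pose gx := `|g x|; have gx0 : 0 <= gx by exact: normr_ge0.
pose M3 := Cv / eta1; have M30 : 0 < M3 by rewrite divr_gt0.
pose d1 := del / 6; have d10 : 0 < d1 by rewrite divr_gt0.
(* The grid step keeps both gx r and gx r M3 below d1; the added ones keep the denominator
   positive. *)
pose r := d1 / ((gx + 1) * (M3 + 1)).
have gM0 : 0 < (gx + 1) * (M3 + 1) by rewrite mulr_gt0 ?ltr_wpDl ?(ltW M30).
have r0 : 0 < r by rewrite divr_gt0.
have rE : r * ((gx + 1) * (M3 + 1)) = d1 by rewrite divfK ?gt_eqF.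
have gr : gx * r <= d1.
  by rewrite -rE (mulrC gx) ler_wpM2l ?(ltW r0)//; nra.
have grM3 : gx * r * M3 <= d1.
  by rewrite -rE -mulrA (mulrCA gx) ler_wpM2l ?(ltW r0)//; nra.
pose M2 := M + `|kap| * M + p%:R * M ^+ 2.
have M20 : 0 <= M2 / r.
  by rewrite divr_ge0 ?(ltW r0)// !addr_ge0 ?mulr_ge0 ?sqr_ge0 ?(ltW M0).
(* N r exceeds the bound M2 on c and on every b_j; N does not depend on q, so the grid stays fixed
   while q shrinks. *)
pose N := Num.bound (M2 / r).
have M2N : M2 <= N%:R * r.
  by rewrite -ler_pdivrMr// ltW// archi_boundP.
pose M4 := N%:R * r; have M40 : 0 <= M4 by rewrite mulr_ge0 ?(ltW r0).
pose p1 : R := p%:R + 1; have p10 : 0 < p1 by rewrite ltr_wpDl.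
pose e2 := d1 / ((gx * M4 + 1) * p1).
have gMp0 : 0 < (gx * M4 + 1) * p1 by rewrite mulr_gt0// ltr_wpDl// mulr_ge0.
have e20 : 0 < e2 by rewrite divr_gt0.
have e2E : e2 * ((gx * M4 + 1) * p1) = d1 by rewrite divfK ?gt_eqF.
have gM4 : gx * M4 * (p%:R * e2) <= d1.
  rewrite mulrA mulrC -e2E ler_wpM2l ?(ltW e20)//.
  by apply: ler_pM; rewrite ?lerDl//; exact: mulr_ge0.
pose eta2 := r / (M * p1); have Mp0 : 0 < M * p1 by rewrite mulr_gt0.
have eta20 : 0 < eta2 by rewrite divr_gt0.
have Meta : M * p%:R * eta2 <= r.
  have E : eta2 * (M * p1) = r by rewrite divfK ?gt_eqF.
  by rewrite -[leRHS]E mulrC ler_wpM2l ?(ltW eta20)// ler_wpM2l ?(ltW M0)// lerDl.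
pose Ng : R := #|{: {ffun 'I_p.+1 -> 'I_(2 * N).+1} * bool}|%:R.
have Ng0 : 0 <= Ng by exact: ler0n.
have Ng1 : 0 < Ng + 1 by rewrite ltr_wpDl.
have H0 : 0 < M4 + r by rewrite ltr_wpDl.
have s1 : 0 < d1 ^+ 2 * (eta1 / (Ng + 1)) by rewrite mulr_gt0 ?exprn_gt0 ?divr_gt0.
have s2 : 0 < e2 ^+ 2 * (eta1 / p1) by rewrite mulr_gt0 ?exprn_gt0 ?divr_gt0.
have s3 : 0 < d1 * eta1 by rewrite mulr_gt0.
apply: (eventually_small_imp (eventually_small_and
  (eventually_small_and
    (eventually_small_linear (8 * (1 + B) * ((M4 + r) * Cv)) s1)
    (eventually_small_linear C2 s2))
  (eventually_small_and
    (eventually_small_linear (B * (M4 + r) ^+ 2 * Cv2) s3)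
    (eventually_small_and
      (eventually_small_linear (gx * (p%:R * M ^+ 2)) d10)
      (eventually_small_linear 1 ltr01))))).
move=> q qgt0 [[qa qb] [qc [qd]]]; rewrite mul1r => qle1 n qn.
(* [K] may depend on [n] because the bounds used below hold for every order with the same
   constants. *)
have [K HK] := ma_approx n eta20 eta10.
have W1 := @whp_seq _ _ _ P _
  (enum {: {ffun 'I_p.+1 -> 'I_(2 * N).+1} * bool}) (eta1 / (Ng + 1))
  (fun ks w => `|centered_sum (p := p) G x (fun t => eps t w)
     (fun s => ma K s w) n q (fun j => grid r ks.1 (lift ord0 j))
     (grid r ks.1 ord0) (if ks.2 then r else - r)| <= d1).
have {W1} : whp P eta1 (fun w => forall k (s : bool),
   `|centered_sum (p := p) G x (fun t => eps t w)
     (fun s => ma K s w) n q (fun j => @grid R p N r k (lift ord0 j))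
     (grid r k ord0) (if s then r else - r)| <= d1).
  apply: whp_imp (W1 _) _ _ => [ks _||w H k s].
  + have thN j : `|@grid R p N r ks.1 j| <= M4 by exact: grid_le.
    have rs : `|(if ks.2 then r else - r)| <= r.
      by case: ks.2; rewrite ?normrN gtr0_norm.
    have C := meanle_centered_sum_sqr x indep eps_cdf eps_var
      G_diff g_lip psi_sum K qgt0 qn H0 (fun j => thN (lift ord0 j)) (thN ord0) rs.
    exact: (whp_chebyshev C d10 qa).
  + rewrite -cardE -/Ng mulrCA ler_piMr ?(ltW eta10)//.
    by rewrite ler_pdivrMr// mul1r lerDl.
  + by apply: (H (k, s)); rewrite mem_enum.
move=> W1.
have W2 : whp P eta1 (fun w => forall j : 'I_p,
    `|q ^+ 2 * \sum_(1 <= t < n.+1) ma K (t%:Z - (j.+1)%:Z) w| <= e2).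
  have := @whp_seq _ _ _ P _ (enum 'I_p) (eta1 / p1) (fun (j : 'I_p) w =>
    `|q ^+ 2 * \sum_(1 <= t < n.+1) ma K (t%:Z - (j.+1)%:Z) w| <= e2).
  move=> H; apply: whp_imp (H _) _ _ => [j _||w Hw j].
  + apply: (@whp_chebyshev _ _ _ P _ (q ^+ 2 * C2)) => //.
      have -> : q ^+ 2 * C2 = (q ^+ 2) ^+ 2 * (n%:R * C2).
        by rewrite [(q ^+ 2) ^+ 2]expr2 -mulrA (mulrA _ n%:R) qn mul1r.
      under eq_fun do rewrite exprMn.
      exact: (meanleZ (sqr_ge0 (q ^+ 2)) (meanle_sum_moving_average indep eps_cdf
        eps_mean eps_var psi_sum K (j.+1)%:Z n)).
    apply: le_trans qb; rewrite mulrC ler_wpM2l// expr2 ler_piMl// ltW//.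
  + rewrite size_enum_ord mulrCA ler_piMr ?(ltW eta10)//.
    by rewrite ler_pdivrMr// mul1r lerDl.
  + by apply: Hw; rewrite mem_enum.
have sumV (X : nat -> T -> R) c : (forall t, meanle P (X t) c) ->
    meanle P (fun w => q ^+ 2 * \sum_(1 <= t < n.+1) X t w) c.
  move=> Xc; have := meanleZ (sqr_ge0 q) (meanle_sum (index_iota 1 n.+1)
    (Q := xpredT) (q := fun=> c) (fun t _ => Xc t)).
  by rewrite sumr_const_nat subn1 /= -mulr_natl mulrA qn mul1r.
have W3 : whp P eta1 (fun w => q ^+ 2 *
    \sum_(1 <= t < n.+1) envelope (p := p) (fun s => ma K s w) t%:Z <= M3).
  apply: (whp_markov (sumV _ _ (fun t => meanle_env eps_cdf eps_var psi_sum K t%:Z))) => //.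
  by rewrite divfK ?gt_eqF.
have W4 : whp P eta1 (fun w => B * (M4 + r) ^+ 2 * q * (q ^+ 2 *
    \sum_(1 <= t < n.+1) envelope (p := p) (fun s => ma K s w) t%:Z ^+ 2) <= d1).
  apply: (whp_markov (meanleZ _ (sumV _ _ (fun t =>
    meanle_env_sqr eps_cdf eps_var psi_sum K t%:Z)))) => //.
    exact: (mulr_ge0 (mulr_ge0 B0 (sqr_ge0 _)) (ltW qgt0)).
  by rewrite mulrAC.
apply: whp_imp (whp_and (whp_and W1 W2) (whp_and (whp_and W3 W4) HK)) _ _.
  have five : eta1 * 5 = eta by rewrite divfK.
  by rewrite -five le_eqVlt; apply/orP; left; apply/eqP; ring.
move=> w [[w1 w2] [[w3 w4] w5]] a b aM bM.
have -> : del = 6 * d1 by rewrite /d1 mulrC divfK.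
apply: (residual_sum_bound B0 (G_taylor x G_diff g_lip) (ut := fun s => ma K s w)
  (N := N) (M := M) (M2 := M2) (r := r) (M3 := M3) (eta0 := eta2) (e2 := e2)) => //.
- exact: ltW.
- exact: ltW.
- by rewrite mulrCA mulrC.
Qed.

End part_one_conclusion.

(** * Approximation of the stationary solution by finite moving averages *)

Section stationary_solution.
Context {d : measure_display} {T : measurableType d} {R : realType} {p : nat}.
Variable P : probability T R.
Variables (eps v : int -> {RV P >-> R}) (beta : 'cV[R]_p) (mu nu : R).
Hypothesis p_gt0 : (0 < p)%N.
Hypothesis beta_stable : ar_stable beta.
Hypothesis nuE : nu = ar_at1 beta * mu.
Hypothesis v_sol : stationary_ar_solution beta nu eps v.

Definition centered (t : int) (w : T) : R := v t w - mu.

(** The equation holds almost surely for each t; countably many null sets are merged, over [Posz]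
    and [Negz] separately, and subtracting mu absorbs nu. *)
Lemma centered_recursion : whp P 0 (fun w => forall t,
  centered t w = \sum_(j < p) beta j 0 * centered (t - (j.+1)%:Z) w + eps t w).
Proof.
have [_ rec] := v_sol.
apply: whp_ae.
have H1 := @ae_foralln _ _ _ P _ (fun n : nat => rec (Posz n)).
have H2 := @ae_foralln _ _ _ P _ (fun n : nat => rec (Negz n)).
apply: filterS2 H1 H2 => w rec1 rec2 t.
have vt : v t w = \sum_(j < p) beta j 0 * v (t - (j.+1)%:Z) w + nu + eps t w.
  by case: t => n.
rewrite /centered vt.
under [in RHS]eq_bigr do rewrite mulrBr.
by rewrite sumrB -mulr_suml nuE /ar_at1; ring.
Qed.

(** A tail bound at time 0 serves all times by stationarity. *)
Lemma stationary_tail (eta : R) : 0 < eta -> exists2 A : R, 0 < A &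
  forall t, whp P eta (fun w => `|v t w| <= A).
Proof.
move=> eta0; have [stat _] := v_sol.
have [A A0 PA] := probability_tail (distribution P (v 0)) eta0.
exists A => // t.
have mB : measurable [set y : R | A < `|y|].
  by apply: measurable_pred; apply: measurable_fun_ltr => //; exact: measurableT_comp.
have := stat t [:: 0] (fun=> [set y | A < `|y|]) (fun=> mB).
have E (f : int -> int) : \bigcap_(s in [set` [:: 0%R : int]]) (v (f s) @^-1` [set y | A < `|y|])
    = v (f 0) @^-1` [set y | A < `|y|].
  apply/seteqP; split=> [w /(_ 0)|w vw s /=]; first by apply; rewrite /= inE.
  by rewrite inE => /eqP ->.
rewrite (E (fun s => s + t)) (E id) add0r => Pt.
apply: (@whp_prob _ _ _ P (fun w => `|v t w| <= A)).
  by apply: measurable_fun_ler => //; exact: measurableT_comp.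
have -> : [set w | ~~ (`|v t w| <= A)] = v t @^-1` [set y | A < `|y|].
  by apply/seteqP; split=> w /=; rewrite ltNge.
by rewrite Pt.
Qed.

Lemma ar_psi_summable : exists Psi, forall K, \sum_(k < K) `|ar_psi beta k| <= Psi.
Proof.
have [r r01 rowr] := ar_row_decay p_gt0 beta_stable.
have [C C0 psir] := rowr 0; exists (C * (1 - r)^-1) => K.
apply: le_trans (ler_wpM2l C0 (geometric_sum_bound K r01)).
by rewrite mulr_sumr; apply: ler_sum => k _; exact: psir.
Qed.

Lemma ar_row_small (e : R) : 0 < e ->
  exists K, forall j : 'I_p, `|ar_row beta K j| <= e.
Proof.
move=> e0; have [r /andP[r0 r1] rowr] := ar_row_decay p_gt0 beta_stable.
have /choice[C CP] : forall j : 'I_p, exists C : R,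
    0 <= C /\ forall K, `|ar_row beta K j| <= C * r ^+ K.
  by move=> j; have [C C0 H] := rowr j; exists C.
pose S := \sum_(j < p) C j.
have S0 : 0 <= S by apply: sumr_ge0 => j _; have [] := CP j.
have cr : r ^+ K @[K --> \oo] --> 0 by apply: cvg_expr; rewrite gtr0_norm.
have eS0 : 0 < e / (S + 1) by rewrite divr_gt0// ltr_wpDl.
have [K _ KP] := cvgr_lt _ cr _ eS0.
exists K => j; have [Cj0 CjP] := CP j.
apply: le_trans (CjP K) _.
have CS : C j <= S + 1.
  rewrite /S (bigD1 j)//= -addrA lerDl addr_ge0//.
  by apply: sumr_ge0 => i _; have [] := CP i.
apply: (@le_trans _ _ ((S + 1) * r ^+ K)).
  by rewrite ler_wpM2r// exprn_ge0// ltW.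
rewrite mulrC -ler_pdivlMr ?ltr_wpDl// ltW//.
by apply: KP => /=.
Qed.

(** The remainder involves finitely many values of [v], for which tightness suffices. The level [A]
    is fixed first, and only then [K] makes the rows small against it. *)
Lemma moving_average_approx n (eta0 eta : R) : 0 < eta0 -> 0 < eta ->
  exists K, whp P eta (fun w => forall t : nat, (1 <= t < n.+1)%N ->
    forall j : 'I_p, `|centered (t%:Z - (j.+1)%:Z) w
      - moving_average eps (ar_psi beta) K (t%:Z - (j.+1)%:Z) w| <= eta0).
Proof.
move=> eta00 etagt0.
(* Indices of the values that occur: the time, the lag of the approximated value, and the position
   in the row. *)
pose I := ('I_n.+1 * 'I_p * 'I_p)%type.
pose N : R := #|{: I}|%:R.
have N1 : 0 < N + 1 by rewrite ltr_wpDl// ler0n.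
have etaN : 0 < eta / (N + 1) by rewrite divr_gt0.
have [A A0 vA] := stationary_tail etaN.
pose A' := A + `|mu|; have A'0 : 0 < A' by rewrite ltr_wpDr.
pose p1 : R := p%:R + 1; have p10 : 0 < p1 by rewrite ltr_wpDl.
have e0 : 0 < eta0 / (p1 * A') by rewrite divr_gt0// mulr_gt0.
have [K rowK] := ar_row_small e0.
exists K.
have := @whp_seq _ _ _ P _ (enum {: I}) (eta / (N + 1)) (fun i w =>
  `|v ((i.1.1 : nat)%:Z - (i.1.2.+1)%:Z - K%:Z - (i.2 : nat)%:Z) w| <= A).
move=> /(_ (fun i _ => vA _)) W.
apply: (whp_imp (whp_and W centered_recursion)).
  rewrite addr0 -cardE -/N mulrCA ler_piMr ?(ltW etagt0)//.
  by rewrite ler_pdivrMr// mul1r lerDl.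
move=> w [wA rec] t /andP[_ tn] j.
rewrite (ar_expansion (u := fun s => centered s w) _ K p_gt0 rec) /moving_average.
rewrite addrC addKr.
apply: le_trans (ler_norm_sum _ _ _) _.
apply: (@le_trans _ _ (\sum_(i < p) eta0 / (p1 * A') * A')).
  apply: ler_sum => i _; rewrite normrM; apply: ler_pM => //.
  rewrite /centered (le_trans (ler_normB _ _))// lerD2r.
  by apply: (wA (Ordinal tn, j, i)); rewrite mem_enum.
have -> : eta0 / (p1 * A') * A' = eta0 / p1.
  by rewrite invfM mulrA -mulrA mulVf ?mulr1 ?gt_eqF.
rewrite sumr_const card_ord -mulr_natl mulrA ler_pdivrMr// mulrC.
by rewrite ler_wpM2l ?(ltW eta00)// lerDl.
Qed.

End stationary_solution.

(** * The outliers *)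

Section contamination.
Context {d : measure_display} {T : measurableType d} {R : realType}.
Variable P : probability T R.
Variables (eps z xi : int -> {RV P >-> R}) (G : R -> R) (x : R).
Variables (Pi : probability R R) (rate : R).
Hypothesis indep : mutually_independent (noise_family eps z xi).
Hypothesis eps_cdf : forall t y, cdf (eps t) y = (G y)%:E.
Hypothesis xi_law : forall t (B : set R), measurable B ->
  distribution P (xi t) B = Pi B.
Hypothesis z_01 : forall t w, z t w = 0 \/ z t w = 1.
Hypothesis z_law : forall t, P [set w | z t w = 1] = rate%:E.

Local Notation Ieps t := (inl (inl t) : int + int + int).
Local Notation Iz t := (inl (inr t) : int + int + int).
Local Notation Ixi t := (inr t : int + int + int).
Local Notation other i := (other_noise eps z xi i).

Lemma z_other (s : int) i : Iz s != i ->
  measurable_fun setT (z s : other i -> R).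
Proof. by move=> si; apply: (other_noiseP (k := Iz s)). Qed.

Lemma xi_other (s : int) i : Ixi s != i ->
  measurable_fun setT (xi s : other i -> R).
Proof. by move=> si; apply: (other_noiseP (k := Ixi s)). Qed.

Let G01 y : 0 <= G y <= 1.
Proof.
by apply: (@cdf_bounds _ (distribution P (eps 0))) => a; exact: eps_cdf.
Qed.

Let G_measurable : measurable_fun setT G.
Proof.
apply: measurable_realfun.nondecreasing_measurable => // a b ab.
rewrite -lee_fin -!(eps_cdf 0); exact: cdf_nondecreasing.
Qed.

Lemma z_ge0 t w : 0 <= z t w.
Proof. by case: (z_01 t w) => ->. Qed.

Lemma z_sqr t w : z t w ^+ 2 = z t w.
Proof. by case: (z_01 t w) => ->; rewrite ?expr0n ?expr1n. Qed.

Lemma z_natb t w : z t w = (z t w == 1)%:R.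
Proof. by case: (z_01 t w) => ->; rewrite ?eqxx// eq_sym oner_eq0. Qed.

Lemma measurable_z_eq1 t : measurable [set w | z t w = 1].
Proof.
by have := measurable_funP (z t) measurableT _ (measurable_set1 1); rewrite setTI.
Qed.

Lemma meanle_z t : meanle P (z t) rate.
Proof.
have -> : (z t : T -> R) = fun w => (z t w == 1)%:R by apply/funext => w; exact: z_natb.
have E : [set w | z t w == 1] = [set w | z t w = 1].
  by apply/seteqP; split=> w /eqP.
by apply: meanle_indic; rewrite E ?z_law//; exact: measurable_z_eq1.
Qed.

Lemma rate_ge0 : 0 <= rate.
Proof. exact: meanle_ge0 (meanle_z 0). Qed.

Lemma rate_le1 : rate <= 1.
Proof. by rewrite -lee_fin -(z_law 0); exact/probability_le1/measurable_z_eq1. Qed.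

Section one_lag.
Variables (m : int) (b : R).

Definition shift_effect : R := fine 'E_Pi [fun u : R => G (x + b * u)] - G x.

Let Gb_measurable : measurable_fun setT (fun u : R => G (x + b * u)).
Proof.
by apply: (measurableT_comp G_measurable); apply: measurable_funD => //;
  exact: measurable_funM.
Qed.

Let integral_Gb t :
  (\int[distribution P (xi t)]_u (G (x + b * u) - G x - shift_effect)%:E = 0)%E.
Proof.
have iG : Pi.-integrable setT (fun u => (G (x + b * u))%:E).
  apply: measurable_bounded_integrable => //.
    by rewrite (le_lt_trans (probability_le1 _ _))// ltry.
  exists 1; split=> // M M1 y _ /=; rewrite (le_trans _ (ltW M1))//.
  by have /andP[? ?] := G01 (x + b * y); rewrite ler_norml; apply/andP; split; lra.
transitivity (\int[Pi]_u (G (x + b * u) - fine 'E_Pi [fun u : R => G (x + b * u)])%:E)%E.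
  transitivity (\int[Pi]_u (G (x + b * u) - G x - shift_effect)%:E)%E.
    by apply: eq_measure_integral => A mA _; exact: xi_law.
  by apply: eq_integral => u _; rewrite /shift_effect; congr EFin; ring.
under eq_integral do rewrite EFinB.
rewrite integralB//; last exact: finite_measure_integrable_cst.
rewrite integral_cst// [X in (_ * X)%E](_ : _ = 1%E); last exact: probability_setT.
rewrite mule1 fineK; first by rewrite unlock subee// integrable_fin_num.
by rewrite unlock integrable_fin_num.
Qed.

Lemma shift_effect_bound : `|shift_effect| <= 1.
Proof.
have g0 u : (0 <= (G (x + b * u))%:E)%E.
  by rewrite lee_fin; have /andP[] := G01 (x + b * u).
have g1 u : ((G (x + b * u))%:E <= 1)%E.
  by rewrite lee_fin; have /andP[] := G01 (x + b * u).
have mg : measurable_fun setT (fun u => (G (x + b * u))%:E).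
  exact/measurable_EFinP.
have E0 : (0 <= 'E_Pi [fun u : R => G (x + b * u)])%E.
  by rewrite unlock; apply: integral_ge0.
have E1 : ('E_Pi [fun u : R => G (x + b * u)] <= 1)%E.
  apply: (@le_trans _ _ (\int[Pi]_u cst 1 u)%E).
    by rewrite unlock; apply: ge0_le_integral.
  by rewrite integral_cst// mul1e; exact: probability_le1.
have Efin : ('E_Pi [fun u : R => G (x + b * u)])%E \is a fin_num.
  by rewrite ge0_fin_numE// (le_lt_trans E1)// ltry.
move: E0 E1; rewrite -(fineK Efin) !lee_fin => ? ?.
have /andP[? ?] := G01 x.
by rewrite /shift_effect ler_norml; apply/andP; split; lra.
Qed.

(** Centering in [eps k] with [xi] and [z] frozen. The deviation is at most 2 in absolute value and
    z^2 = z, so each square is at most 4 z. *)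
Let z_dev_sum n : meanle P (fun w => (\sum_(1 <= k < n.+1)
   z (k%:Z - m) w
     * threshold_dev eps G x (fun w => x + b * xi (k%:Z - m) w) k%:Z w) ^+ 2)
  (n%:R * (4 * rate)).
Proof.
apply: (meanle_sum_threshold indep eps_cdf (c := fun k w => z (k%:Z - m) w) n
  (tau := fun (k : nat) w => x + b * xi (k%:Z - m) w)).
- move=> k l _; apply: measurable_funD => //; apply: measurable_funM => //.
  exact: xi_other.
- by move=> k l _; exact: z_other.
- move=> k; apply: (meanle_le (meanleZ (k := 4) _ (meanle_z (k%:Z - m)))) => //.
    apply: measurable_funX; apply: measurable_funM => //; apply: measurable_funB.
      by apply: measurable_funB; apply: measurable_natb_le => //;
        apply: measurable_funD => //; exact: measurable_funM.
    by apply: measurable_funB => //; apply: measurableT_comp => //;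
      apply: measurable_funD => //; exact: measurable_funM.
  move=> w; rewrite sqr_ge0 exprMn z_sqr mulrC ler_wpM2r ?z_ge0//.
  rewrite -sqr_normE (_ : 4 = 2 ^+ 2 :> R); last by ring.
  rewrite ler_pXn2r ?nnegrE// /threshold_dev.
  have /andP[? ?] := G01 (x + b * xi (k%:Z - m) w); have /andP[? ?] := G01 x.
  by case: (_ <= x + _); case: (_ <= x); rewrite /= ler_norml; apply/andP; split; lra.
Qed.

(** Centering in [xi], with [z] frozen, of what the first centering leaves. *)
Let z_mean_sum n : meanle P (fun w => (\sum_(1 <= k < n.+1)
   z (k%:Z - m) w * (G (x + b * xi (k%:Z - m) w) - G x - shift_effect)) ^+ 2)
  (n%:R * (4 * rate)).
Proof.
apply: (meanle_sum_orthogonal indep n (i := fun k : nat => Ixi (k%:Z - m))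
  (f := fun k w y => z (k%:Z - m) w * (G (x + b * y) - G x - shift_effect))).
- move=> k; apply: measurable_funM.
    by apply: (measurableT_comp _ measurable_fst); exact: z_other.
  do 2 apply: measurable_funB => //.
  exact: (measurableT_comp Gb_measurable measurable_snd).
- move=> k w; apply: integral_scale_eq0; last exact: integral_Gb.
  by do 2 apply: measurable_funB => //.
- move=> k; apply: (meanle_le (meanleZ (k := 4) _ (meanle_z (k%:Z - m)))) => //.
    apply: measurable_funX; apply: measurable_funM => //.
    by do 2 apply: measurable_funB => //; exact: (measurableT_comp Gb_measurable).
  move=> w; rewrite sqr_ge0 exprMn z_sqr mulrC ler_wpM2r ?z_ge0//.
  rewrite -sqr_normE (_ : 4 = 2 ^+ 2 :> R); last by ring.
  rewrite ler_pXn2r ?nnegrE//.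
  have /andP[? ?] := G01 (x + b * xi (k%:Z - m) w); have /andP[? ?] := G01 x.
  have := shift_effect_bound; rewrite !ler_norml => /andP[? ?].
  by apply/andP; split; lra.
- move=> k l lk; apply: measurable_funM; first exact: z_other.
  do 2 apply: measurable_funB => //.
  apply: (measurableT_comp Gb_measurable); apply: xi_other.
  by apply/eqP => -[] /addIr [] lk'; rewrite lk' ltnn in lk.
Qed.

Let integral_z t : (\int[distribution P (z t)]_y (y - rate)%:E = 0)%E.
Proof.
have zE : (z t : T -> R) = \1_[set w | z t w = 1].
  apply/funext => w; rewrite indicE; case: (z_01 t w) => zt; rewrite zt.
    by rewrite memNset//= zt => /eqP; rewrite eq_sym oner_eq0.
  by rewrite mem_set.
have iz : P.-integrable setT (fun w => (z t w - rate)%:E).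
  apply: measurable_bounded_integrable => //.
  - by rewrite (le_lt_trans (probability_le1 _ _))// ltry.
  - exact: measurable_funB.
  exists (1 + rate); split=> [|M M1 w _ /=]; first exact: num_real.
  rewrite (le_trans _ (ltW M1))// (le_trans (ler_normB _ _))//.
  rewrite (ger0_norm rate_ge0) lerD2r.
  by case: (z_01 t w) => ->; rewrite ?normr0 ?normr1.
have mE : measurable_fun setT (fun y : R => (y - rate)%:E).
  by apply/measurable_EFinP; exact: measurable_funB.
rewrite (integral_pushforward (measurable_funP (z t)) mE iz measurableT) /=.
have mz1 := measurable_z_eq1 t.
transitivity (\int[P]_w ((\1_[set w | z t w = 1] w)%:E - rate%:E))%E.
  by apply: eq_integral => w _; rewrite EFinB -zE.
rewrite integralB//; last exact: finite_measure_integrable_cst.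
  rewrite integral_indic// setIT integral_cst//.
  rewrite [X in (X - _)%E](_ : _ = rate%:E); last exact: z_law.
  rewrite [X in (_ * X)%E](_ : _ = 1%E); last exact: probability_setT.
  by rewrite mule1 subee.
apply: measurable_bounded_integrable => //.
  by rewrite (le_lt_trans (probability_le1 _ _))// ltry.
exists 1; split=> // M M1 y _ /=; rewrite (le_trans _ (ltW M1))//.
by rewrite indicE; case: (_ \in _); rewrite ?normr0 ?normr1.
Qed.

(** Centering in [z]. The square is at most z + rate, of mean 2 rate; the weaker 4 rate matches the
    other two bounds. *)
Let z_rate_sum n : meanle P (fun w => (\sum_(1 <= k < n.+1)
   shift_effect * (z (k%:Z - m) w - rate)) ^+ 2) (n%:R * (4 * rate)).
Proof.
apply: (meanle_sum_orthogonal indep n (i := fun k : nat => Iz (k%:Z - m))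
  (f := fun k w y => shift_effect * (y - rate))).
- move=> k; apply: measurable_funM => //; apply: measurable_funB => //.
- move=> k w; apply: integral_scale_eq0; last exact: integral_z.
  exact: measurable_funB.
- move=> k; apply: (meanle_le (meanleD (meanle_z (k%:Z - m))
    (meanle_cst P rate_ge0))) => //.
  + by apply: measurable_funX; apply: measurable_funM => //; exact: measurable_funB.
  + move=> w; rewrite sqr_ge0 exprMn /=.
    have s1 : shift_effect ^+ 2 <= 1.
      rewrite -sqr_normE -(expr1n _ 2) ler_pXn2r ?nnegrE//.
      exact: shift_effect_bound.
    apply: le_trans (ler_wpM2r (sqr_ge0 _) s1) _; rewrite mul1r.
    have := rate_ge0; have := rate_le1.
    by case: (z_01 (k%:Z - m) w) => ->; nra.
  + have := rate_ge0; lra.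
- move=> k l lk; apply: measurable_funM => //; apply: measurable_funB => //.
  apply: z_other.
  by apply/eqP => -[] /addIr [] lk'; rewrite lk' ltnn in lk.
Qed.

(** The three centered sums telescope to the left-hand side; scaled by q, each has second moment at
    most 4 rate, which is small with q. *)
Lemma contamination_lag_whp (n : nat) (q del eta : R) :
  0 < q -> q ^+ 2 * n%:R = 1 -> 0 < del -> 4 * rate <= del ^+ 2 * eta ->
  whp P (3 * eta) (fun w => `| q * (\sum_(1 <= k < n.+1) z (k%:Z - m) w
      * le_increment x (fun t => eps t w) (x + b * xi (k%:Z - m) w) k%:Z)
    - q * n%:R * rate * shift_effect | <= 3 * del).
Proof.
move=> q0 qn del0 rd.
have W (X : T -> R) : meanle P (fun w => X w ^+ 2) (n%:R * (4 * rate)) ->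
    whp P eta (fun w => `|q * X w| <= del).
  move=> /(meanleZ (sqr_ge0 q)); rewrite mulrA qn mul1r => H.
  apply: (@whp_chebyshev _ _ _ P _ (4 * rate)) => //.
  by under eq_fun do rewrite exprMn.
apply: (whp_imp (whp_and (W _ (z_dev_sum n))
  (whp_and (W _ (z_mean_sum n)) (W _ (z_rate_sum n))))); first lra.
move=> w [w1 [w2 w3]].
set S1 := (X in `|q * X|) in w1; set S2 := (X in `|q * X|) in w2.
set S3 := (X in `|q * X|) in w3.
have -> : q * (\sum_(1 <= k < n.+1) z (k%:Z - m) w
      * le_increment x (fun t => eps t w) (x + b * xi (k%:Z - m) w) k%:Z)
    - q * n%:R * rate * shift_effect = q * S1 + q * S2 + q * S3.
  have -> : q * n%:R * rate * shift_effect =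
      q * \sum_(1 <= k < n.+1) rate * shift_effect.
    by rewrite sumr_const_nat subn1 /= -[(_ * _) *+ n]mulr_natl !mulrA.
  rewrite -!mulrDr -mulrBr; congr (_ * _).
  rewrite /S1 /S2 /S3 -sumrB -!big_split /=; apply: eq_bigr => k _.
  rewrite /threshold_dev /le_increment; ring.
apply: le_trans (ler_normD _ _) _; have := ler_normD (q * S1) (q * S2); lra.
Qed.

End one_lag.
End contamination.

(** * Pathwise splitting of the contaminated indicators *)

Section contamination_pointwise.
Context {R : realType} {p : nat}.
Variables (x : R) (e u ze xx : int -> R) (coef : 'I_p.+1 -> R).
Hypothesis ze_01 : forall t, ze t = 0 \/ ze t = 1.

(** Shaped so that the residual at t is at most x exactly when e t is at most this value, see
    [ar_residual_le]. There [coef] is [ar_coef0 beta], whose entry -1 accounts for an outlier at t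
    itself. *)
Definition full_threshold (q : R) (b : 'I_p -> R) (c : R) (t : int) : R :=
  x + \sum_(j < p.+1) coef j * (ze (t - j%:Z) * xx (t - j%:Z))
  + q * (\sum_(j < p) b j * (u (t - (j.+1)%:Z)
           + ze (t - (j.+1)%:Z) * xx (t - (j.+1)%:Z)) + c).

Definition ar_threshold (q : R) (b : 'I_p -> R) (c : R) (t : int) : R :=
  x + q * (\sum_(j < p) b j * u (t - (j.+1)%:Z) + c).

Definition contamination_increment (t : int) : R :=
  \sum_(j < p.+1) ze (t - j%:Z) * le_increment x e (x + coef j * xx (t - j%:Z)) t.

(** The double sum detects two outliers in one window. The rest collects single outliers at which
    the splitting may still fail: e t is close to a threshold, or xi or u is too large for the
    perturbation to be small. *)
Definition error_bound (s l : R) (t : int) : R :=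
  p.+3%:R * (\sum_(i < p.+1) \sum_(j < p.+1 | j != i) ze (t - i%:Z) * ze (t - j%:Z))
  + \sum_(j < p.+1) ze (t - j%:Z) *
      ((`|e t - (x + coef j * xx (t - j%:Z))| <= s)%R%:R
       + (`|e t - x| <= s)%R%:R
       + 2 * ((l < `|xx (t - j%:Z)|)%R%:R
              + \sum_(i < p) (l < `|u (t - (i.+1)%:Z)|)%R%:R)).

Lemma norm_le_increment (tau : R) t : `|le_increment x e tau t| <= 1.
Proof.
by rewrite /le_increment; case: (_ <= tau); case: (_ <= x);
  rewrite /= ler_norml; apply/andP; split; lra.
Qed.

Lemma le_indicator_shift (y tau h s : R) : `|h| <= s ->
  `|(y <= tau + h)%R%:R - (y <= tau)%R%:R : R| <= (`|y - tau| <= s)%R%:R.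
Proof.
rewrite ler_norml => /andP[h1 h2].
case: (leP y (tau + h)) => y1; case: (leP y tau) => y2;
  rewrite ?subrr ?normr0 ?ler0n// ?subr0 ?sub0r ?normrN normr1 ler1n lt0b.
- by rewrite ler_norml; apply/andP; split; lra.
- by rewrite ler_norml; apply/andP; split; lra.
Qed.

Lemma ze_ge0 t : 0 <= ze t.
Proof. by case: (ze_01 t) => ->. Qed.

Lemma ze_norm_le1 t : `|ze t| <= 1.
Proof. by case: (ze_01 t) => ->; rewrite ?normr0 ?normr1. Qed.

(* If at most one of z_t, ..., z_(t-p) is 1 the decomposition is exact up to
   perturbations of size s; two outliers in a window cost at most p + 3. *)
Lemma contamination_error q b c M Mc s l t :
  0 < q -> 0 <= M -> 0 <= l -> (forall j, `|b j| <= M) -> `|c| <= Mc ->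
  q * (2 * p%:R * M * l + Mc) <= s ->
  `| le_increment x e (full_threshold q b c t) t
     - le_increment x e (ar_threshold q b c t) t - contamination_increment t |
  <= error_bound s l t.
Proof.
move=> q0 M0 l0 bM cM qs.
have pair0 : 0 <= \sum_(i < p.+1) \sum_(j < p.+1 | j != i)
    ze (t - i%:Z) * ze (t - j%:Z).
  by apply: sumr_ge0 => i _; apply: sumr_ge0 => j _; rewrite mulr_ge0 ?ze_ge0.
have term0 j : 0 <= ze (t - (j : 'I_p.+1)%:Z) *
      ((`|e t - (x + coef j * xx (t - j%:Z))| <= s)%R%:R
       + (`|e t - x| <= s)%R%:R
       + 2 * ((l < `|xx (t - j%:Z)|)%R%:R
              + \sum_(i < p) (l < `|u (t - (i.+1)%:Z)|)%R%:R)).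
  rewrite mulr_ge0 ?ze_ge0// !addr_ge0// mulr_ge0// addr_ge0//.
  by apply: sumr_ge0 => i _.
have sum0 := sumr_ge0 _ (fun j (_ : xpredT j) => term0 j).
have [[i0 [j0 [ij zi zj]]]|nopair] := pselect (exists i j : 'I_p.+1,
    [/\ j != i, ze (t - i%:Z) = 1 & ze (t - j%:Z) = 1]).
  have pair1 : 1 <= \sum_(i < p.+1) \sum_(j < p.+1 | j != i)
      ze (t - i%:Z) * ze (t - j%:Z).
    rewrite (bigD1 i0)//= (bigD1 j0)//= zi zj mulr1 -addrA lerDl addr_ge0//.
      by apply: sumr_ge0 => j _; rewrite mulr_ge0 ?ze_ge0 ?mul1r ?ze_ge0.
    by apply: sumr_ge0 => i _; apply: sumr_ge0 => j _; rewrite mulr_ge0 ?ze_ge0.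
  have con : `|contamination_increment t| <= p.+1%:R.
    apply: le_trans (ler_norm_sum _ _ _) _.
    have -> : p.+1%:R = \sum_(j < p.+1) (1 : R) by rewrite sumr_const card_ord.
    apply: ler_sum => j _; rewrite normrM mulr_ile1// ?ze_norm_le1//.
    exact: norm_le_increment.
  (* The constant is 1 + 1 + (p + 1): two increments and the contamination sum. *)
  apply: (@le_trans _ _ p.+3%:R).
    have := norm_le_increment (full_threshold q b c t) t.
    have := norm_le_increment (ar_threshold q b c t) t.
    rewrite -natr1 -[p.+2%:R]natr1 => h1 h2.
    apply: le_trans (ler_normB _ _) _.
    apply: le_trans (lerD (ler_normB _ _) con) _; lra.
  rewrite /error_bound -[leLHS]mulr1; apply: ler_wpDr => //.
  exact: ler_wpM2l.
have [[j0 zj0]|nz] := pselect (exists j : 'I_p.+1, ze (t - j%:Z) = 1); last first.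
  have z0 (j : 'I_p.+1) : ze (t - j%:Z) = 0.
    by case: (ze_01 (t - j%:Z)) => // zj; case: nz; exists j.
  have -> : contamination_increment t = 0.
    by rewrite /contamination_increment big1// => j _; rewrite z0 mul0r.
  have -> : full_threshold q b c t = ar_threshold q b c t.
    rewrite /full_threshold /ar_threshold big1 ?addr0; last first.
      by move=> j _; rewrite z0 mul0r mulr0.
    congr (_ + q * (_ + _)); apply: eq_bigr => j _.
    by have := z0 (lift ord0 j); rewrite /= => ->; rewrite mul0r addr0.
  rewrite subrr subr0 normr0 /error_bound addr_ge0//.
  exact: mulr_ge0.
have zother (j : 'I_p.+1) : j != j0 -> ze (t - j%:Z) = 0.
  move=> jj; case: (ze_01 (t - j%:Z)) => // zj; case: nopair.
  by exists j0, j.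
rewrite /error_bound; apply: ler_wpDl; first exact: mulr_ge0.
rewrite (bigD1 j0)//= ler_wpDr//; first by apply: sumr_ge0.
rewrite zj0 mul1r.
have -> : contamination_increment t = le_increment x e (x + coef j0 * xx (t - j0%:Z)) t.
  rewrite /contamination_increment (bigD1 j0)//= zj0 mul1r big1 ?addr0// => j jj.
  by rewrite zother// mul0r.
have fE : full_threshold q b c t = (x + coef j0 * xx (t - j0%:Z)) +
   q * (\sum_(j < p) b j * (u (t - (j.+1)%:Z)
           + ze (t - (j.+1)%:Z) * xx (t - (j.+1)%:Z)) + c).
  rewrite /full_threshold (bigD1 j0)//= zj0 mul1r big1 ?addr0// => j jj.
  by rewrite zother// mul0r mulr0.
rewrite fE /ar_threshold.
set h1 := q * _; set h0 := q * _; set y := x + coef j0 * _.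
(* A single outlier moves the base point from x to y; what remains is the effect of the small shift
   h1 at y minus that of h0 at x. *)
have E : le_increment x e (y + h1) t - le_increment x e (x + h0) t
    - le_increment x e y t =
  ((e t <= y + h1)%R%:R - (e t <= y)%R%:R)
  - ((e t <= x + h0)%R%:R - (e t <= x)%R%:R).
  by rewrite /le_increment; ring.
rewrite E.
have two : `|((e t <= y + h1)%R%:R - (e t <= y)%R%:R)
  - ((e t <= x + h0)%R%:R - (e t <= x)%R%:R) : R| <= 2.
  have natbB (b1 b2 : bool) : `|b1%:R - b2%:R : R| <= 1.
    by case: b1; case: b2; rewrite ?subrr ?subr0 ?sub0r ?normrN ?normr1 ?normr0.
  exact: le_trans (ler_normB _ _) (lerD (natbB _ _) (natbB _ _)).
have usum0 : 0 <= \sum_(i < p) (l < `|u (t - (i.+1)%:Z)|)%R%:R :> R by exact: sumr_ge0.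
have near0 (b1 : bool) : 0 <= b1%:R :> R by [].
have [xl|xl] := ltP l `|xx (t - j0%:Z)|.
  apply: le_trans two _; have := near0 (`|e t - y| <= s); have := near0 (`|e t - x| <= s).
  by rewrite /= => *; lra.
have [[i0 ui]|nu] := pselect (exists i : 'I_p, l < `|u (t - (i.+1)%:Z)|).
  apply: le_trans two _; have := near0 (`|e t - y| <= s); have := near0 (`|e t - x| <= s).
  have : 1 <= \sum_(i < p) (l < `|u (t - (i.+1)%:Z)|)%R%:R :> R.
    by rewrite (bigD1 i0)//= ui lerDl sumr_ge0.
  by rewrite /= => *; lra.
have ul (i : 'I_p) : `|u (t - (i.+1)%:Z)| <= l.
  by rewrite leNgt; apply/negP => ui; apply: nu; exists i.
(* Only slot [j0] carries an outlier, whose size is at most l here; all other products vanish. *)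
have zl (i : 'I_p) : `|ze (t - (i.+1)%:Z) * xx (t - (i.+1)%:Z)| <= l.
  have [E1|ne] := eqVneq (lift ord0 i) j0.
    move: xl; rewrite -E1 /= => xl; rewrite normrM.
    by apply: le_trans xl; rewrite ler_piMl// ze_norm_le1.
  by have := zother _ ne; rewrite /= => ->; rewrite mul0r normr0.
have pMl (y' : 'I_p -> R) : (forall i, `|y' i| <= l) ->
    `|\sum_(j < p) b j * y' j| <= p%:R * (M * l).
  move=> yl; apply: le_trans (ler_norm_sum _ _ _) _.
  have -> : p%:R * (M * l) = \sum_(j < p) M * l.
    by rewrite sumr_const card_ord mulr_natl.
  by apply: ler_sum => j _; rewrite normrM; apply: ler_pM.
have h1s : `|h1| <= s.
  rewrite normrM (gtr0_norm q0) (le_trans _ qs)// ler_wpM2l ?(ltW q0)//.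
  apply: le_trans (ler_normD _ _) _; apply: lerD => //.
  under eq_bigr do rewrite mulrDr.
  rewrite big_split /=; apply: le_trans (ler_normD _ _) _.
  by have := pMl _ ul; have := pMl _ zl => *; lra.
have h0s : `|h0| <= s.
  rewrite normrM (gtr0_norm q0) (le_trans _ qs)// ler_wpM2l ?(ltW q0)//.
  apply: le_trans (ler_normD _ _) _; apply: lerD => //.
  have := pMl _ ul; have : 0 <= p%:R * (M * l) by rewrite !mulr_ge0.
  by move=> *; lra.
apply: le_trans (ler_normB _ _) _.
have := le_indicator_shift (e t) y h1s; have := le_indicator_shift (e t) x h0s.
by move=> *; rewrite /= -/y; lra.
Qed.

End contamination_pointwise.

(** * Mean of the splitting error *)

Section contamination_error_probability.
Context {d : measure_display} {T : measurableType d} {R : realType} {p : nat}.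
Variable P : probability T R.
Variables (eps z xi : int -> {RV P >-> R}) (G : R -> R) (L x : R).
Variables (Pi : probability R R) (rate : R).
Hypothesis indep : mutually_independent (noise_family eps z xi).
Hypothesis eps_cdf : forall t y, cdf (eps t) y = (G y)%:E.
Hypothesis eps_var : ('E_P [fun w => (eps 1 w ^+ 2)%R] < +oo)%E.
Hypothesis lipG : forall a b, `|G a - G b| <= L * `|a - b|.
Hypothesis xi_law : forall t (B : set R), measurable B ->
  distribution P (xi t) B = Pi B.
Hypothesis z_01 : forall t w, z t w = 0 \/ z t w = 1.
Hypothesis z_law : forall t, P [set w | z t w = 1] = rate%:E.
Variables (psi : nat -> R) (Psi : R).
Hypothesis psi_sum : forall K, \sum_(k < K) `|psi k| <= Psi.
Variables (coef : 'I_p.+1 -> R).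

Local Notation Ieps t := (inl (inl t) : int + int + int).
Local Notation Iz t := (inl (inr t) : int + int + int).
Local Notation Ixi t := (inr t : int + int + int).
Local Notation other i := (other_noise eps z xi i).
Local Notation ma := (moving_average eps psi).
Local Notation C2 := (ma_moment eps Psi).

Let rate0 : 0 <= rate.
Proof. exact: rate_ge0 z_01 z_law. Qed.

Lemma meanle_z_indep (s : int) (h : T -> R) c :
  measurable_fun setT (h : other (Iz s) -> R) -> meanle P h c ->
  meanle P (fun w => z s w * h w) (rate * c).
Proof.
move=> mh hc; have h0 : forall w, 0 <= h w by case: hc.
(* The absolute value makes the integrand nonnegative on the whole line, as [meanle_others] asks,
   and changes nothing at the values 0 and 1. *)
rewrite (_ : (fun w => _) = fun w => h w * `|z s w|); last first.
  by apply/funext => w; rewrite mulrC ger0_norm// (z_ge0 z_01).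
apply: (meanle_others indep (i := Iz s) (f := fun v => h v.1 * `|v.2|) _ _
  (meanleZ rate0 hc)).
- apply: measurable_funM; first exact: (measurableT_comp mh measurable_fst).
  by apply: measurableT_comp.
- by move=> v; rewrite mulr_ge0.
- move=> w /=; under eq_integral do rewrite EFinM.
  rewrite ge0_integralZl_EFin//; last exact/measurable_EFinP.
  rewrite muleC [in leRHS]EFinM lee_wpmul2r ?lee_fin//.
  rewrite ge0_integral_pushforward//; last exact/measurable_EFinP.
  have [_ _] := meanle_z z_01 z_law s; apply: le_trans.
  rewrite le_eqVlt; apply/orP; left; apply/eqP; apply: eq_integral => v _ /=.
  by rewrite ger0_norm// (z_ge0 z_01).
Qed.

(** With rate = O(q) the product is O(1/n), so pairs of outliers contribute only O(q) after
    summation and scaling. *)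
Lemma meanle_z_pair (s t : int) : s != t ->
  meanle P (fun w => z s w * z t w) (rate * rate).
Proof.
move=> st; apply: meanle_z_indep; last exact: meanle_z.
by apply: z_other; apply: contra_neq st => -[].
Qed.

Lemma meanle_z_near (s t : int) (b r : R) : 0 < r ->
  meanle P (fun w => z s w * (`|eps t w - (x + b * xi s w)| <= r)%R%:R)
    (3 * L * (rate * r)).
Proof.
move=> r0; apply: (meanle_eps_near indep eps_cdf lipG (s := cst r)) => //.
- apply: measurable_funD => //; apply: measurable_funM => //; exact: xi_other.
- exact: z_other.
- by move=> w; exact: z_ge0.
- have := meanleZ (ltW r0) (meanle_z z_01 z_law s); rewrite mulrC.
  by congr (meanle P _ _); apply/funext => w; rewrite mulrC.
Qed.

Lemma meanle_z_xi_far (s : int) (l c : R) : (Pi [set y | l < `|y|]%R <= c%:E)%E ->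
  meanle P (fun w => z s w * (l < `|xi s w|)%R%:R) (rate * c).
Proof.
move=> Pic; apply: meanle_z_indep.
  apply: measurable_natb; apply: measurable_fun_ltr => //.
  by apply: measurableT_comp => //; exact: xi_other.
have mB : measurable [set y : R | l < `|y|].
  by apply: measurable_pred; apply: measurable_fun_ltr => //; exact: measurableT_comp.
apply: meanle_indic.
  by apply: measurable_pred; apply: measurable_fun_ltr => //; exact: measurableT_comp.
by apply: le_trans Pic; rewrite -(xi_law s mB).
Qed.

Lemma meanle_z_ma_far (s t : int) K (l c : R) : 0 < l -> C2 <= l ^+ 2 * c ->
  meanle P (fun w => z s w * (l < `|ma K t w|)%R%:R) (rate * c).
Proof.
move=> l0 lc; apply: meanle_z_indep.
  apply: measurable_natb; apply: measurable_fun_ltr => //.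
  by apply: measurableT_comp => //; exact: moving_average_other.
have l2 : 0 < l ^+ 2 by rewrite exprn_gt0.
apply: (meanle_le (meanleZ (k := (l ^+ 2)^-1) _
  (meanle_moving_average_sqr eps_cdf eps_var psi_sum K t))).
- by rewrite invr_ge0 ltW.
- apply: measurable_natb; apply: measurable_fun_ltr => //.
  by apply: measurableT_comp => //; exact: moving_average_measurable.
- move=> w; rewrite ler0n /=; case: ltP => [lm|_].
    rewrite mulrC ler_pdivlMr// mul1r -(sqr_normE (ma K t w)).
    by rewrite ler_pXn2r ?nnegrE// ltW.
  by rewrite mulr_ge0 ?invr_ge0 ?sqr_ge0// ltW.
- by rewrite mulrC ler_pdivrMr// mulrC.
Qed.

(* The factor 0 lets meanle_z_near cover both neighbourhoods. *)
Definition error_bound_at K (s l : R) (t : int) (w : T) : R :=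
  p.+3%:R * (\sum_(i < p.+1) \sum_(j < p.+1 | j != i)
     z (t - i%:Z) w * z (t - j%:Z) w)
  + \sum_(j < p.+1)
      (z (t - j%:Z) w * (`|eps t w - (x + coef j * xi (t - j%:Z) w)| <= s)%R%:R
       + z (t - j%:Z) w * (`|eps t w - (x + 0 * xi (t - j%:Z) w)| <= s)%R%:R
       + 2 * (z (t - j%:Z) w * (l + 1 < `|xi (t - j%:Z) w|)%R%:R
              + \sum_(i < p) z (t - j%:Z) w
                    * (l < `|ma K (t - (i.+1)%:Z) w|)%R%:R)).

(** Each term carries a factor rate, and q n rate will be gamma. The remaining factor must therefore
    be small: rate for the pairs, [s] for the windows, [c] for the tails. *)
Lemma meanle_error_bound K s l c t : 0 < s -> 0 < l ->
  (Pi [set y | l + 1 < `|y|]%R <= c%:E)%E -> C2 <= l ^+ 2 * c ->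
  meanle P (error_bound_at K s l t)
    (p.+3%:R * (p.+1%:R * (p.+1%:R * (rate * rate)))
     + p.+1%:R * (3 * L * (rate * s) + 3 * L * (rate * s)
                  + 2 * (rate * c + p%:R * (rate * c)))).
Proof.
move=> s0 l0 Pic lc.
have c0 : 0 <= c by rewrite -lee_fin (le_trans _ Pic).
have sumC (m : nat) (F : 'I_m -> T -> R) k : (forall i, meanle P (F i) k) ->
    meanle P (fun w => \sum_(i < m) F i w) (m%:R * k).
  move=> Fk; have -> : m%:R * k = \sum_(i < m) k.
    by rewrite sumr_const card_ord mulr_natl.
  by apply: meanle_sum.
apply: meanleD.
- apply: meanleZ => //; apply: (sumC) => i.
  have rr : 0 <= rate * rate by rewrite mulr_ge0.
  have -> : p.+1%:R * (rate * rate) = \sum_(j < p.+1) rate * rate.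
    by rewrite sumr_const card_ord mulr_natl.
  have := meanle_sum (index_enum 'I_p.+1) (Q := fun j => j != i)
    (X := fun j w => z (t - i%:Z) w * z (t - j%:Z) w) (q := fun=> rate * rate).
  move=> /(_ P) H; apply: meanle_le (H _) _ _ _.
  + move=> j ji; apply: meanle_z_pair; apply: contra_neq ji => /addrI/oppr_inj [].
    by move/val_inj.
  + under eq_fun do rewrite big_mkcond.
    by apply: measurable_sum => j; case: (j != i) => //; exact: measurable_funM.
  + move=> w; rewrite lexx andbT; apply: sumr_ge0 => j _.
    by rewrite mulr_ge0 ?(z_ge0 z_01).
  + by rewrite [leRHS](bigID (fun j => j != i))/= lerDl sumr_ge0.
- apply: (sumC) => j; apply: meanleD; first apply: meanleD.
  + exact: meanle_z_near.
  + exact: meanle_z_near.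
  + apply: meanleZ => //; apply: meanleD; first exact: meanle_z_xi_far.
    by apply: (sumC) => i; exact: meanle_z_ma_far.
Qed.

(** A distance of at most 1 between u and the moving average lowers the level from l + 1 to l. *)
Lemma error_bound_le K s l t w (u : int -> R) :
  (forall j : 'I_p, `|u (t - (j.+1)%:Z) - ma K (t - (j.+1)%:Z) w| <= 1) ->
  error_bound x (fun t => eps t w) u (fun t => z t w) (fun t => xi t w) coef
    s (l + 1) t <= error_bound_at K s l t w.
Proof.
move=> um; apply: lerD => //; apply: ler_sum => j _.
rewrite /= mul0r addr0.
have : z (t - j%:Z) w * \sum_(i < p) (l + 1 < `|u (t - (i.+1)%:Z)|)%R%:R <=
    \sum_(i < p) z (t - j%:Z) w * (l < `|ma K (t - (i.+1)%:Z) w|)%R%:R.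
  rewrite mulr_sumr; apply: ler_sum => i _; apply: ler_wpM2l; first exact: z_ge0.
  rewrite ler_nat; case: ltP => // lu; rewrite (_ : _ < _)//.
  have := um i; have := ler_normD (u (t - (i.+1)%:Z) - ma K (t - (i.+1)%:Z) w)
    (ma K (t - (i.+1)%:Z) w); rewrite subrK => *; lra.
move=> *; lra.
Qed.

End contamination_error_probability.

(** * Passage to the limit, uniformly in the contamination level *)

Lemma cvge0_small {R : realType} (f : nat -> \bar R) :
  (forall n, 0 <= f n)%E ->
  (forall eta : R, 0 < eta -> \forall n \near \oo, (f n <= eta%:E)%E) ->
  f @ \oo --> 0%E.
Proof.
move=> f0 fs; apply: cvg_EFin.
  apply: filterS (fs 1 ltr01) => n fn1.
  by rewrite ge0_fin_numE// (le_lt_trans fn1)// ltry.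
apply/cvgr0Pnorm_le => eta eta0; apply: filterS (fs _ eta0) => n fn /=.
have ffin : f n \is a fin_num by rewrite ge0_fin_numE// (le_lt_trans fn)// ltry.
by rewrite ger0_norm ?fine_ge0// -lee_fin fineK.
Qed.

Section estimator_bounds.
Context {d : measure_display} {T : measurableType d} {R : realType}.
Variable P : probability T R.

Lemma whp_norm_le (X : T -> R) (M eta : R) : measurable_fun setT X ->
  (P [set w | (M < `|X w|)%R] <= eta%:E)%E -> whp P eta (fun w => `|X w| <= M).
Proof.
move=> mX PX; apply: (@whp_prob _ _ _ P (fun w => `|X w| <= M)).
  by apply: measurable_fun_ler => //; exact: measurableT_comp.
by rewrite (_ : [set w | ~~ (_ <= _)] = [set w | M < `|X w|])//;
  apply/seteqP; split=> w /=; rewrite ltNge.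
Qed.

Lemma mx_entry_norm_le (p : nat) (v : 'cV[R]_p) j : `|v j 0| <= `|v|.
Proof.
rewrite [leRHS]mx_normrE.
exact: (le_bigmax _ (fun ij : 'I_p * 'I_1 => `|v ij.1 ij.2|) (j, 0)).
Qed.

(** A nonzero max norm is attained at some entry, and [0 <= M] ensures that it is nonzero. *)
Lemma mx_norm_gt_entry (p : nat) (v : 'cV[R]_p) (M : R) : 0 <= M -> M < `|v| ->
  exists j, M < `|v j 0|.
Proof.
move=> M0 Mv; have [|[i k] E] := @mx_norm_neq0 _ _ _ v.
  by rewrite gt_eqF//; exact: le_lt_trans Mv.
by exists i; move: E; rewrite /= (ord1 k) => <-.
Qed.

Lemma whp_mx_norm_le (p : nat) (X : 'I_p -> T -> R) (M eta : R) :
  (forall j, measurable_fun setT (X j)) ->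
  (P [set w | (M < `|\col_j X j w : 'cV[R]_p|)%R] <= eta%:E)%E ->
  whp P eta (fun w => forall j, `|X j w| <= M).
Proof.
move=> mX PX; exists [set w | M < `|\col_j X j w : 'cV[R]_p|]; split=> //.
  (* A negative level makes the event the whole space; otherwise it is a finite union over the
     entries. *)
  have [M0|M0] := leP 0 M; last first.
    rewrite (_ : [set w | _] = setT)//; apply/seteqP; split=> // w _ /=.
    exact: lt_le_trans M0 _.
  rewrite (_ : [set w | _] = \bigcup_(j in [set: 'I_p]) [set w | M < `|X j w|]).
    apply: fin_bigcup_measurable => // j _; apply: measurable_pred.
    by apply: measurable_fun_ltr => //; exact: measurableT_comp.
  apply/seteqP; split=> [w /(mx_norm_gt_entry M0)[j]|w [j _ /= Mj]].
    by rewrite mxE => Mj; exists j.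
  by apply: lt_le_trans Mj _; have := mx_entry_norm_le (\col_j X j w) j; rewrite mxE.
move=> w /negP; rewrite -leNgt => wM j; apply: le_trans wM.
by have := mx_entry_norm_le (\col_j X j w) j; rewrite mxE.
Qed.

End estimator_bounds.

(** The recursion leaves only e t of the uncontaminated part; the product of the two estimation
    errors is the source of the term q a sum bb_j. *)
Lemma ar_residual_le {R : realType} {p : nat} (beta b : 'cV[R]_p)
    (mu mh a q x : R) (v e ze xx : int -> R) t :
  (forall s, v s - mu = \sum_(j < p) beta j 0 * (v (s - (j.+1)%:Z) - mu) + e s) ->
  mh - mu = q * a ->
  forall y, (forall s, y s = v s + ze s * xx s) ->
  forall bb : 'I_p -> R, (forall j, b j 0 - beta j 0 = q * bb j) ->
  (ar_residual b mh y t <= x) =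
  (e t <= full_threshold x (fun s => v s - mu) ze xx (ar_coef0 beta) q bb
     (ar_at1 beta * a - q * a * \sum_(j < p) bb j) t).
Proof.
move=> rec mhE y yE bb bE.
set th := full_threshold _ _ _ _ _ _ _ _ _.
suff -> : ar_residual b mh y t = e t - (th - x) by rewrite lerBlDr subrKC.
rewrite /th /full_threshold /ar_residual.
have vt := rec t; have -> : e t = v t - mu - \sum_(j < p) beta j 0 * (v (t - (j.+1)%:Z) - mu).
  by rewrite vt addrC addKr.
have mE : mh = mu + q * a by rewrite -mhE addrC subrK.
have bjE j : b j 0 = beta j 0 + q * bb j by rewrite -bE addrC subrK.
have -> : \sum_(j < p.+1) ar_coef0 beta j * (ze (t - j%:Z) * xx (t - j%:Z)) =
    - (ze t * xx t)
    + \sum_(j < p) beta j 0 * (ze (t - (j.+1)%:Z) * xx (t - (j.+1)%:Z)).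
  rewrite big_ord_recl /= /ar_coef0 unlift_none subr0 mulN1r; congr (_ + _).
  by apply: eq_bigr => j _; rewrite liftK.
have -> : \sum_(j < p) b j 0 * (y (t - (j.+1)%:Z) - mh) =
   \sum_(j < p) beta j 0 * (v (t - (j.+1)%:Z) - mu)
   + \sum_(j < p) beta j 0 * (ze (t - (j.+1)%:Z) * xx (t - (j.+1)%:Z))
   - q * a * \sum_(j < p) beta j 0
   + q * (\sum_(j < p) bb j * (v (t - (j.+1)%:Z) - mu
       + ze (t - (j.+1)%:Z) * xx (t - (j.+1)%:Z)))
   - q * (q * a * \sum_(j < p) bb j).
  rewrite !mulr_sumr -!big_split /= -!sumrB -!big_split /= -!sumrB.
  by apply: eq_bigr => j _; rewrite yE mE bjE; ring.
rewrite yE mE /ar_at1; ring.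
Qed.

Lemma eventually_small_inv_sqrt {R : realType} (A : R -> Prop) :
  eventually_small A ->
  \forall n \near \oo, (0 < n)%N /\ A (Num.sqrt n%:R)^-1.
Proof.
move=> [q0 q00 Aq]; exists (Num.bound (q0 ^- 2)).+1 => // n /= nb.
have n0 : (0 < n)%N by exact: leq_ltn_trans nb.
have nR : 0 < n%:R :> R by rewrite ltr0n.
have sn : 0 < Num.sqrt n%:R :> R by rewrite sqrtr_gt0.
split=> //; apply: Aq; first by rewrite invr_gt0.
rewrite -[q0]invrK lef_pV2 ?posrE ?invr_gt0//.
rewrite -(@ler_pXn2r _ 2) ?nnegrE ?invr_ge0 ?(ltW q00) ?sqrtr_ge0//.
rewrite sqr_sqrtr ?(ltW nR)// exprVn (le_trans (ltW (archi_boundP _)))//.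
  by rewrite invr_ge0 exprn_ge0// ltW.
by rewrite ler_nat ltnW.
Qed.

Theorem theorem2p1
  (d : measure_display) (T : measurableType d) (R : realType)
  (P : probability T R)
  (p : nat) (p_gt0 : (0 < p)%N)
  (beta : 'cV[R]_p) (beta_stable : ar_stable beta)
  (mu nu : R) (nuE : nu = ar_at1 beta * mu)
  (G : R -> R) (Pi : probability R R)
  (eps v xi : int -> {RV P >-> R})
  (z : R -> nat -> int -> {RV P >-> R})
  (eps_cdf : forall t y, cdf (eps t) y = (G y)%:E)
  (eps_mean : ('E_P [eps 1%R] = 0)%E)
  (eps_var : (0 < 'E_P [fun w => (eps 1 w ^+ 2)%R] < +oo)%E)
  (v_sol : stationary_ar_solution beta nu eps v)
  (xi_law : forall t (B : set R), measurable B ->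
     distribution P (xi t) B = Pi B)
  (z_01 : forall (gamma : R) n t w, 0 <= gamma -> (0 < n)%N ->
     z gamma n t w = 0 \/ z gamma n t w = 1)
  (z_law : forall (gamma : R) n t, 0 <= gamma -> (0 < n)%N ->
     P [set w | z gamma n t w = 1] = (contamination_rate gamma n)%:E)
  (indep : forall (gamma : R) n, 0 <= gamma -> (0 < n)%N ->
     mutually_independent (noise_family eps (z gamma n) xi))
  (muhat : R -> nat -> {RV P >-> R})
  (betahat : R -> nat -> 'I_p -> {RV P >-> R})
  (muhat_OP : uniform_OP1 P (fun gamma n w =>
     Num.sqrt n%:R * (muhat gamma n w - mu) : R^o))
  (betahat_OP : uniform_OP1 P (fun gamma n w =>
     Num.sqrt n%:R *: ((\col_j betahat gamma n j w) - beta)))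
  (g : R -> R)
  (G_diff : forall y : R, is_derive y 1 G (g y))
  (g_diff : forall y : R, derivable g y 1)
  (g'_bounded :
     (ereal_sup [set (`|derive1 g y|%R)%:E | y in [set: R]] < +oo)%E)
  (Gamma : R) (Gamma_ge0 : 0 <= Gamma) (x delta : R) (delta_gt0 : 0 < delta) :
  let y gamma n w := contaminated v (z gamma n) xi w in
  let epshat gamma n w :=
    ar_residual (\col_j betahat gamma n j w) (muhat gamma n w) (y gamma n w) in
  let Ghat gamma n w := edf n (epshat gamma n w) x in
  let Gn n w := edf n (fun t => eps t w) x in
  (fun n : nat => ereal_sup
     [set P [set w | delta <
         `| Num.sqrt n%:R * (Ghat gamma n w - Gn n w)
            - g x * ar_at1 beta * (Num.sqrt n%:R * (muhat gamma n w - mu))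
            - gamma * Delta beta G Pi x |]
     | gamma in [set gamma : R | 0 <= gamma <= Gamma]]) @ \oo --> 0%E.
Proof.
move=> y epshat Ghat Gn.
pose kap := ar_at1 beta.
pose stat gamma n w := Num.sqrt n%:R * (Ghat gamma n w - Gn n w)
  - g x * kap * (Num.sqrt n%:R * (muhat gamma n w - mu)) - gamma * Delta beta G Pi x.
have stat_measurable gamma n : measurable_fun setT (stat gamma n).
  have my t : measurable_fun setT (fun w => y gamma n w t).
    by apply: measurable_funD => //; exact: measurable_funM.
  have me t : measurable_fun setT (fun w => epshat gamma n w t).
    apply: measurable_funB; first exact: measurable_funB.
    apply: measurable_sum => j; apply: measurable_funM; last exact: measurable_funB.
    under eq_fun do rewrite mxE.
    exact: measurable_funP.
  have mG (e : T -> int -> R) : (forall t, measurable_fun setT (e ^~ t)) ->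
      measurable_fun setT (fun w => edf n (e w) x).
    move=> em; apply: measurable_funM => //; apply: measurable_sum => t.
    by apply: measurable_natb_le => //; exact: em.
  apply: measurable_funB => //; apply: measurable_funB.
    by apply: measurable_funM => //; apply: measurable_funB; exact: mG.
  by do 2 apply: measurable_funM => //; exact: measurable_funB.
(* The supremum over gamma is taken inside the limit, so one threshold on n must serve all gamma;
   the exceptional event may depend on gamma. *)
suff key : forall eta : R, 0 < eta -> \forall n \near \oo,
    forall gamma, 0 <= gamma <= Gamma -> whp P eta (fun w => `|stat gamma n w| <= delta).
  apply: cvge0_small => [n|eta eta0].
    apply: (@le_trans _ _ (P [set w | delta < `|stat 0 n w|])) => //.
    by apply: ereal_sup_ubound; exists 0 => //=; rewrite lexx.
  apply: filterS (key eta eta0) => n H; apply: ge_ereal_sup => _ [gamma gG <-].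
  have [E [mE PE EH]] := H gamma gG; apply: le_trans PE; apply: le_measure.
  - rewrite inE; apply: measurable_pred; apply: measurable_fun_ltr => //.
    by apply: measurableT_comp => //; exact: stat_measurable.
  - by rewrite inE.
  - move=> w /= dw; apply: contrapT => /EH; rewrite leNgt => /negP; exact.
move=> eta eta0.
have eta8 : 0 < eta / 8 by rewrite divr_gt0.
have del4 : 0 < delta / 4 by rewrite divr_gt0.
have [Ma nearMa] := muhat_OP Gamma (eta / 8) eta8.
have [Mb nearMb] := betahat_OP Gamma (eta / 8) eta8.
pose M := `|Ma| + `|Mb| + 1.
have M0 : 0 < M by rewrite ltr_wpDl// addr_ge0.
have MaM : Ma <= M by rewrite (le_trans (ler_norm Ma))// /M -addrA lerDl addr_ge0.
have MbM : Mb <= M.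
  by rewrite (le_trans (ler_norm Mb))// /M addrAC lerDr addr_ge0.
have [B B0 g_lip] := derivable_bounded_lipschitz g_diff g'_bounded.
have eps_var_lty : ('E_P [fun w => (eps 1 w ^+ 2)%R] < +oo)%E by case/andP: eps_var.
have lipG := G_lipschitz eps_cdf G_diff g_lip.
have L0 : 0 <= 1 + B by rewrite addr_ge0.
have [Psi psi_sum] := ar_psi_summable p_gt0 beta_stable.
set C2 := ma_moment eps Psi.
have C20 : 0 <= C2 by exact: (ma_moment_ge0 eps_cdf eps_var_lty Psi).
have approx := moving_average_approx p_gt0 beta_stable nuE v_sol.
(* The conclusion mentions no [z], so a single instance of independence, at gamma = 0 and n = 1,
   yields a bound valid for all gamma. *)
have part1 := residual_sum_whp x (indep 0 1%N (lexx 0) isT) eps_cdf eps_mean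
  eps_var_lty G_diff g_lip psi_sum approx kap M0 del4 eta8.
pose p1 : R := p.+1%:R; have p10 : 0 < p1 by rewrite ltr0n.
(* Over the p + 1 lags, errors 3 dj add up to delta / 4 and probabilities 3 ej to eta / 8. *)
pose dj := delta / (12 * p1); have dj0 : 0 < dj by rewrite divr_gt0// mulr_gt0.
pose ej := eta / (24 * p1); have ej0 : 0 < ej by rewrite divr_gt0// mulr_gt0.
have djej : 0 < dj ^+ 2 * ej by rewrite mulr_gt0// exprn_gt0.
(* Markov's inequality asks for a mean of at most D0; pairs, windows and tails get a quarter
   each. *)
pose D0 := delta / 4 * (eta / 8); have D00 : 0 < D0 by rewrite mulr_gt0.
have D4 : 0 < D0 / 4 by rewrite divr_gt0.
pose ks := p1 * Gamma * (6 * (1 + B)).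
have ks0 : 0 <= ks by rewrite !mulr_ge0// ltW.
pose s := D0 / 4 / (ks + 1).
have s0 : 0 < s by rewrite divr_gt0// ltr_wpDl.
have kss : ks * s <= D0 / 4.
  rewrite mulrC -mulrA -[leRHS]mulr1 ler_wpM2l ?(ltW D4)//.
  by rewrite mulrC ler_pdivrMr ?ltr_wpDl// mul1r lerDl.
pose kc := 2 * p1 ^+ 2 * Gamma.
have kc0 : 0 <= kc by rewrite !mulr_ge0// sqr_ge0.
pose c := D0 / 4 / (kc + 1).
have c0 : 0 < c by rewrite divr_gt0// ltr_wpDl.
have kcc : kc * c <= D0 / 4.
  rewrite mulrC -mulrA -[leRHS]mulr1 ler_wpM2l ?(ltW D4)//.
  by rewrite mulrC ler_pdivrMr ?ltr_wpDl// mul1r lerDl.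
have [A A0 PiA] := probability_tail Pi c0.
(* Dominates [A] for the tail of [Pi], and both 1 and C2 / c, so that l^2 c >= l c >= C2. *)
pose l := A + 1 + C2 / c.
have Cc0 : 0 <= C2 / c by rewrite divr_ge0 ?(ltW c0).
have l1 : 1 <= l by rewrite /l addrAC lerDr addr_ge0// ltW.
have l0 : 0 < l by exact: lt_le_trans l1.
have Al : A <= l by rewrite /l -addrA lerDl addr_ge0.
have Cl : C2 / c <= l by rewrite /l lerDr addr_ge0// ltW.
have mtail (a : R) : measurable [set u : R | a < `|u|].
  by apply: measurable_pred; apply: measurable_fun_ltr => //; exact: measurableT_comp.
have PiL : (Pi [set u | (l + 1 < `|u|)%R] <= c%:E)%E.
  apply: le_trans PiA; apply: le_measure.
  - by rewrite inE; exact: mtail.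
  - by rewrite inE; exact: mtail.
  - by move=> u /=; apply: le_lt_trans; rewrite (le_trans Al)// lerDl.
have C2l : C2 <= l ^+ 2 * c.
  have E : C2 / c * c = C2 by rewrite divfK ?gt_eqF.
  rewrite -[leLHS]E ler_wpM2r ?(ltW c0)// (le_trans Cl)//.
  by rewrite expr2 ler_peMr// ltW.
pose Mc := `|kap| * M + p%:R * M ^+ 2.
have small := eventually_small_and part1 (eventually_small_and
  (eventually_small_and (eventually_small_linear (4 * Gamma) djej)
    (eventually_small_linear (p.+3%:R * p1 ^+ 2 * Gamma ^+ 2) D4))
  (eventually_small_and (eventually_small_linear (2 * p%:R * M * (l + 1) + Mc) s0)
    (eventually_small_and (eventually_small_linear 1 ltr01)
      (eventually_small_linear Gamma ltr01)))).
apply: filterS3 nearMa nearMb (eventually_small_inv_sqrt small).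
move=> n Pa Pb [n0 [W1 [[q1 q2] [q3 [q4 q5]]]]] gamma /andP[gamma0 gammaG].
rewrite mul1r in q4; set q := (Num.sqrt n%:R)^-1 in W1 q1 q2 q3 q4 q5.
have nR : 0 < n%:R :> R by rewrite ltr0n.
have sqn : 0 < Num.sqrt n%:R :> R by rewrite sqrtr_gt0.
have q0 : 0 < q by rewrite invr_gt0.
have qn : q ^+ 2 * n%:R = 1 by rewrite exprVn sqr_sqrtr ?(ltW nR)// mulVf ?gt_eqF.
have sqE : Num.sqrt n%:R = q * n%:R.
  by rewrite -[n%:R in RHS]sqr_sqrtr ?(ltW nR)// expr2 mulrA mulVf ?mul1r ?gt_eqF.
pose rate := contamination_rate gamma n.
have gq : gamma * q <= 1.
  by rewrite (le_trans _ q5)// ler_wpM2r ?(ltW q0).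
(* The cap at 1 is inactive for these n, which makes q n rate exactly gamma. *)
have rateE : rate = gamma * q by rewrite /rate /contamination_rate min_r.
have rateG : rate <= Gamma * q by rewrite rateE ler_wpM2r ?(ltW q0).
have rate0 : 0 <= rate by rewrite rateE mulr_ge0 ?(ltW q0).
have qnrate : q * n%:R * rate = gamma.
  rewrite rateE (_ : _ * (gamma * q) = gamma * (q ^+ 2 * n%:R)); last by ring.
  by rewrite qn mulr1.
have ind := indep gamma n gamma0 n0.
have z01 t w : z gamma n t w = 0 \/ z gamma n t w = 1 by exact: z_01.
have zlaw t : P [set w | z gamma n t w = 1] = rate%:E by exact: z_law.
(* Precision 1 is enough: the approximation is used here only to compare truncation levels. *)
have [K HK] := approx n 1 (eta / 8) ltr01 eta8.
have Wa : whp P (eta / 8) (fun w => `|Num.sqrt n%:R * (muhat gamma n w - mu)| <= M).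
  apply: whp_imp (whp_norm_le _ (Pa gamma _)) (lexx _) _.
  - by apply: measurable_funM => //; exact: measurable_funB.
  - by rewrite gamma0.
  - by move=> w /le_trans; exact.
have Wb : whp P (eta / 8) (fun w => forall j,
    `|Num.sqrt n%:R * (betahat gamma n j w - beta j 0)| <= M).
  have Pb' : (P [set w | (Mb < `|\col_j (Num.sqrt n%:R *
      (betahat gamma n j w - beta j 0)) : 'cV[R]_p|)%R] <= (eta / 8)%:E)%E.
    have := Pb gamma; rewrite gamma0 => /(_ gammaG); congr (P _ <= _)%E.
    apply/seteqP; split=> w /=;
      rewrite (_ : _ *: _ = \col_j (Num.sqrt n%:R * (betahat gamma n j w - beta j 0)))//;
      by apply/matrixP => i k; rewrite !mxE (ord1 k).
  apply: whp_imp (whp_mx_norm_le _ Pb') (lexx _) _.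
  - by move=> j; apply: measurable_funM => //; exact: measurable_funB.
  - by move=> w H j; apply: le_trans (H j) MbM.
have W2 : whp P (eta / 8) (fun w => forall j : 'I_p.+1,
    `| q * (\sum_(1 <= k < n.+1) z gamma n (k%:Z - j%:Z) w
      * le_increment x (fun t => eps t w)
          (x + ar_coef0 beta j * xi (k%:Z - j%:Z) w) k%:Z)
    - q * n%:R * rate * shift_effect G x Pi (ar_coef0 beta j) | <= 3 * dj).
  have := @whp_seq _ _ _ P _ (enum 'I_p.+1) (3 * ej) (fun j w =>
    `| q * (\sum_(1 <= k < n.+1) z gamma n (k%:Z - j%:Z) w
      * le_increment x (fun t => eps t w)
          (x + ar_coef0 beta j * xi (k%:Z - j%:Z) w) k%:Z)
    - q * n%:R * rate * shift_effect G x Pi (ar_coef0 beta j) | <= 3 * dj).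
  move=> H; apply: whp_imp (H _) _ _ => [j _||w Hw j].
  - apply: (contamination_lag_whp x ind eps_cdf xi_law z01 zlaw) => //.
    by apply: le_trans q1; rewrite -mulrA ler_wpM2l.
  - rewrite size_enum_ord -/p1 /ej invfM.
    have -> : p1 * (3 * (eta * (24^-1 * p1^-1))) = eta / 8 * (p1 / p1) by field; rewrite gt_eqF.
    by rewrite divff ?mulr1// gt_eqF.
  - by apply: Hw; rewrite mem_enum.
have W3 : whp P (eta / 8) (fun w => q * \sum_(1 <= t < n.+1)
    error_bound_at eps (z gamma n) xi x (ar_psi beta) (ar_coef0 beta) K s l t%:Z w
    <= delta / 4).
  have Eb t := meanle_error_bound x ind eps_cdf eps_var_lty lipG xi_law z01 zlaw
    psi_sum (ar_coef0 beta) K t s0 l0 PiL C2l.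
  have := meanleZ (ltW q0) (meanle_sum (index_iota 1 n.+1) (Q := xpredT)
    (X := fun (t : nat) w => error_bound_at eps (z gamma n) xi x (ar_psi beta)
      (ar_coef0 beta) K s l t%:Z w) (fun t _ => Eb t%:Z)).
  move=> H; apply: (whp_markov H) => //.
  rewrite sumr_const_nat subn1 /= -[(_ + _) *+ n]mulr_natl -/p1 -/D0.
  have p1E : p%:R = p1 - 1 by rewrite /p1 -natr1 addrK.
  rewrite p1E.
  have -> : q * (n%:R * (p.+3%:R * (p1 * (p1 * (rate * rate))) +
      p1 * (3 * (1 + B) * (rate * s) + 3 * (1 + B) * (rate * s) +
        2 * (rate * c + (p1 - 1) * (rate * c))))) =
    p.+3%:R * p1 ^+ 2 * ((q * n%:R * rate) * rate) +
    p1 * (q * n%:R * rate) * (6 * (1 + B)) * s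
    + 2 * p1 ^+ 2 * (q * n%:R * rate) * c by ring.
  rewrite qnrate.
  have h1 : p.+3%:R * p1 ^+ 2 * (gamma * rate) <= D0 / 4.
    apply: le_trans q2; rewrite -[leRHS]mulrA ler_wpM2l ?mulr_ge0 ?sqr_ge0//.
    by rewrite expr2 -mulrA; apply: ler_pM.
  have h2 : p1 * gamma * (6 * (1 + B)) * s <= D0 / 4.
    apply: le_trans kss; rewrite /ks ler_wpM2r ?(ltW s0)// ler_wpM2r ?mulr_ge0//.
    by rewrite ler_wpM2l ?(ltW p10).
  have h3 : 2 * p1 ^+ 2 * gamma * c <= D0 / 4.
    apply: le_trans kcc; rewrite /kc ler_wpM2r ?(ltW c0)//.
    by rewrite ler_wpM2l// mulr_ge0 ?sqr_ge0.
  by clear -h1 h2 h3 D4; lra.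
(* Six of the eight shares of eta are spent; the recursion holds almost surely and costs nothing. *)
apply: (whp_imp (whp_and (whp_and (whp_and Wa Wb) (whp_and (W1 n qn) W2))
  (whp_and (whp_and W3 HK) (centered_recursion nuE v_sol))));
  first by clear -eta0; lra.
move=> w [[[wa wb] [w1 w2]] [[w3 w4] rec]].
pose a := Num.sqrt n%:R * (muhat gamma n w - mu).
pose b j := Num.sqrt n%:R * (betahat gamma n j w - beta j 0).
pose cc := kap * a - q * a * \sum_(j < p) b j.
pose u t := centered v mu t w.
pose full (t : nat) := le_increment x (fun t => eps t w) (full_threshold x u
  (fun t => z gamma n t w) (fun t => xi t w) (ar_coef0 beta) q b cc t%:Z) t%:Z.
pose ar (t : nat) := le_increment x (fun t => eps t w) (ar_threshold x u q b cc t%:Z) t%:Z.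
pose con (t : nat) := contamination_increment x (fun t => eps t w)
  (fun t => z gamma n t w) (fun t => xi t w) (ar_coef0 beta) t%:Z.
have qsq : q * Num.sqrt n%:R = 1 by rewrite mulVf ?gt_eqF.
have edfE : Num.sqrt n%:R * (Ghat gamma n w - Gn n w) = q * \sum_(1 <= t < n.+1) full t.
  rewrite /Ghat /Gn /edf -mulrBr mulrA -sumrB.
  have -> : Num.sqrt n%:R * n%:R^-1 = q.
    by rewrite sqE -mulrA divff ?mulr1 ?gt_eqF.
  congr (_ * _); apply: eq_bigr => t _; rewrite /full /le_increment; congr (_%:R - _).
  congr nat_of_bool.
  apply: (@ar_residual_le R p beta (\col_j betahat gamma n j w) mu
    (muhat gamma n w) a q x (fun t => v t w) (fun t => eps t w)
    (fun t => z gamma n t w) (fun t => xi t w) t%:Z rec) => //.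
  - by rewrite /a mulrA qsq mul1r.
  - by move=> j; rewrite mxE /b mulrA qsq mul1r.
have aM : `|a| <= M by exact: wa.
have bM j : `|b j| <= M by exact: wb.
have ccM : `|cc| <= Mc.
  rewrite /cc; apply: le_trans (ler_normB _ _) _; apply: lerD.
    by rewrite (normrM kap) ler_wpM2l.
  have sb : `|\sum_(j < p) b j| <= p%:R * M.
    rewrite (le_trans (ler_norm_sum _ _ _))//.
    rewrite (le_trans (ler_sum _ (fun j _ => bM j)))//.
    by rewrite sumr_const card_ord mulr_natl.
  rewrite (normrM (q * a)) (normrM q) (gtr0_norm q0) -mulrA.
  apply: (@le_trans _ _ (1 * (M * (p%:R * M)))).
    by apply: (ler_pM (ltW q0) _ q4); [exact: mulr_ge0|apply: ler_pM].
  by rewrite mul1r mulrCA -expr2.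
have E1 : `|q * \sum_(1 <= t < n.+1) (full t - ar t - con t)| <= delta / 4.
  rewrite normrM (gtr0_norm q0); apply: le_trans w3; rewrite ler_wpM2l ?(ltW q0)//.
  apply: le_trans (ler_norm_sum _ _ _) _; rewrite !big_nat; apply: ler_sum => t tn.
  apply: le_trans (error_bound_le xi x z01 (ar_coef0 beta) s l (fun j => w4 t tn j)).
  apply: (@contamination_error R p x (fun t => eps t w) u (fun t => z gamma n t w)
    (fun t => xi t w) (ar_coef0 beta) (fun t => z01 t w) q b cc M Mc) => //.
  - exact: ltW.
  - by rewrite addr_ge0// ltW.
  - by rewrite mulrC.
have E2 := w1 a b aM bM.
have E3 : `|q * \sum_(1 <= t < n.+1) con t - gamma * Delta beta G Pi x| <= delta / 4.
  have -> : q * \sum_(1 <= t < n.+1) con t - gamma * Delta beta G Pi x =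
    \sum_(j < p.+1) (q * (\sum_(1 <= k < n.+1) z gamma n (k%:Z - j%:Z) w
      * le_increment x (fun t => eps t w)
          (x + ar_coef0 beta j * xi (k%:Z - j%:Z) w) k%:Z)
      - q * n%:R * rate * shift_effect G x Pi (ar_coef0 beta j)).
    by rewrite sumrB -!mulr_sumr qnrate /con /contamination_increment exchange_big.
  apply: le_trans (ler_norm_sum _ _ _) _.
  apply: le_trans (ler_sum _ (fun j _ => w2 j)) _.
  rewrite sumr_const card_ord -[(3 * dj) *+ _]mulr_natl -/p1 /dj invfM.
  have -> : p1 * (3 * (delta * (12^-1 * p1^-1))) = delta / 4 * (p1 / p1).
    by field; rewrite gt_eqF.
  by rewrite divff ?mulr1// gt_eqF.
(* Splitting error, outlier-free part and outlier part, each at most delta / 4. *)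
have -> : stat gamma n w = q * \sum_(1 <= t < n.+1) (full t - ar t - con t)
  + (residual_sum x (fun t => eps t w) (fun t => centered v mu t w) n q b
      (kap * a - q * a * \sum_(j < p) b j) - g x * kap * a)
  + (q * \sum_(1 <= t < n.+1) con t - gamma * Delta beta G Pi x).
  have -> : residual_sum x (fun t => eps t w) (fun t => centered v mu t w) n q b
      (kap * a - q * a * \sum_(j < p) b j) = q * \sum_(1 <= t < n.+1) ar t by [].
  have -> : \sum_(1 <= t < n.+1) (full t - ar t - con t) = \sum_(1 <= t < n.+1) full t
      - \sum_(1 <= t < n.+1) ar t - \sum_(1 <= t < n.+1) con t by rewrite -!sumrB.
  by rewrite /stat edfE -/a; ring.
apply: le_trans (ler_normD _ _) _.
apply: (@le_trans _ _ (delta / 4 + delta / 4 + delta / 4)).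
  by apply: lerD E3; exact: le_trans (ler_normD _ _) (lerD E1 E2).
by clear -delta_gt0; lra.
Qed.
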